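(* Let $(M,E)$ be a Finsler space, let $P$ and $Q$ be the hv-curvature and v-curvature of its Cartan connection, and let the index of nullity $\mu_Q$ be constant on an open subset $U$ of $TM$. The nullity distribution $\mathcal{N}_Q$ is completely integrable on $U$ if and only if, for all $X,Y\in\mathcal{N}_Q$, $\mathfrak{R}(X,Y)=0$ and the tensor $$A(X,Y,Z):=-P(F\mathcal{C}(Z,X),Y)-(D_{JX}P)(Y,Z)-(D_{JZ}P)(X,Y),\qquad Z \text{ any vector field on } TM,$$ is symmetric in $X$ and $Y$.
   Context: Setting (Klein–Grifone approach). $M$ is a smooth $n$-dimensional manifold, $\mathcal{T}M\subset TM$ is the bundle of nonzero tangent vectors, and $X,Y,Z$ denote vector fields on $TM$ (objects are smooth on $\mathcal{T}M$). $J$ is the natural almost tangent structure of $TM$ (locally $J\partial_{x^i}=\partial_{y^i}$, $J\partial_{y^i}=0$), $C$ is the Liouville vector field (locally $y^i\partial_{y^i}$), and $V(TM)=\operatorname{Im}J=\ker J$. A Finsler space $(M,E)$ is given by $E:TM\to\mathbb{R}$ with $E>0$ on $\mathcal{T}M$, $E(0)=0$, $E$ of class $C^\infty$ on $\mathcal{T}M$ and $C^1$ on $TM$, $\mathcal{L}_CE=2E$, and $\Omega:=dd_JE$ (where $d_JE=dE\circ J$) of maximal rank. The canonical spray $S$ is defined by $i_S\Omega=-dE$. The Barthel connection is $\Gamma=[J,S]$, i.e. $\Gamma X=[JX,S]-J[X,S]$. Put $h=\frac12(I+\Gamma)$, $v=\frac12(I-\Gamma)$, and $H(TM)=\operatorname{Im}h$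 (rank $n$). The curvature of the Barthel connection is $\mathfrak{R}=-\frac12[h,h]$ (equivalently $\mathfrak{R}(X,Y)=-v[hX,hY]$). The almost complex structure $F$ is defined by $FJ=h$, $Fh=-J$. The metric $g$ is $g(X,Y)=\Omega(X,FY)$, so that $g(JX,JY)=\Omega(JX,Y)$. The Berwald connection $D^\circ$ is the linear connection on $TM$ with $D^\circ_{JX}JY=J[JX,Y]$, $D^\circ_{hX}JY=v[hX,JY]$, $D^\circ F=0$. The first and second Cartan tensors $\mathcal{C},\mathcal{C}'$ are the symmetric semi-basic (vertical-valued) tensors given by $\Omega(\mathcal{C}(X,Y),Z)=\frac12(\mathcal{L}_{JX}(J^*g))(Y,Z)$ and $\Omega(\mathcal{C}'(X,Y),Z)=\frac12(\mathcal{L}_{hX}g)(JY,JZ)$, where $(J^*g)(Y,Z)=g(JY,JZ)$. The Cartan connection $D$ is the linear connection on $TM$ with $D_{JX}JY=D^\circ_{JX}JY+\mathcal{C}(X,Y)$, $D_{hX}JY=D^\circ_{hX}JY+\mathcal{C}'(X,Y)$, $DF=0$. With $K(A,B)=[D_A,D_B]-D_{[A,B]}$ the curvature of $D$, the hv-curvature and v-curvature are $P(X,Y)Z=K(hX,JY)JZ$ and $Q(X,Y)Z=K(JX,JY)JZ$. The nullity space of $Q$ at $z$ is $\mathcal{N}_Q(z)=\{X\in H_z(TM): Q(X,Y)=0\ \forall\,Y\in T_z(TM)\}$, and $\mu_Q(z)=\dim\mathcal{N}_Q(z)$. Where $\mu_Q$ is constant, $z\mapsto\mathcal{N}_Q(z)$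 is the nullity distribution $\mathcal{N}_Q$; $X\in\mathcal{N}_Q$ means that $X$ is a vector field with values in $\mathcal{N}_Q$. Completely integrable means: $X,Y\in\mathcal{N}_Q$ implies $[X,Y]\in\mathcal{N}_Q$. *)

(* Defs.v *)
From mathcomp Require Export all_boot all_order all_algebra.
From mathcomp Require Export all_classical all_reals all_analysis.
Export numFieldNormedType.Exports.
Set Implicit Arguments.
Unset Strict Implicit.
Unset Printing Implicit Defensive.
Export Order.TTheory GRing.Theory Num.Theory.
Local Open Scope classical_set_scope.
Local Open Scope ring_scope.

(* Meant for A open and V finite-dimensional, where it suffices to iterate the
   directional derivatives. *)
Fixpoint Ck (R : realType) (V W : normedModType R) (k : nat) (A : set V)
    (f : V -> W) : Prop :=
  match k with
  | 0 => forall x, A x -> {for x, continuous f}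
  | k'.+1 => (forall x, A x -> differentiable f x) /\
             (forall v, Ck k' A (fun x => 'd f x v))
  end.

Definition Csmooth (R : realType) (V W : normedModType R) (A : set V)
  (f : V -> W) : Prop := forall k, Ck k A f.

(* cphi i is the chart map on the open set cdom i, cpsi i its inverse; the
   values of cphi i outside cdom i and of cpsi i outside the image of the chart
   are irrelevant. *)
Record smooth_manifold (R : realType) (n : nat) := SmoothManifold {
  mpoint :> topologicalType;
  chart : Type;
  cdom : chart -> set mpoint;
  cphi : chart -> mpoint -> 'rV[R]_n;
  cpsi : chart -> 'rV[R]_n -> mpoint;
  hausdorff_mpoint : hausdorff_space mpoint;
  second_countable_mpoint : @second_countable mpoint;
  chart_cover : forall p, exists i, cdom i p;
  open_cdom : forall i, open (cdom i);
  open_cran : forall i, open (cphi i @` cdom i);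
  cphiK : forall i p, cdom i p -> cpsi i (cphi i p) = p;
  continuous_cphi : forall i, {within cdom i, continuous (cphi i)};
  continuous_cpsi : forall i, {within cphi i @` cdom i, continuous (cpsi i)};
  smooth_transition : forall i j,
    Csmooth (cphi i @` (cdom i `&` cdom j)) (cphi j \o cpsi i)
}.

Section TangentBundle.
Context {R : realType} {n : nat} (M : smooth_manifold R n).

(* A tangent vector at p is encoded by its components in one chart around p,
   selected once and for all; changing the selection changes every object
   below by the corresponding coordinate change. *)
Definition chart_at (p : M) : chart M := projT1 (cid (chart_cover p)).

Record TM := TPoint { foot : M; tvec : 'rV[R]_n }.

Definition slitTM : set TM := [set z | tvec z != 0].

(* The chart (x, y) of TM induced by the chart i of M, and its inverse. *)
Definition tphi (i : chart M) (z : TM) : 'rV[R]_n * 'rV[R]_n :=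
  let c := chart_at (foot z) in
  (cphi i (foot z), 'd (cphi i \o cpsi c) (cphi c (foot z)) (tvec z)).

Definition tpsi (i : chart M) (w : 'rV[R]_n * 'rV[R]_n) : TM :=
  let p := cpsi i w.1 in
  TPoint p ('d (cphi (chart_at p) \o cpsi i) (w.1) w.2).

Definition tcoord (i : chart M) (W : set TM) : set ('rV[R]_n * 'rV[R]_n) :=
  [set w | (cphi i @` cdom i) w.1 /\ W (tpsi i w)].

Definition openTM (W : set TM) : Prop := forall i, open (tcoord i W).

End TangentBundle.

Arguments slitTM {R n M}.

(* T_z(TM): components, with respect to the coordinates (x, y) of TM induced
   by the chart selected at foot z. *)
Notation vec R n := ('rV[R]_n * 'rV[R]_n)%type.

Section TangentVectors.
Context {R : realType} {n : nat} {M : smooth_manifold R n}.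
Notation V := (vec R n).
Notation field := (TM M -> V).

Definition tchart (z : TM M) : chart M := chart_at (foot z).

(* Change of components at z from the induced chart i to the induced chart j *)
Definition tchange (i j : chart M) (z : TM M) (a : V) : V :=
  'd (tphi j \o tpsi i) (tphi i z) a.

Definition field_coord (i : chart M) (X : field) (w : V) : V :=
  let z := tpsi i w in tchange (tchart z) i z (X z).

(* Vector fields and functions are total on TM; they are "defined on W" when
   smooth there, and their values elsewhere play no role. *)
Definition smooth_field (W : set (TM M)) (X : field) : Prop :=
  forall i, Csmooth (tcoord i W) (field_coord i X).

Definition smooth_fun (W : set (TM M)) (f : TM M -> R) : Prop :=
  forall i, Csmooth (tcoord i W) (f \o tpsi i).

Definition dfun (f : TM M -> R) (z : TM M) (a : V) : R :=
  'd (f \o tpsi (tchart z)) (tphi (tchart z) z) a.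

Definition bracket (X Y : field) : field := fun z =>
  let i := tchart z in
  'd (field_coord i Y) (tphi i z) (X z) - 'd (field_coord i X) (tphi i z) (Y z).

(* The local vector field around z with constant components in the chart
   selected at z and with value a at z: a tensor given by a formula on vector
   fields is evaluated at tangent vectors by means of these extensions. *)
Definition extend (z : TM M) (a : V) : field :=
  fun z' => tchange (tchart z) (tchart z') z' a.

Definition Jmap (a : V) : V := (0, a.1).

Definition Jf (X : field) : field := fun z => Jmap (X z).

Definition liouville : field := fun z => (0, tvec z).

(* dw(X,Y) = X(w(Y)) - Y(w(X)) - w([X,Y]), where [X,Y] vanishes near z for the
   extensions used here. *)
Definition d1form (w : TM M -> V -> R) (z : TM M) (a b : V) : R :=
  dfun (fun z' => w z' (extend z b z')) z a
  - dfun (fun z' => w z' (extend z a z')) z b.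

Definition app1 (T : TM M -> V -> V) (X : field) : field := fun z => T z (X z).

Definition app2 (T : TM M -> V -> V -> V) (X Y : field) : field :=
  fun z => T z (X z) (Y z).

(* (L_X T)(Y,Z) for a 2-covariant tensor T *)
Definition lie2 (X : field) (T : TM M -> V -> V -> R) (Y Z : field)
    (z : TM M) : R :=
  dfun (fun z' => T z' (Y z') (Z z')) z (X z)
  - T z (bracket X Y z) (Z z) - T z (Y z) (bracket X Z z).

(* Froelicher-Nijenhuis bracket [T,T] of a (1,1) tensor with itself *)
Definition fn_square (T : TM M -> V -> V) (X Y : field) : field := fun z =>
  2 *: (bracket (app1 T X) (app1 T Y) z + T z (T z (bracket X Y z))
        - T z (bracket (app1 T X) Y z) - T z (bracket X (app1 T Y) z)).

Definition linear_connection (D : field -> field -> field) : Prop :=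
  forall W, openTM W -> W `<=` slitTM ->
  forall X X' Y Y' f,
    smooth_field W X -> smooth_field W X' ->
    smooth_field W Y -> smooth_field W Y' -> smooth_fun W f ->
  smooth_field W (D X Y) /\
  forall z, W z ->
  [/\ D (fun t => X t + X' t) Y z = D X Y z + D X' Y z,
      D (fun t => f t *: X t) Y z = f z *: D X Y z,
      D X (fun t => Y t + Y' t) z = D X Y z + D X Y' z
    & D X (fun t => f t *: Y t) z = dfun f z (X z) *: Y z + f z *: D X Y z].

Definition has_dim (A : set V) (k : nat) : Prop :=
  exists2 W : {vspace V}, A = [set a | a \in W] & \dim W = k.

(* The vector satisfying P, when there is exactly one. *)
Definition the_vec (P : set V) : V := xget 0 P.

End TangentVectors.

Section Finsler.
Context {R : realType} {n : nat} {M : smooth_manifold R n}.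
Notation V := (vec R n).
Notation field := (TM M -> V).
Variable E : TM M -> R.

Definition dJ_form (z : TM M) (a : V) : R := dfun E z (Jmap a).

Definition Omega : TM M -> V -> V -> R := d1form dJ_form.

Record finsler : Prop := Finsler {
  finsler_pos : forall z, slitTM z -> 0 < E z;
  finsler_zero : forall p, E (TPoint p 0) = 0;
  finsler_smooth : smooth_fun slitTM E;
  finsler_C1 : forall i, Ck 1 (tcoord i setT) (E \o tpsi i);
  finsler_homog : forall z, dfun E z (liouville z) = 2 * E z;
  finsler_nondeg : forall z, slitTM z ->
    forall a, (forall b, Omega z a b = 0) -> a = 0
}.

Definition spray : field := fun z =>
  the_vec [set s | forall b, Omega z s b = - dfun E z b].

Definition barthel (z : TM M) (a : V) : V :=
  bracket (Jf (extend z a)) spray z - Jmap (bracket (extend z a) spray z).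

Definition hproj (z : TM M) (a : V) : V := 2^-1 *: (a + barthel z a).

Definition vproj (z : TM M) (a : V) : V := 2^-1 *: (a - barthel z a).

Definition horizontal (z : TM M) : set V := range (hproj z).

Definition barthel_curvature (X Y : field) : field :=
  fun z => - 2^-1 *: fn_square hproj X Y z.

(* The almost complex structure: FJ = h and Fh = -J determine it, since
   T_z(TM) is the direct sum of the images of J and h. *)
Definition Fmap (z : TM M) (a : V) : V :=
  the_vec [set f | exists b c,
    a = Jmap b + hproj z c /\ f = hproj z b - Jmap c].

Definition metric (z : TM M) (a b : V) : R := Omega z a (Fmap z b).

Definition Jmetric (z : TM M) (a b : V) : R := metric z (Jmap a) (Jmap b).

(* Vertical-valuedness and symmetry of the Cartan tensors follow from the
   defining relations. *)
Definition cartan1 (z : TM M) (a b : V) : V :=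
  the_vec [set c | forall e, Omega z c e =
    2^-1 * lie2 (Jf (extend z a)) Jmetric (extend z b) (extend z e) z].

Definition cartan2 (z : TM M) (a b : V) : V :=
  the_vec [set c | forall e, Omega z c e =
    2^-1 * lie2 (app1 hproj (extend z a)) metric
             (Jf (extend z b)) (Jf (extend z e)) z].

Notation hf := (app1 hproj).
Notation vf := (app1 vproj).
Notation Ff := (app1 Fmap).

Definition berwald_connection (D0 : field -> field -> field) : Prop :=
  linear_connection D0 /\
  forall W, openTM W -> W `<=` slitTM ->
  forall X Y, smooth_field W X -> smooth_field W Y ->
  forall z, W z ->
  [/\ D0 (Jf X) (Jf Y) z = Jf (bracket (Jf X) Y) z,
      D0 (hf X) (Jf Y) z = vf (bracket (hf X) (Jf Y)) z
    & D0 X (Ff Y) z = Ff (D0 X Y) z].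

Definition cartan_connection (D0 D : field -> field -> field) : Prop :=
  linear_connection D /\
  forall W, openTM W -> W `<=` slitTM ->
  forall X Y, smooth_field W X -> smooth_field W Y ->
  forall z, W z ->
  [/\ D (Jf X) (Jf Y) z = D0 (Jf X) (Jf Y) z + app2 cartan1 X Y z,
      D (hf X) (Jf Y) z = D0 (hf X) (Jf Y) z + app2 cartan2 X Y z
    & D X (Ff Y) z = Ff (D X Y) z].

Section Curvatures.
Variable D : field -> field -> field.

Definition curvature (A B Z : field) : field := fun z =>
  D A (D B Z) z - D B (D A Z) z - D (bracket A B) Z z.

Definition hv_curv (X Y Z : field) : field := curvature (hf X) (Jf Y) (Jf Z).

Definition v_curv (X Y Z : field) : field := curvature (Jf X) (Jf Y) (Jf Z).

Definition D_hv_curv (A X Y W : field) : field := fun z =>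
  D A (hv_curv X Y W) z - hv_curv (D A X) Y W z
  - hv_curv X (D A Y) W z - hv_curv X Y (D A W) z.

Definition nullityQ (z : TM M) : set V :=
  [set a | horizontal z a /\
     forall b c, v_curv (extend z a) (extend z b) (extend z c) z = 0].

Definition in_nullityQ (W : set (TM M)) (X : field) : Prop :=
  smooth_field W X /\ forall z, W z -> nullityQ z (X z).

Definition nullityQ_integrable (W : set (TM M)) : Prop :=
  forall X Y, in_nullityQ W X -> in_nullityQ W Y -> in_nullityQ W (bracket X Y).

(* The endomorphism A(X,Y,Z) applied to T *)
Definition Atensor (X Y Z T : field) : field := fun z =>
  - hv_curv (Ff (app2 cartan1 Z X)) Y T z
  - D_hv_curv (Jf X) Y Z T z - D_hv_curv (Jf Z) X Y T z.

End Curvatures.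
End Finsler.

(* Main.v *)
From HB Require Import structures.
From mathcomp Require Import perm ring lra.
Require Import Defs.
Local Open Scope classical_set_scope.
Local Open Scope ring_scope.
Set Implicit Arguments.
Unset Strict Implicit.
Unset Printing Implicit Defensive.

(** The identity behind the theorem is
      [Q([X, Y], Z) T = A(Y, X, Z) T - A(X, Y, Z) T]  for [X], [Y] in the nullity
    distribution of [Q] ([v_curv_bracket]), together with
      [R(X, Y) = h [X, Y] - [X, Y]]  for horizontal [X], [Y]
    ([barthel_curvature_horizontal]). Membership of [[X, Y]] in the nullity
    distribution means that [[X, Y]] is horizontal and that [Q([X, Y], _) _]
    vanishes; the first condition is [R(X, Y) = 0] and the second is the symmetry
    of [A] in [X] and [Y]. The fields [Z], [T] on which the symmetry is tested
    are smooth on all nonzero tangent vectors, and [Q] is evaluated at vectors: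
    [Q] being a tensor ([v_curv_tensorial]), it suffices that each vector is the
    value of such a field ([global_extension], by a bump function on the base).

    The first identity comes from the second Bianchi identity of the Cartan
    connection [D] on [X], [J Y], [J Z] ([bianchi_nullity]). There
    [D_(JY) X = h [J Y, X] + F C(Y, X)], by the definition of [D] and [DF = 0],
    and the curvature of two vertical fields vanishes as soon as one of them is
    [J X] or [J Y]. So the identity expresses the curvature of [v [X, J Y]] and
    [J Z] by the hv-curvature [P], its derivatives and its values on [F C]. As
    the Barthel connection has no weak torsion, [J [X, Y]] is
    [v [X, J Y] - v [Y, J X]] ([weak_torsion]), and the skew part in [X] and [Y]
    is the claim ([nullity_bracket]). This is formal: it uses the Jacobi
    identity, [[J, J] = 0], the relations between [J], [h] and [F], and that the
    first Cartan tensor is symmetric and vertical while [D_(hX) J Y] is vertical.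
    It is carried out in an abelian group with operators, and then applied to
    the group of vector fields on an open set.

    The other parts prove that these relations hold: [J S = C] and the smoothness
    of the spray give the properties of the Barthel connection, and the first
    Cartan tensor is given by the third vertical derivatives of [E], from which
    its symmetry follows ([cartan1C]). *)

(** * Differential calculus in several variables *)

(** The product rule is that of this bilinear map. *)
Definition scale_by (R : realType) (W : normedModType R) (k : R) (v : W) : W :=
  k *: v.

Fact scale_by_bilinear (R : realType) (W : normedModType R) :
  bilinear_for
    (GRing.Scale.Law.clone _ _ *:%R _) (GRing.Scale.Law.clone _ _ *:%R _)
    (@scale_by R W : R -> W -> W).
Proof.
split=> [v|k] a u w; rewrite /scale_by /=.
  by rewrite scalerDl [RHS]addrC scalerA addrC.
by rewrite scalerDr !scalerA mulrC.
Qed.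

HB.instance Definition _ (R : realType) (W : normedModType R) :=
  bilinear_isBilinear.Build R R W W _ _ (@scale_by R W) (@scale_by_bilinear R W).

Section Differentials.
Context {R : realType}.

(** A name for the differential that can be kept opaque: comparing two
    derivatives then does not unfold the functions under them. *)
Definition der (V W : normedModType R) (f : V -> W) (x v : V) : W := 'd f x v.

Definition has_der (V W : normedModType R) (f : V -> W) (x : V) : Prop :=
  differentiable f x.

Lemma der_linear (V W : normedModType R) (f : V -> W) (x : V) : linear (der f x).
Proof. by move=> a u v; rewrite /der linearP. Qed.

Lemma derD (V W : normedModType R) (f : V -> W) (x u v : V) :
  der f x (u + v) = der f x u + der f x v.
Proof. by rewrite /der raddfD. Qed.

Lemma derB (V W : normedModType R) (f : V -> W) (x u v : V) :
  der f x (u - v) = der f x u - der f x v.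
Proof. by rewrite /der raddfB. Qed.

Lemma der0 (V W : normedModType R) (f : V -> W) (x : V) : der f x 0 = 0.
Proof. by rewrite /der raddf0. Qed.

Lemma derZ (V W : normedModType R) (f : V -> W) (x u : V) (a : R) :
  der f x (a *: u) = a *: der f x u.
Proof. by rewrite /der; exact: linearZ. Qed.

Lemma has_der_continuous (V W : normedModType R) (f : V -> W) (x : V) :
  has_der f x -> {for x, continuous f}.
Proof. exact: differentiable_continuous. Qed.

(** The first-order expansion of [f] at [x] is also one of [g], and its linear
    part is unique. *)
Lemma near_eq_der (V W : normedModType R) (f g : V -> W) (x : V) :
  (\near x, f x = g x) -> has_der f x ->
  has_der g x /\ der g x = der f x.
Proof.
move=> fg df; have fgx : f x = g x := nbhs_singleton fg.
have H : g \o shift x = cst (g x) + 'd f x +o_ 0 id.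
  have /eqaddoP Hf := diff_locally df.
  apply/eqaddoP => e e0; have := Hf e e0.
  have fg0 : \forall h \near 0, f (h + x) = g (h + x).
    move: fg; rewrite (near_shift 0 x) => fg; near=> h.
    by rewrite -[x]subr0; near: h.
  move=> He; near=> h.
  have -> : (g \o shift x - (cst (g x) + 'd f x)) h =
     (f \o shift x - (cst (f x) + 'd f x)) h.
    by rewrite !fctE /= fgx; congr (_ - _); apply/esym; near: h.
  by near: h.
have dE : 'd g x = 'd f x :> (V -> W).
  by apply: diff_unique => //; apply: diff_continuous.
split=> //; apply/diff_locallyP; split.
  by rewrite dE; apply: diff_continuous.
by rewrite dE.
Unshelve. all: by end_near. Qed.

Lemma der_eq_on (V W : normedModType R) (A : set V) (f g : V -> W) (x : V) :
  open A -> A x -> (forall y, A y -> f y = g y) -> has_der f x ->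
  has_der g x /\ der g x = der f x.
Proof.
move=> oA Ax fg; apply: near_eq_der.
by near=> y; apply: fg; near: y; apply: open_nbhs_nbhs.
Unshelve. all: by end_near. Qed.

Lemma der_cst (V W : normedModType R) (c : W) (x : V) :
  has_der (fun _ : V => c) x /\ der (fun _ : V => c) x = fun=> 0.
Proof.
split; first exact: differentiable_cst.
by apply/funext => v; rewrite /der (diff_cst c x).
Qed.

Lemma der_id (V : normedModType R) (x : V) :
  has_der (fun y : V => y) x /\ der (fun y : V => y) x = id.
Proof.
split; first exact: (ex_diff (is_diff_def := is_diff_id x)).
by apply/funext => v; rewrite /der (@diff_val _ _ _ _ _ _ _ (is_diff_id x)).
Qed.

Lemma der_scale (V W : normedModType R) (k : V -> R) (f : V -> W) (x : V) :
  has_der k x -> has_der f x ->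
  has_der (fun y => k y *: f y) x /\
  der (fun y => k y *: f y) x = fun v => k x *: der f x v + der k x v *: f x.
Proof.
move=> dk df; have dkf := differentiable_pair dk df.
have cs : continuous (fun p : R * W => scale_by p.1 p.2).
  exact: scale_continuous.
have ds := differentiable_bilin (k x, f x) cs.
split; first exact: (differentiable_comp dkf ds).
rewrite /der (diff_comp dkf ds) (diff_bilin (k x, f x) cs).
by rewrite (diff_pair dk df).
Qed.

Lemma der_add (V W : normedModType R) (f g : V -> W) (x : V) :
  has_der f x -> has_der g x ->
  has_der (fun y => f y + g y) x /\
  der (fun y => f y + g y) x = fun v => der f x v + der g x v.
Proof.
by move=> df dg; split; [exact: differentiableD | exact: (diffD df dg)].
Qed.

Lemma der_comp (U V W : normedModType R) (f : U -> V) (g : V -> W) (x : U) :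
  has_der f x -> has_der g (f x) ->
  has_der (fun y => g (f y)) x /\
  der (fun y => g (f y)) x = fun v => der g (f x) (der f x v).
Proof.
move=> df dg; split; first exact: (differentiable_comp df dg).
exact: (diff_comp df dg).
Qed.

Lemma der_lin (V W : normedModType R) (l : {linear V -> W}) (x : V) :
  continuous l -> has_der l x /\ der l x = l.
Proof.
move=> cl; split; first exact: linear_differentiable.
by apply/funext => v; rewrite /der diff_lin.
Qed.

Lemma der_pair (V W W' : normedModType R) (f : V -> W) (g : V -> W') (x : V) :
  has_der f x -> has_der g x ->
  has_der (fun y => (f y, g y)) x /\
  der (fun y => (f y, g y)) x = fun v => (der f x v, der g x v).
Proof.
by move=> df dg; split; [exact: differentiable_pair | exact: (diff_pair df dg)].
Qed.

Lemma der_inv (V : normedModType R) (f : V -> R) (x : V) :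
  has_der f x -> f x != 0 ->
  has_der (fun y => (f y)^-1) x /\
  der (fun y => (f y)^-1) x = fun v => - f x ^- 2 * der f x v.
Proof.
by move=> df f0; split; [exact: differentiableV | exact: (diffV df f0)].
Qed.

Lemma der_derive1 (f : R -> R) (x : R) (df : R) :
  is_derive x 1 f df -> has_der f x /\ der f x = fun v => v * df.
Proof.
move=> dfx; have d1 : derivable f x 1 by exact: ex_derive.
split; first exact/derivable1_diffP.
apply/funext => v; rewrite /der deriv1E//.
by rewrite derive1E derive_val.
Qed.

Lemma is_derive_line (V : normedModType R) (f : V -> R) (p u : V) (s : R) :
  has_der f (p + s *: u) ->
  is_derive s 1 (fun t : R => f (p + t *: u)) (der f (p + s *: u) u).
Proof.
move=> df.
have dl : is_diff s (fun t : R => p + t *: u) (fun t : R => t *: u).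
  have : is_diff s (cst p + *:%R ^~ u) (0 + *:%R ^~ u) by apply: is_diffD.
  by move/is_diff_eq; apply; apply/funext => t; rewrite !fctE add0r.
have dc := is_diff_comp dl (differentiableP df).
apply: DeriveDef; first exact/derivable1_diffP/ex_diff.
have d1 := @ex_diff _ _ _ _ _ _ _ dc.
by rewrite (deriveE _ d1) (@diff_val _ _ _ _ _ _ _ dc) /= scale1r.
Qed.

Lemma CkS (V W : normedModType R) k (A : set V) (f : V -> W) :
  Ck k.+1 A f <->
  (forall x, A x -> has_der f x) /\ (forall v, Ck k A (fun x => der f x v)).
Proof. by []. Qed.

End Differentials.

#[local] Opaque der has_der Ck.

Section Calculus.
Context {R : realType}.

Lemma Ck_sub (V W : normedModType R) k (A B : set V) (f : V -> W) :
  B `<=` A -> Ck k A f -> Ck k B f.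
Proof.
move=> BA; elim: k f => [|k IH] f; first by move=> fA x /BA; apply: fA.
by move=> /CkS[fA fk]; apply/CkS; split=> [x /BA|v]; [apply: fA | apply/IH/fk].
Qed.

Lemma CkW (V W : normedModType R) k (A : set V) (f : V -> W) :
  Ck k.+1 A f -> Ck k A f.
Proof.
elim: k f => [|k IH] f /CkS[dA fk].
  by move=> x /dA; apply: has_der_continuous.
by apply/CkS; split=> // v; apply: IH; apply: fk.
Qed.

Lemma Ck_cont (V W : normedModType R) k (A : set V) (f : V -> W) x :
  Ck k A f -> A x -> {for x, continuous f}.
Proof.
elim: k => [|k IH] fA Ax; [exact: fA | apply: IH Ax; exact: CkW fA].
Qed.

Lemma Ck_der (V W : normedModType R) k (A : set V) (f : V -> W) v :
  Ck k.+1 A f -> Ck k A (fun x => der f x v).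
Proof. by move/CkS => [_]; apply. Qed.

Lemma Ck_has_der (V W : normedModType R) k (A : set V) (f : V -> W) x :
  Ck k.+1 A f -> A x -> has_der f x.
Proof. by move/CkS => [+ _]; apply. Qed.

Lemma Ck_local (V W : normedModType R) k (A : set V) (f : V -> W) :
  (forall x, A x -> exists2 B, B x & Ck k B f) -> Ck k A f.
Proof.
elim: k f => [|k IH] f H; first by move=> x /H[B Bx]; apply.
apply/CkS; split=> [x /H[B Bx /CkS[]]|v]; first by move=> + _; apply.
by apply: IH => x /H[B Bx fk]; exists B => //; apply: Ck_der.
Qed.

Lemma Ck_ext (V W : normedModType R) k (A : set V) (f g : V -> W) :
  open A -> (forall x, A x -> f x = g x) -> Ck k A f -> Ck k A g.
Proof.
move=> oA; elim: k f g => [|k IH] f g fg.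
  move=> fA x Ax; have := fA x Ax.
  rewrite /continuous_at /prop_for (fg x Ax) => fAx; apply: cvg_trans fAx.
  apply: near_eq_cvg.
  by near=> y; rewrite -fg//; near: y; apply: open_nbhs_nbhs.
move=> /CkS[dA fk]; apply/CkS; split=> [x Ax|v].
  by have [] := der_eq_on oA Ax fg (dA x Ax).
apply: IH (fk v) => x Ax.
by rewrite (der_eq_on oA Ax fg (dA x Ax)).2.
Unshelve. all: by end_near. Qed.

Lemma Ck_cst (V W : normedModType R) k (A : set V) (c : W) :
  Ck k A (fun _ : V => c).
Proof.
elim: k c => [|k IH] c; first by move=> x _; apply: cst_continuous.
apply/CkS; split=> [x _|v]; first exact: (der_cst c x).1.
suff -> : (fun x : V => der (fun _ : V => c) x v) = fun _ => 0 by apply: IH.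
by apply/funext => x; rewrite (der_cst c x).2.
Qed.

Lemma Ck_id (V : normedModType R) k (A : set V) : Ck k A (fun x : V => x).
Proof.
case: k => [|k]; first by move=> x _; exact: cvg_id.
apply/CkS; split=> [x _|v]; first exact: (der_id x).1.
have -> : (fun x => der (fun y : V => y) x v) = (fun=> v).
  by apply/funext => x; rewrite (der_id x).2.
exact: Ck_cst.
Qed.

Lemma Ck_add (V W : normedModType R) k (A : set V) (f g : V -> W) :
  open A -> Ck k A f -> Ck k A g -> Ck k A (fun x => f x + g x).
Proof.
move=> oA; elim: k f g => [|k IH] f g.
  by move=> fA gA x Ax; apply: continuousD; [apply: fA | apply: gA].
move=> /CkS[fA fk] /CkS[gA gk]; apply/CkS; split=> [x Ax|v].
  exact: (der_add (fA x Ax) (gA x Ax)).1.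
apply: Ck_ext (IH _ _ (fk v) (gk v)) => // x Ax.
by rewrite (der_add (fA x Ax) (gA x Ax)).2.
Qed.

Lemma Ck_sum (V W : normedModType R) k (A : set V) (I : Type) (r : seq I)
    (P : pred I) (F : I -> V -> W) :
  open A -> (forall i, Ck k A (F i)) -> Ck k A (fun x => \sum_(i <- r | P i) F i x).
Proof.
move=> oA FA; elim: r => [|i r IH].
  have -> : (fun x => \sum_(i <- [::] | P i) F i x) = fun=> 0.
    by apply/funext => x; rewrite big_nil.
  exact: Ck_cst.
case Pi : (P i).
  have -> : (fun x => \sum_(j <- i :: r | P j) F j x) =
            fun x => F i x + \sum_(j <- r | P j) F j x.
    by apply/funext => x; rewrite big_cons Pi.
  exact: Ck_add.
have -> : (fun x => \sum_(j <- i :: r | P j) F j x) =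
          fun x => \sum_(j <- r | P j) F j x.
  by apply/funext => x; rewrite big_cons Pi.
exact: IH.
Qed.

Lemma Ck_scale (V W : normedModType R) k (A : set V) (a : V -> R) (f : V -> W) :
  open A -> Ck k A a -> Ck k A f -> Ck k A (fun x => a x *: f x).
Proof.
move=> oA; elim: k a f => [|k IH] a f.
  by move=> aA fA x Ax; apply: continuousZ; [apply: aA | apply: fA].
move=> aS fS; have aS' := CkW aS; have fS' := CkW fS.
move: aS fS => /CkS[aA ak] /CkS[fA fk]; apply/CkS; split=> [x Ax|v].
  exact: (der_scale (aA x Ax) (fA x Ax)).1.
apply: Ck_ext (Ck_add oA (IH _ _ aS' (fk v)) (IH _ _ (ak v) fS')) => // x Ax.
by rewrite (der_scale (aA x Ax) (fA x Ax)).2.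
Qed.

Lemma Ck_mul (V : normedModType R) k (A : set V) (f g : V -> R) :
  open A -> Ck k A f -> Ck k A g -> Ck k A (fun x => f x * g x).
Proof. exact: (@Ck_scale V R). Qed.

Lemma Ck_prod (V : normedModType R) k (A : set V) (I : Type) (r : seq I)
    (F : I -> V -> R) :
  open A -> (forall i, Ck k A (F i)) -> Ck k A (fun x => \prod_(i <- r) F i x).
Proof.
move=> oA FA; elim: r => [|i r IH].
  have -> : (fun x => \prod_(i <- [::]) F i x) = fun=> 1.
    by apply/funext => x; rewrite big_nil.
  exact: Ck_cst.
have -> : (fun x => \prod_(j <- i :: r) F j x) =
          fun x => F i x * \prod_(j <- r) F j x.
  by apply/funext => x; rewrite big_cons.
exact: Ck_mul.
Qed.

Lemma Ck_inv (V : normedModType R) k (A : set V) (f : V -> R) :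
  open A -> (forall x, A x -> f x != 0) -> Ck k A f -> Ck k A (fun x => (f x)^-1).
Proof.
move=> oA fN; elim: k => [|k IH] fk.
  by move=> x Ax; apply: continuousV; [apply: fN | apply: fk].
have IH' := IH (CkW fk); move/CkS: fk => [df fk].
apply/CkS; split=> [x Ax|v]; first exact: (der_inv (df x Ax) (fN x Ax)).1.
have H : Ck k A (fun x => -1 * ((f x)^-1 * (f x)^-1) * der f x v).
  apply: Ck_mul => //; apply: Ck_mul => //; first exact: Ck_cst.
  exact: Ck_mul.
apply: Ck_ext H => // x Ax.
by rewrite (der_inv (df x Ax) (fN x Ax)).2 mulN1r -exprVn expr2.
Qed.

Lemma Ck_pair (V W W' : normedModType R) k (A : set V) (f : V -> W) (g : V -> W') :
  open A -> Ck k A f -> Ck k A g -> Ck k A (fun x => (f x, g x)).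
Proof.
move=> oA; elim: k f g => [|k IH] f g.
  by move=> fA gA x Ax; apply: cvg_pair; [apply: fA | apply: gA].
move=> /CkS[fA fk] /CkS[gA gk]; apply/CkS; split=> [x Ax|v].
  exact: (der_pair (fA x Ax) (gA x Ax)).1.
apply: Ck_ext (IH _ _ (fk v) (gk v)) => // x Ax.
by rewrite (der_pair (fA x Ax) (gA x Ax)).2.
Qed.

Lemma der_lin_comp (V W W' : normedModType R) (l : {linear W -> W'})
    (f : V -> W) (x : V) :
  continuous l -> has_der f x ->
  has_der (fun y => l (f y)) x /\ der (fun y => l (f y)) x = fun v => l (der f x v).
Proof.
move=> cl df; have [dl lE] := der_lin (f x) cl.
by have [H ->] := der_comp df dl; rewrite lE.
Qed.

Lemma Ck_lin (V W W' : normedModType R) k (A : set V) (l : {linear W -> W'})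
    (f : V -> W) :
  continuous l -> open A -> Ck k A f -> Ck k A (fun x => l (f x)).
Proof.
move=> cl oA; elim: k f => [|k IH] f.
  by move=> fA x Ax; apply: continuous_comp; [apply: fA | apply: cl].
move=> /CkS[fA fk]; apply/CkS; split=> [x Ax|v].
  exact: (der_lin_comp cl (fA x Ax)).1.
apply: Ck_ext (IH _ (fk v)) => // x Ax.
by rewrite (der_lin_comp cl (fA x Ax)).2.
Qed.

(** On a space with a finite frame and continuous coordinate forms, a derivative
    in a variable direction is a combination of derivatives in fixed directions,
    the only ones that [Ck] iterates. *)
Definition framed (V : normedModType R) : Prop :=
  exists (I : finType) (e : I -> V) (l : I -> {linear V -> R}),
    (forall j, continuous (l j)) /\ forall v, v = \sum_j l j v *: e j.

Lemma framed_real : framed R.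
Proof.
exists unit, (fun=> 1), (fun=> idfun); split; first by move=> _ x.
by move=> v; rewrite (big_pred1 tt) => [|[]//]; rewrite /= [_ *: _]mulr1.
Qed.

Definition rV_coord n (j : 'I_n) (v : 'rV[R]_n) : R := v 0 j.

Lemma rV_coord_linear n (j : 'I_n) : linear (rV_coord j).
Proof. by move=> a u v; rewrite /rV_coord !mxE. Qed.

HB.instance Definition _ n (j : 'I_n) := GRing.isLinear.Build R 'rV[R]_n R
  *%R (rV_coord j) (rV_coord_linear j).

Lemma framed_rV n : framed 'rV[R]_n.
Proof.
exists 'I_n, (fun j => delta_mx 0 j), (@rV_coord n); split=> [j|v] /=.
  exact: coord_continuous.
by rewrite [LHS]row_sum_delta.
Qed.

Lemma continuous_fst (V W : normedModType R) : continuous (fst : (V * W)%type -> V).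
Proof. by move=> x; exact: cvg_fst. Qed.

Lemma continuous_snd (V W : normedModType R) : continuous (snd : (V * W)%type -> W).
Proof. by move=> x; exact: cvg_snd. Qed.

Lemma framed_pair (V W : normedModType R) :
  framed V -> framed W -> framed (V * W)%type.
Proof.
move=> [I [e [l [lc lE]]]] [I' [e' [l' [lc' lE']]]].
pose L (j : I + I') : {linear (V * W)%type -> R} :=
  match j with inl i => l i \o fst | inr i => l' i \o snd end.
exists (I + I')%type,
  (fun j => match j with inl i => (e i, 0) | inr i => (0, e' i) end), L.
split=> [[i|i] x|[v w]].
- by apply: continuous_comp; [exact: cvg_fst | exact: lc].
- by apply: continuous_comp; [exact: cvg_snd | exact: lc'].
rewrite big_sumType /=; apply/pair_equal_spec; split.
  rewrite raddf_sum /= [X in _ = _ + X]raddf_sum /= [X in _ + X]big1 ?addr0//.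
  by move=> i _; rewrite scaler0.
rewrite raddf_sum /= [X in _ = _ + X]raddf_sum /= [X in X + _]big1 ?add0r//.
by move=> i _; rewrite scaler0.
Qed.

Lemma der_sum (V W : normedModType R) (I : finType) (g : I -> V -> W) (x : V) :
  (forall j, has_der (g j) x) ->
  has_der (fun y => \sum_j g j y) x /\
  der (fun y => \sum_j g j y) x = fun v => \sum_j der (g j) x v.
Proof.
move=> dg; elim: (index_enum I) => [|i r [IHd IHe]].
  have -> : (fun y => \sum_(j <- [::]) g j y) = fun=> 0.
    by apply/funext => y; rewrite big_nil.
  have [H ->] := der_cst (0 : W) x; split=> //.
  by apply/funext => v; rewrite big_nil.
have -> : (fun y => \sum_(j <- i :: r) g j y) =
          fun y => g i y + \sum_(j <- r) g j y.
  by apply/funext => y; rewrite big_cons.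
have [dD ->] := der_add (dg i) IHd; split=> //.
by apply/funext => v; rewrite big_cons IHe.
Qed.

Lemma der_framed (V W : normedModType R) (f : V -> W) (I : finType) (e : I -> V)
    (l : I -> {linear V -> R}) (x v : V) :
  (forall v, v = \sum_j l j v *: e j) ->
  der f x v = \sum_j l j v *: der f x (e j).
Proof.
move=> lE; rewrite {1}(lE v).
rewrite (big_morph (der f x) (derD f x) (der0 f x)).
by apply: eq_bigr => j _; rewrite derZ.
Qed.

Lemma Ck_der_apply (V W : normedModType R) k (A : set V) (f : V -> W)
    (X : V -> V) :
  framed V -> open A -> Ck k.+1 A f -> Ck k A X -> Ck k A (fun x => der f x (X x)).
Proof.
move=> [I [e [l [lc lE]]]] oA fk Xk.
have -> : (fun x => der f x (X x)) = fun x => \sum_j l j (X x) *: der f x (e j).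
  by apply/funext => x; apply: der_framed.
apply: Ck_sum => // j; apply: Ck_scale => //; last exact: Ck_der.
by apply: (Ck_lin (lc j)).
Qed.

(** Leibniz rule for the pairing of a derivative with a variable vector: expand
    the vector in a frame. *)
Lemma der_der_apply (V W : normedModType R) (A : set V) (f : V -> W)
    (X : V -> V) (x : V) :
  framed V -> open A -> A x -> Ck 2 A f -> has_der X x ->
  has_der (fun y => der f y (X y)) x /\
  der (fun y => der f y (X y)) x =
    fun v => der (fun y => der f y (X x)) x v + der f x (der X x v).
Proof.
move=> [I [e [l [lc lE]]]] oA Ax fk dX.
have df j : has_der (fun y => der f y (e j)) x by apply: Ck_has_der (Ck_der (e j) fk) Ax.
have dfX : der (fun y => der f y (X x)) x =
    fun v => \sum_j l j (X x) *: der (fun y => der f y (e j)) x v.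
  have -> : (fun y => der f y (X x)) = fun y => \sum_j l j (X x) *: der f y (e j).
    by apply/funext => y; apply: der_framed.
  have dsf j := der_scale (der_cst (l j (X x)) x).1 (df j).
  rewrite (der_sum (fun j => (dsf j).1)).2; apply/funext => v; apply: eq_bigr => j _.
  by rewrite (dsf j).2 (der_cst _ _).2 scale0r addr0.
have -> : (fun y => der f y (X y)) = fun y => \sum_j l j (X y) *: der f y (e j).
  by apply/funext => y; apply: der_framed.
have dl j := der_lin_comp (lc j) dX.
have ds j := der_scale (dl j).1 (df j).
have [dS ->] := der_sum (fun j => (ds j).1); split=> //; apply/funext => v.
rewrite dfX (der_framed _ _ _ lE) -big_split /=; apply: eq_bigr => j _.
by rewrite (ds j).2 (dl j).2.
Qed.

Lemma Ck_comp (U V W : normedModType R) k (A : set U) (B : set V) (f : U -> V)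
    (g : V -> W) :
  framed V -> open A -> (forall x, A x -> B (f x)) ->
  Ck k A f -> Ck k B g -> Ck k A (fun x => g (f x)).
Proof.
move=> [I [e [l [lc lE]]]] oA AB; elim: k g => [|k IH] g fk gk.
  by move=> x Ax; apply: continuous_comp; [apply: fk | apply/gk/AB].
have dg x : A x -> has_der g (f x).
  by move=> Ax; apply: Ck_has_der gk (AB x Ax).
have df x : A x -> has_der f x by apply: Ck_has_der fk.
apply/CkS; split=> [x Ax|v]; first exact: (der_comp (df x Ax) (dg x Ax)).1.
have H : Ck k A (fun x => \sum_j l j (der f x v) *: der g (f x) (e j)).
  apply: Ck_sum => // j; apply: Ck_scale => //.
    by apply: (Ck_lin (lc j)) => //; apply: Ck_der.
  by apply: (IH (fun y => der g y (e j))); [exact: CkW | exact: Ck_der].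
apply: Ck_ext H => // x Ax.
by rewrite -(der_framed g (f x) (der f x v) lE) (der_comp (df x Ax) (dg x Ax)).2.
Qed.

Lemma Ck_minus (V W : normedModType R) k (A : set V) (f g : V -> W) :
  open A -> Ck k A f -> Ck k A g -> Ck k A (fun x => f x - g x).
Proof.
move=> oA fk gk; have ck := @Ck_cst V R k A (-1).
apply: Ck_ext (Ck_add oA fk (Ck_scale oA ck gk)) => // x _.
by rewrite scaleN1r.
Qed.

(** * Symmetry of second derivatives *)

Lemma mean_value (f df : R -> R) (h : R) : 0 < h ->
  (forall s, 0 <= s <= h -> is_derive s 1 f (df s)) ->
  exists2 s, 0 <= s <= h & f h - f 0 = df s * h.
Proof.
move=> h0 fP.
have [s||s] := @MVT_segment R f df 0 h (ltW h0).
- by rewrite in_itv /= => /andP[s0 sh]; apply: fP; rewrite !ltW.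
- apply: derivable_within_continuous => s; rewrite in_itv /= => /fP ds.
  exact: ex_derive.
- by rewrite in_itv /= subr0 => sh E; exists s.
Qed.

(** The mean value theorem along [u], then along [v]. *)
Lemma second_difference (V : normedModType R) (A : set V) (f : V -> R)
    (x u v : V) (h : R) :
  Ck 2 A f -> 0 < h ->
  (forall s t, 0 <= s <= h -> 0 <= t <= h -> A (x + s *: u + t *: v)) ->
  exists s t, [/\ 0 <= s <= h, 0 <= t <= h &
    f (x + h *: u + h *: v) - f (x + h *: u) - (f (x + h *: v) - f x) =
    der (fun y => der f y u) (x + s *: u + t *: v) v * h * h].
Proof.
move=> f2 h0 HA; have df y : A y -> has_der f y.
  exact: Ck_has_der f2.
have h00 : 0 <= h <= h by rewrite lexx ltW.
have z00 : (0:R) <= 0 <= h by rewrite lexx ltW.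
pose phi (s : R) := f (x + h *: v + s *: u) - f (x + s *: u).
pose dphi (s : R) := der f (x + h *: v + s *: u) u - der f (x + s *: u) u.
have dphiP s : 0 <= s <= h -> is_derive s 1 phi (dphi s).
  move=> sh; apply: is_deriveB; apply: is_derive_line; apply: df.
    by rewrite addrAC; apply: HA.
  by rewrite -[X in A X]addr0 -(scale0r v); apply: HA.
have [s sh Es] := mean_value h0 dphiP.
pose psi (t : R) := der f (x + s *: u + t *: v) u.
pose dpsi (t : R) := der (fun y => der f y u) (x + s *: u + t *: v) v.
have dpsiP t : 0 <= t <= h -> is_derive t 1 psi (dpsi t).
  move=> th; apply: (@is_derive_line _ _ (fun y => der f y u)).
  by apply: Ck_has_der (Ck_der u f2) _; apply: HA.
have [t th Et] := mean_value h0 dpsiP.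
exists s, t; split=> //.
move: Es Et; rewrite /phi /dphi /psi /dpsi !scale0r !addr0 => Es Et.
by rewrite -Et (addrAC _ (s *: u)) -Es (addrAC _ (h *: v)).
Qed.

(** The second difference at scale [h] is [h ^ 2] times a value, at a nearby
    point, of the second derivative taken in either order; let [h] tend to 0. *)
Lemma der_derC_real (V : normedModType R) (A : set V) (f : V -> R) (x u v : V) :
  open A -> A x -> Ck 2 A f ->
  der (fun y => der f y u) x v = der (fun y => der f y v) x u.
Proof.
move=> oA Ax f2.
pose D1 y := der (fun y => der f y u) y v; pose D2 y := der (fun y => der f y v) y u.
have c1 : {for x, continuous D1} by exact: Ck_cont (Ck_der v (Ck_der u f2)) Ax.
have c2 : {for x, continuous D2} by exact: Ck_cont (Ck_der u (Ck_der v f2)) Ax.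
apply/eqP; rewrite -subr_eq0 -normr_le0; apply/ler_addgt0Pr => _/posnumP[e].
rewrite add0r -/(D1 x) -/(D2 x).
have : \forall y \near x, [/\ A y, `|D1 x - D1 y| < e%:num / 2 & `|D2 x - D2 y| < e%:num / 2].
  near=> y; split.
  - by near: y; apply: open_nbhs_nbhs.
  - by near: y; apply: cvgr_dist_lt c1 _ _.
  - by near: y; apply: cvgr_dist_lt c2 _ _.
move=> /nbhs_ballP[r /= r0 Hr].
pose N := `|u| + `|v| + 1; have N0 : 0 < N by rewrite ltr_wpDl ?addr_ge0.
pose h := r / 2 / N; have h0 : 0 < h by rewrite !divr_gt0.
have Hb s t : 0 <= s <= h -> 0 <= t <= h -> ball x r (x + s *: u + t *: v).
  move=> /andP[s0 sh] /andP[t0 th]; rewrite -ball_normE /ball_ /=.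
  rewrite -addrA opprD addrA subrr add0r normrN.
  apply: le_lt_trans (ler_normD _ _) _; rewrite !normrZ !ger0_norm//.
  have : s * `|u| + t * `|v| <= h * N.
    rewrite /N !mulrDr mulr1; apply: le_trans (_ : h * `|u| + h * `|v| <= _).
      by apply: lerD; apply: ler_wpM2r.
    by rewrite lerDl ltW.
  by move/le_lt_trans; apply; rewrite /h divfK ?gt_eqF// gtr_pMr// invf_lt1 ?ltr1n.
have [s [t [sh th E1]]] := second_difference f2 h0
  (fun s t sh th => let: And3 a _ _ := Hr _ (Hb s t sh th) in a).
have Hb' s' t' : 0 <= s' <= h -> 0 <= t' <= h -> ball x r (x + s' *: v + t' *: u).
  by move=> sh' th'; rewrite addrAC; apply: Hb.
have [s' [t' [sh' th' E2]]] := second_difference f2 h0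
  (fun s t sh th => let: And3 a _ _ := Hr _ (Hb' s t sh th) in a).
have E : D1 (x + s *: u + t *: v) = D2 (x + s' *: v + t' *: u).
  apply: (mulIf (lt0r_neq0 h0)); apply: (mulIf (lt0r_neq0 h0)).
  rewrite -[LHS]E1 -[RHS]E2 (addrAC _ (h *: v)).
  ring.
have [_ l1 _] := Hr _ (Hb s t sh th); have [_ _ l2] := Hr _ (Hb' s' t' sh' th').
rewrite (_ : D1 x - D2 x =
  (D1 x - D1 (x + s *: u + t *: v)) - (D2 x - D2 (x + s' *: v + t' *: u))); last first.
  by rewrite E opprB addrA subrK.
apply: le_trans (ler_normB _ _) _; rewrite [leRHS]splitr; apply: lerD; exact: ltW.
Unshelve. all: by end_near. Qed.

Lemma der_derC (V W : normedModType R) (A : set V) (f : V -> W) (x u v : V) :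
  framed W -> open A -> A x -> Ck 2 A f ->
  der (fun y => der f y u) x v = der (fun y => der f y v) x u.
Proof.
move=> [I [e [l [lc lE]]]] oA Ax f2.
rewrite [LHS]lE [RHS]lE; apply: eq_bigr => j _; congr (_ *: _).
have lf u' v' : l j (der (fun y => der f y u') x v') =
               der (fun y => der (fun y => l j (f y)) y u') x v'.
  have d2 := Ck_has_der (Ck_der u' f2) Ax.
  have [dl dlE] := der_lin_comp (lc j) d2.
  have E y : A y -> l j (der f y u') = der (fun y => l j (f y)) y u'.
    by move=> Ay; rewrite (der_lin_comp (lc j) (Ck_has_der f2 Ay)).2.
  by rewrite (der_eq_on oA Ax E dl).2 dlE.
by rewrite !lf; apply: (@der_derC_real _ A) => //; apply: Ck_lin.
Qed.

End Calculus.

(** * The tangent bundle in coordinates *)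

Section TangentMaps.
Context {R : realType}.

Lemma Ck_linear (V W : normedModType R) k (A : set V) (l : {linear V -> W}) :
  open A -> continuous l -> Ck k A l.
Proof. by move=> oA cl; apply: (Ck_lin cl oA (Ck_id _ A)). Qed.

Lemma Ck_fst (V W : normedModType R) k (A : set (V * W)) : open A ->
  Ck k A (fst : V * W -> V).
Proof.
move=> oA.
exact: (@Ck_linear (V * W)%type V k A fst oA (@continuous_fst R V W)).
Qed.

Lemma Ck_snd (V W : normedModType R) k (A : set (V * W)) : open A ->
  Ck k A (snd : V * W -> W).
Proof.
move=> oA.
exact: (@Ck_linear (V * W)%type W k A snd oA (@continuous_snd R V W)).
Qed.

Lemma der_fst (V W : normedModType R) (w : V * W) :
  has_der (fst : V * W -> V) w /\ der (fst : V * W -> V) w = fst.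
Proof. exact: (@der_lin R (V * W)%type V fst w (@continuous_fst R V W)). Qed.

Lemma der_snd (V W : normedModType R) (w : V * W) :
  has_der (snd : V * W -> W) w /\ der (snd : V * W -> W) w = snd.
Proof. exact: (@der_lin R (V * W)%type W snd w (@continuous_snd R V W)). Qed.

Lemma der_fst_comp (V V' W : normedModType R) (f : V -> W) (w : V * V') :
  has_der f w.1 ->
  has_der (fun z : V * V' => f z.1) w /\
  der (fun z : V * V' => f z.1) w = fun a => der f w.1 a.1.
Proof.
move=> df; have [d1 E1] := der_fst w.
by have [d2 ->] := der_comp d1 df; rewrite E1.
Qed.

Lemma open_fst (V V' : normedModType R) (A : set V) : open A ->
  open [set w : V * V' | A w.1].
Proof. by move=> oA; apply: (open_comp _ oA) => x _; apply: continuous_fst. Qed.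

(** The tangent map of [f]: the chart changes of the tangent bundle are the
    tangent maps of those of the base. *)
Definition tangent_map (V W : normedModType R) (f : V -> W) (w : V * V) : W * W :=
  (f w.1, der f w.1 w.2).

(** The fibre component is the derivative of [f \o fst] in the variable
    direction [(w.2, 0)]. *)
Lemma Ck_tangent_map (V W : normedModType R) k (A : set V) (f : V -> W) :
  framed V -> open A -> Ck k.+1 A f ->
  Ck k [set w : V * V | A w.1] (tangent_map f).
Proof.
move=> fV oA fk; have oA' := open_fst (V' := V) oA.
have f1 : Ck k.+1 [set w : V * V | A w.1] (fun w => f w.1).
  by apply: (@Ck_comp _ _ _ _ k.+1 _ A fst f) => //; apply: Ck_fst.
apply: Ck_pair => //; first exact: CkW.
have h : Ck k [set w : V * V | A w.1] (fun w => (w.2, 0 : V)).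
  by apply: Ck_pair => //; [exact: Ck_snd | exact: Ck_cst].
apply: Ck_ext (Ck_der_apply (framed_pair fV fV) oA' f1 h) => // w Aw.
by rewrite (der_fst_comp (V' := V) (Ck_has_der fk Aw)).2.
Qed.

Lemma der_tangent_map (V W : normedModType R) (A : set V) (f : V -> W)
    (w a : V * V) :
  framed V -> open A -> A w.1 -> Ck 2 A f ->
  der (tangent_map f) w a =
  (der f w.1 a.1, der (fun x => der f x w.2) w.1 a.1 + der f w.1 a.2).
Proof.
move=> fV oA Aw fk; have oA' := open_fst (V' := V) oA.
have f1 : Ck 2 [set w : V * V | A w.1] (fun w => f w.1).
  by apply: (@Ck_comp _ _ _ _ 2 _ A fst f) => //; apply: Ck_fst.
pose X (w : V * V) := (w.2, 0 : V).
have [dX EX] := der_pair (der_snd w).1 (der_cst (0 : V) w).1.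
have [d1 E1] := der_der_apply (framed_pair fV fV) oA' Aw f1 dX.
have E0 b (y : V * V) : A y.1 -> der (fun w : V * V => f w.1) y (b, 0) = der f y.1 b.
  by move=> Ay; rewrite (der_fst_comp (V' := V) (Ck_has_der fk Ay)).2.
have [d2 E2] := der_eq_on oA' Aw (fun y => E0 y.2 y) d1.
have [d3 E3] := der_fst_comp (V' := V) (Ck_has_der fk Aw).
have [_ ->] := der_pair d3 d2.
rewrite E3 E2 E1 EX E3 (der_snd w).2; congr (_, _ + _).
have [d4 E4] := der_fst_comp (V' := V) (Ck_has_der (Ck_der w.2 fk) Aw).
by have [_ ->] := der_eq_on oA' Aw (fun y Ay => esym (E0 w.2 y Ay)) d4; rewrite E4.
Qed.

End TangentMaps.

Section Charts.
Context {R : realType} {n : nat} {M : smooth_manifold R n}.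
Notation V := (vec R n).
Implicit Types (i j k : chart M) (x : 'rV[R]_n) (w a b : V) (z : TM M).

Lemma framed_rVn : framed 'rV[R]_n. Proof. exact: framed_rV. Qed.

Lemma framed_vec : framed V. Proof. exact: framed_pair framed_rVn framed_rVn. Qed.

Definition cran i : set 'rV[R]_n := cphi i @` cdom i.

Lemma cranP i x : cran i x -> cdom i (cpsi i x) /\ cphi i (cpsi i x) = x.
Proof. by case=> p ip <-; rewrite cphiK. Qed.

Lemma cran_cphi i (p : M) : cdom i p -> cran i (cphi i p).
Proof. by exists p. Qed.

Definition overlap i j : set 'rV[R]_n := [set x | cran i x /\ cdom j (cpsi i x)].

Lemma open_cpsi_preimage i (O : set M) : open O ->
  open [set x | cran i x /\ O (cpsi i x)].
Proof.
move=> oO; have oi := @open_cran _ _ M i.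
have ci := @continuous_cpsi _ _ M i; rewrite continuous_open_subspace// in ci.
rewrite openE => x [xi xO]; rewrite /interior.
have nO : nbhs x (cpsi i @^-1` O).
  by apply: (ci x _ O); [rewrite inE | apply: open_nbhs_nbhs].
have ni : nbhs x (cran i) by apply: open_nbhs_nbhs.
by near=> y; split; near: y.
Unshelve. all: by end_near. Qed.

Lemma open_overlap i j : open (overlap i j).
Proof. exact: open_cpsi_preimage (open_cdom j). Qed.

Definition transition i j (x : 'rV[R]_n) : 'rV[R]_n := cphi j (cpsi i x).

Lemma smooth_overlap i j (r : nat) : Ck r (overlap i j) (transition i j).
Proof.
apply: Ck_sub (@smooth_transition _ _ M i j r) => x [[p ip <-] jp].
by exists p => //; split => //; rewrite cphiK in jp.
Qed.

Lemma transition_overlap i j x : overlap i j x -> overlap j i (transition i j x).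
Proof.
move=> [/cranP[xi xE] xj]; split; first exact: cran_cphi.
by rewrite /transition cphiK.
Qed.

Lemma transition_comp i j k x : overlap i j x ->
  transition j k (transition i j x) = transition i k x.
Proof. by move=> [_ xj]; rewrite /transition cphiK. Qed.

Lemma der_transition_comp i j k x v : overlap i j x -> overlap i k x ->
  der (transition j k) (transition i j x) (der (transition i j) x v) =
  der (transition i k) x v.
Proof.
move=> xj xk.
have dij := Ck_has_der (smooth_overlap i j 1) xj.
have xjk : overlap j k (transition i j x).
  split; first by apply: cran_cphi; case: xj.
  by rewrite /transition cphiK; [case: xk | case: xj].
have djk := Ck_has_der (smooth_overlap j k 1) xjk.
have [dc E] := der_comp dij djk.
have Ec y : overlap i j y -> transition j k (transition i j y) = transition i k y.
  exact: transition_comp.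
by have [_ ->] := der_eq_on (@open_overlap i j) xj Ec dc; rewrite E.
Qed.

Lemma transition_id i x : cran i x -> transition i i x = x.
Proof. by case/cranP. Qed.

Lemma overlap_id i x : cran i x -> overlap i i x.
Proof. by move=> xi; split=> //; case/cranP: xi. Qed.

Lemma der_transition_id i x v : cran i x -> der (transition i i) x v = v.
Proof.
move=> xi; have [d1 E1] := der_id x.
have E y : cran i y -> y = transition i i y by move/transition_id.
by have [_ ->] := der_eq_on (@open_cran _ _ M i) xi E d1; rewrite E1.
Qed.

(** Change of the induced coordinates of the tangent bundle. *)
Definition ttrans i j : V -> V := tangent_map (transition i j).

Definition tover i j : set V := [set w | overlap i j w.1].

Lemma open_tover i j : open (tover i j).
Proof. exact: (open_fst (@open_overlap i j)). Qed.

Lemma smooth_ttrans i j (r : nat) : Ck r (tover i j) (ttrans i j).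
Proof.
exact: (@Ck_tangent_map _ _ _ r _ _ framed_rVn (@open_overlap i j) (smooth_overlap i j r.+1)).
Qed.

Lemma tphi_tpsi i j w : tover i j w -> tphi j (tpsi i w) = ttrans i j w.
Proof.
move=> wij; have [wi wj] := wij.
rewrite /tphi /tpsi /ttrans /tangent_map /=; congr (_, _).
set p := cpsi i w.1; set c := chart_at p.
have pc : cdom c p by exact: (projT2 (cid (chart_cover p))).
have wc : overlap i c w.1 by [].
exact: (der_transition_comp w.2 wc wij).
Qed.

Lemma tpsiK i w : cran i w.1 -> tphi i (tpsi i w) = w.
Proof.
move=> wi; rewrite tphi_tpsi; last exact: overlap_id.
by rewrite /ttrans /tangent_map transition_id// der_transition_id//; case: (w).
Qed.

Definition Tdom i : set (TM M) := [set z | cdom i (foot z)].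

Lemma Tdom_tchart z : Tdom (tchart z) z.
Proof. exact: (projT2 (cid (chart_cover (foot z)))). Qed.

Lemma tpsi_Tdom i w : cran i w.1 -> Tdom i (tpsi i w).
Proof. by case/cranP. Qed.

Lemma tphi_cran i z : Tdom i z -> cran i (tphi i z).1.
Proof. exact: cran_cphi. Qed.

Lemma tphiK i z : Tdom i z -> tpsi i (tphi i z) = z.
Proof.
case: z => p y; rewrite /Tdom /= => ip.
rewrite /tpsi /tphi /= cphiK//; congr TPoint.
set c := chart_at p; have pc : cdom c p by exact: (projT2 (cid (chart_cover p))).
have x1 : overlap c i (cphi c p) by split; [exact: cran_cphi | rewrite cphiK].
have x2 : overlap c c (cphi c p) by apply: overlap_id; apply: cran_cphi.
have E1 := der_transition_comp y x1 x2.
have E2 := der_transition_id y (cran_cphi pc).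
have E3 : transition c i (cphi c p) = cphi i p by rewrite /transition cphiK.
move: (etrans E1 E2); rewrite E3; exact.
Qed.

Lemma tphi_tover i j z : Tdom i z -> Tdom j z -> tover i j (tphi i z).
Proof. by move=> zi zj; split; [exact: tphi_cran | rewrite /= cphiK]. Qed.

Lemma ttrans_tphi i j z : Tdom i z -> Tdom j z -> ttrans i j (tphi i z) = tphi j z.
Proof. by move=> zi zj; rewrite -tphi_tpsi ?tphiK//; apply: tphi_tover. Qed.

Lemma tpsi_ttrans i j w : tover i j w -> tpsi j (ttrans i j w) = tpsi i w.
Proof. by move=> wij; rewrite -tphi_tpsi// tphiK//; case: wij. Qed.

Lemma ttrans_tover i j w : tover i j w -> tover j i (ttrans i j w).
Proof. exact: transition_overlap. Qed.

Lemma openTM_Tdom i : openTM (Tdom i).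
Proof. by move=> j; exact: (@open_tover j i). Qed.

Lemma openTM_I (W W' : set (TM M)) : openTM W -> openTM W' -> openTM (W `&` W').
Proof.
move=> oW oW' i.
have -> : tcoord i (W `&` W') = tcoord i W `&` tcoord i W'.
  by apply/seteqP; split=> [w [wi [? ?]]|w [[wi ?] [_ ?]]].
exact: openI.
Qed.

Lemma tcoord_tphi i (W : set (TM M)) z : Tdom i z -> W z -> tcoord i W (tphi i z).
Proof. by move=> zi Wz; split; [exact: tphi_cran | rewrite tphiK]. Qed.

Lemma tchangeE i j z a : Tdom i z -> Tdom j z ->
  tchange i j z a = der (ttrans i j) (tphi i z) a.
Proof.
move=> zi zj; have w := tphi_tover zi zj.
have d1 := Ck_has_der (smooth_ttrans i j 1) w.
have E y : tover i j y -> ttrans i j y = tphi j (tpsi i y).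
  by move=> yij; rewrite /= tphi_tpsi.
by have [_ <-] := der_eq_on (@open_tover i j) w E d1.
Qed.

Lemma tchange_comp i j k z a : Tdom i z -> Tdom j z -> Tdom k z ->
  tchange j k z (tchange i j z a) = tchange i k z a.
Proof.
move=> zi zj zk; rewrite !tchangeE//.
have dij := Ck_has_der (smooth_ttrans i j 1) (tphi_tover zi zj).
have djk := Ck_has_der (smooth_ttrans j k 1) (tphi_tover zj zk).
rewrite -(ttrans_tphi zi zj) in djk.
have [dc Ec] := der_comp dij djk.
rewrite -{1}(ttrans_tphi zi zj); apply: etrans (esym (congr1 (@^~ a) Ec)) _.
have oI : open (tover i j `&` tover i k) by apply: openI; apply: open_tover.
have E w : (tover i j `&` tover i k) w -> ttrans j k (ttrans i j w) = ttrans i k w.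
  move=> [wij wik]; rewrite -(tphi_tpsi wik) -(tpsi_ttrans wij) tphi_tpsi//.
  split; first exact: (ttrans_tover wij).1.
  by rewrite /ttrans /tangent_map /transition /= cphiK//; [case: wik | case: wij].
by have [_ ->] := der_eq_on oI (conj (tphi_tover zi zj) (tphi_tover zi zk)) E dc.
Qed.

Lemma tchange_id i z a : Tdom i z -> tchange i i z a = a.
Proof.
move=> zi; rewrite tchangeE//.
have oi : open [set w : V | cran i w.1] by apply: open_fst; apply: open_cran.
have [d1 E1] := der_id (tphi i z).
have E (y : V) : cran i y.1 -> y = ttrans i i y.
  by move=> yi; rewrite -tphi_tpsi ?tpsiK//; apply: overlap_id.
by have [_ ->] := der_eq_on oi (tphi_cran zi) E d1; rewrite E1.
Qed.

Lemma der_ttrans i j w a : tover i j w ->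
  der (ttrans i j) w a =
  (der (transition i j) w.1 a.1,
   der (fun x => der (transition i j) x w.2) w.1 a.1 + der (transition i j) w.1 a.2).
Proof.
move=> wij.
exact: (der_tangent_map a framed_rVn (@open_overlap i j) wij (smooth_overlap i j 2)).
Qed.

Lemma tchange_Jmap i j z a : Tdom i z -> Tdom j z ->
  tchange i j z (Jmap a) = Jmap (tchange i j z a).
Proof.
move=> zi zj; have w := tphi_tover zi zj; rewrite !tchangeE// !der_ttrans//.
by rewrite /Jmap /= !der0 add0r.
Qed.

Lemma tchangeD i j z a b : tchange i j z (a + b) = tchange i j z a + tchange i j z b.
Proof. exact: (@derD R V V). Qed.

Lemma tchangeZ i j z (c : R) a : tchange i j z (c *: a) = c *: tchange i j z a.
Proof. by exact: (@derZ R V V). Qed.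

Lemma tchange0 i j z : tchange i j z 0 = 0.
Proof. exact: (@der0 R V V). Qed.

Lemma tvec_tpsi i w : tvec (tpsi i w) = der (transition i (tchart (tpsi i w))) w.1 w.2.
Proof. by []. Qed.

Lemma tvec_tpsi_eq0 i w : cran i w.1 -> (tvec (tpsi i w) == 0) = (w.2 == 0).
Proof.
move=> wi; rewrite tvec_tpsi; set c := tchart _.
have zc : Tdom c (tpsi i w) := Tdom_tchart _.
have wc : overlap i c w.1 by split.
have wi' : overlap i i w.1 by apply: overlap_id.
apply/eqP/eqP => [E|->]; last by rewrite der0.
by rewrite -(der_transition_id w.2 wi) -(der_transition_comp w.2 wc wi') E der0.
Qed.

Lemma tphi_snd i z : Tdom i z ->
  (tphi i z).2 = der (transition (tchart z) i) (cphi (tchart z) (foot z)) (tvec z).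
Proof. by []. Qed.

Lemma tphi_fst i z : (tphi i z).1 = cphi i (foot z). Proof. by []. Qed.

Lemma tphi_self z : (tphi (tchart z) z).2 = tvec z.
Proof.
rewrite tphi_snd; last exact: Tdom_tchart.
by rewrite der_transition_id//; apply: cran_cphi; exact: Tdom_tchart.
Qed.

End Charts.

#[local] Opaque tpsi tphi ttrans tchange transition.

(** * Vector fields and their brackets *)

Section Fields.
Context {R : realType} {n : nat} {M : smooth_manifold R n}.
Notation V := (vec R n).
Notation field := (TM M -> V).
Implicit Types (i j : chart M) (w a b : V) (z : TM M) (X Y Z : field)
  (f : TM M -> R) (W : set (TM M)).

Lemma tchangeK i j z a : Tdom i z -> Tdom j z -> tchange j i z (tchange i j z a) = a.
Proof. by move=> zi zj; rewrite tchange_comp// tchange_id. Qed.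

Lemma JmapD a b : Jmap (a + b) = Jmap a + Jmap b.
Proof. by rewrite /Jmap /=; congr pair; rewrite /= addr0. Qed.

Lemma JmapB a b : Jmap (a - b) = Jmap a - Jmap b.
Proof. by rewrite /Jmap /=; congr pair; rewrite /= subr0. Qed.

Lemma JmapZ (k : R) a : Jmap (k *: a) = k *: Jmap a.
Proof. by rewrite /Jmap /=; congr pair; rewrite /= scaler0. Qed.

Lemma Jmap0 : Jmap (0 : V) = 0. Proof. by []. Qed.

Lemma JmapJ a : Jmap (Jmap a) = 0. Proof. by []. Qed.

Lemma Jmap_image a : Jmap a = 0 -> a = Jmap (a.2, 0).
Proof. by case: a => x y [-> ]. Qed.

Lemma Ck_Jmap (A : set V) (xi : V -> V) k :
  open A -> Ck k A xi -> Ck k A (fun w => Jmap (xi w)).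
Proof.
move=> oA xk; apply: Ck_pair => //; first exact: Ck_cst.
by apply: (@Ck_comp _ _ _ _ k A setT xi fst framed_vec) => //; apply: Ck_fst; apply: openT.
Qed.

Lemma der_Jmap (xi : V -> V) w : has_der xi w ->
  has_der (fun u => Jmap (xi u)) w /\
  der (fun u => Jmap (xi u)) w = fun v => Jmap (der xi w v).
Proof.
move=> d; have [d1 E1] := der_comp d (der_fst (xi w)).1.
have [d2 ->] := der_pair (der_cst (0 : 'rV[R]_n) w).1 d1; split=> //.
by apply/funext => v; rewrite (der_cst _ w).2 E1 (der_fst _).2.
Qed.

Lemma field_coord_tphi i X z : Tdom i z ->
  field_coord i X (tphi i z) = tchange (tchart z) i z (X z).
Proof. by move=> zi; rewrite /field_coord tphiK. Qed.

Lemma field_coord_self X z : field_coord (tchart z) X (tphi (tchart z) z) = X z.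
Proof.
by rewrite field_coord_tphi ?tchange_id//; exact: Tdom_tchart.
Qed.

Lemma field_coord_change i j X w : tover i j w ->
  field_coord j X (ttrans i j w) = der (ttrans i j) w (field_coord i X w).
Proof.
move=> wij; have [wi wj] := wij.
have zi : Tdom i (tpsi i w) := tpsi_Tdom wi.
have zc := Tdom_tchart (tpsi i w).
have E a : der (ttrans i j) w a = tchange i j (tpsi i w) a.
  by rewrite (tchangeE a zi wj) (tpsiK wi).
by rewrite E /field_coord (tpsi_ttrans wij) (tchange_comp _ zc zi wj).
Qed.

Lemma field_eq_coord i X Y z : Tdom i z ->
  field_coord i X (tphi i z) = field_coord i Y (tphi i z) -> X z = Y z.
Proof.
move=> zi; rewrite !field_coord_tphi// => /(congr1 (tchange i (tchart z) z)).
by rewrite !tchangeK//; exact: Tdom_tchart.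
Qed.

Lemma tcoord_sub W W' i : W `<=` W' -> tcoord i W `<=` tcoord i W'.
Proof. by move=> WW w [wi Ww]; split=> //; apply: WW. Qed.

Lemma smooth_field_sub W W' X : W `<=` W' -> smooth_field W' X -> smooth_field W X.
Proof. by move=> WW sX i k; apply: Ck_sub (sX i k); apply: tcoord_sub. Qed.

Lemma tcoord_tover W i j w : tcoord i (W `&` Tdom j) w -> tover i j w.
Proof. by case=> wi [_ wj]. Qed.

Lemma tcoord_ttrans W i j w : tcoord i (W `&` Tdom j) w ->
  tcoord j (W `&` Tdom i) (ttrans i j w).
Proof.
move=> H; have wij := tcoord_tover H; case: H => wi [Ww wj].
split; first exact: (ttrans_tover wij).1.
by rewrite tpsi_ttrans//; split=> //; apply: tpsi_Tdom.
Qed.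

Lemma open_tcoord_I W i j : openTM W -> open (tcoord i (W `&` Tdom j)).
Proof. by move=> oW; have := openTM_I oW (@openTM_Tdom _ _ _ j); apply. Qed.

Lemma ttransK i j w : tover i j w -> ttrans j i (ttrans i j w) = w.
Proof.
move=> wij; rewrite -(tphi_tpsi (ttrans_tover wij)) tpsi_ttrans// tpsiK//.
by case: wij.
Qed.

(** The components in two charts differ by the derivative of the chart change,
    which is smooth. *)
Lemma smooth_field_local W X : openTM W ->
  (forall z, W z -> exists i W', [/\ openTM W', W' z, Tdom i z &
     forall k, Ck k (tcoord i W') (field_coord i X)]) ->
  smooth_field W X.
Proof.
move=> oW H j k; apply: Ck_local => w [wj Ww].
have [i [W' [oW' W'z zi Xk]]] := H _ Ww.
exists (tcoord j (W' `&` Tdom i)); first by split.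
have oB : open (tcoord j (W' `&` Tdom i)) by exact: open_tcoord_I.
have oB' : open (tcoord i (W' `&` Tdom j)) by exact: open_tcoord_I.
have H1 : Ck k (tcoord i (W' `&` Tdom j))
    (fun v => der (ttrans i j) v (field_coord i X v)).
  have hT : Ck k.+1 (tcoord i (W' `&` Tdom j)) (ttrans i j).
    by apply: Ck_sub (smooth_ttrans i j k.+1) => v; apply: tcoord_tover.
  have hX : Ck k (tcoord i (W' `&` Tdom j)) (field_coord i X).
    by apply: Ck_sub (Xk k); apply: tcoord_sub => ? [].
  exact: (Ck_der_apply framed_vec oB' hT hX).
have H2 : Ck k (tcoord j (W' `&` Tdom i)) (ttrans j i).
  by apply: Ck_sub (smooth_ttrans j i k) => v; apply: tcoord_tover.
have H3 := Ck_comp framed_vec oB (fun v => @tcoord_ttrans W' j i v) H2 H1.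
apply: (Ck_ext oB _ H3) => v /tcoord_tover vji.
rewrite -(field_coord_change _ (ttrans_tover vji)).
by rewrite (ttransK vji).
Qed.

Lemma smooth_fun_local W f : openTM W ->
  (forall z, W z -> exists i W', [/\ openTM W', W' z, Tdom i z &
     forall k, Ck k (tcoord i W') (f \o tpsi i)]) ->
  smooth_fun W f.
Proof.
move=> oW H j k; apply: Ck_local => w [wj Ww].
have [i [W' [oW' W'z zi Xk]]] := H _ Ww.
exists (tcoord j (W' `&` Tdom i)); first by split.
have oB : open (tcoord j (W' `&` Tdom i)) by exact: open_tcoord_I.
have H1 : Ck k (tcoord i (W' `&` Tdom j)) (f \o tpsi i).
  by apply: Ck_sub (Xk k); apply: tcoord_sub => ? [].
have H2 : Ck k (tcoord j (W' `&` Tdom i)) (ttrans j i).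
  by apply: Ck_sub (smooth_ttrans j i k) => v; apply: tcoord_tover.
have H3 := Ck_comp framed_vec oB (fun v => @tcoord_ttrans W' j i v) H2 H1.
apply: (Ck_ext oB _ H3) => v /tcoord_tover vji.
by rewrite /= (tpsi_ttrans vji).
Qed.

Lemma smooth_field_eq W X Y : openTM W -> (forall z, W z -> X z = Y z) ->
  smooth_field W X -> smooth_field W Y.
Proof.
move=> oW XY sX i k; apply: Ck_ext (sX i k); first exact: oW.
by move=> w [_ Ww]; rewrite /field_coord XY.
Qed.

Definition chart_field i (xi : V -> V) : field :=
  fun z => tchange i (tchart z) z (xi (tphi i z)).

Lemma chart_fieldE i xi w : cran i w.1 -> field_coord i (chart_field i xi) w = xi w.
Proof.
move=> wi; rewrite /field_coord /chart_field tpsiK// tchangeK//.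
  exact: tpsi_Tdom.
exact: Tdom_tchart.
Qed.

Lemma smooth_chart_field W i (xi : V -> V) : openTM W -> W `<=` Tdom i ->
  (forall k, Ck k (tcoord i W) xi) -> smooth_field W (chart_field i xi).
Proof.
move=> oW Wi xk; apply: smooth_field_local => // z Wz.
exists i, W; split=> // [|k]; first exact: Wi.
by apply: Ck_ext (xk k); [exact: oW | move=> w [wi _]; rewrite chart_fieldE].
Qed.

Lemma extendE z a : extend z a = chart_field (tchart z) (fun=> a).
Proof. by []. Qed.

Lemma extend_at z a : extend z a z = a.
Proof. by rewrite /extend tchange_id//; exact: Tdom_tchart. Qed.

Lemma extend_coord z a w : cran (tchart z) w.1 ->
  field_coord (tchart z) (extend z a) w = a.
Proof. by move=> wi; rewrite extendE chart_fieldE. Qed.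

Lemma smooth_extend W z a : openTM W -> W `<=` Tdom (tchart z) ->
  smooth_field W (extend z a).
Proof.
by move=> oW Wz; apply: smooth_chart_field => // k; apply: Ck_cst.
Qed.

Lemma smooth_field_add W X Y : openTM W -> smooth_field W X -> smooth_field W Y ->
  smooth_field W (fun z => X z + Y z).
Proof.
move=> oW sX sY i k; apply: Ck_ext (Ck_add (oW i) (sX i k) (sY i k)); first exact: oW.
by move=> w _; rewrite /field_coord tchangeD.
Qed.

Lemma smooth_field_scale W f X : openTM W -> smooth_fun W f -> smooth_field W X ->
  smooth_field W (fun z => f z *: X z).
Proof.
move=> oW sf sX i k; apply: Ck_ext (Ck_scale (oW i) (sf i k) (sX i k)); first exact: oW.
by move=> w _; rewrite /field_coord tchangeZ.
Qed.

Lemma smooth_fun_cst W (c : R) : smooth_fun W (fun=> c).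
Proof. by move=> i k; apply: Ck_cst. Qed.

Lemma smooth_field0 W : smooth_field W (fun=> 0).
Proof.
move=> i k.
rewrite (_ : field_coord i _ = fun=> 0); first exact: Ck_cst.
by apply/funext => w; rewrite /field_coord tchange0.
Qed.

Lemma smooth_fieldZ W (c : R) X : openTM W -> smooth_field W X ->
  smooth_field W (fun z => c *: X z).
Proof. by move=> oW; apply: smooth_field_scale => //; apply: smooth_fun_cst. Qed.

Lemma smooth_fieldB W X Y : openTM W -> smooth_field W X -> smooth_field W Y ->
  smooth_field W (fun z => X z - Y z).
Proof.
move=> oW sX sY; apply: smooth_field_eq (smooth_field_add oW sX (smooth_fieldZ (-1) oW sY)) => // z _.
by rewrite scaleN1r.
Qed.

Lemma field_coord_Jf i X w : cran i w.1 ->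
  field_coord i (Jf X) w = Jmap (field_coord i X w).
Proof.
move=> wi; rewrite /field_coord tchange_Jmap//; first exact: Tdom_tchart.
exact: tpsi_Tdom.
Qed.

Lemma smooth_Jf W X : openTM W -> smooth_field W X -> smooth_field W (Jf X).
Proof.
move=> oW sX i k; apply: Ck_ext (Ck_Jmap (oW i) (sX i k)); first exact: oW.
by move=> w [wi _]; rewrite field_coord_Jf.
Qed.

Lemma field_has_der W X i w : smooth_field W X -> tcoord i W w ->
  has_der (field_coord i X) w.
Proof. by move=> sX; apply: Ck_has_der (sX i 1). Qed.

Lemma bracketE X Y z :
  let c := tchart z in let w := tphi c z in
  bracket X Y z = der (field_coord c Y) w (field_coord c X w) -
                  der (field_coord c X) w (field_coord c Y w).
Proof. by rewrite /= !field_coord_self. Qed.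

Lemma der_field_coord_change W X i j w b : openTM W -> smooth_field W X ->
  tcoord i (W `&` Tdom j) w ->
  der (field_coord j X) (ttrans i j w) (der (ttrans i j) w b) =
  der (fun v => der (ttrans i j) v (field_coord i X w)) w b +
  der (ttrans i j) w (der (field_coord i X) w b).
Proof.
move=> oW sX wB; have oB : open (tcoord i (W `&` Tdom j)).
  exact: open_tcoord_I.
have dT : has_der (ttrans i j) w.
  exact: Ck_has_der (smooth_ttrans i j 1) (tcoord_tover wB).
have dX : has_der (field_coord j X) (ttrans i j w).
  by apply: field_has_der sX _; have [? []] := tcoord_ttrans wB.
have dX' : has_der (field_coord i X) w.
  by apply: field_has_der sX _; have [? []] := wB.
have [d1 E1] := der_comp dT dX.
have T2 : Ck 2 (tcoord i (W `&` Tdom j)) (ttrans i j).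
  by apply: Ck_sub (smooth_ttrans i j 2) => v; apply: tcoord_tover.
have [d2 E2] := der_der_apply framed_vec oB wB T2 dX'.
have E v : tcoord i (W `&` Tdom j) v ->
    field_coord j X (ttrans i j v) = der (ttrans i j) v (field_coord i X v).
  by move=> vB; rewrite field_coord_change//; apply: tcoord_tover vB.
have [_ E3] := der_eq_on oB wB E d1.
by move: E3; rewrite E1 E2 => /(congr1 (@^~ b)).
Qed.

(** The second derivatives of the chart change cancel by symmetry, so that the
    formula for the bracket has the same form in every chart. *)
Lemma bracket_coord W i X Y w : openTM W -> smooth_field W X -> smooth_field W Y ->
  tcoord i W w ->
  field_coord i (bracket X Y) w =
  der (field_coord i Y) w (field_coord i X w) -
  der (field_coord i X) w (field_coord i Y w).
Proof.
move=> oW sX sY [wi Ww].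
set z := tpsi i w; have zi : Tdom i z := tpsi_Tdom wi.
set c := tchart z; have zc : Tdom c z := Tdom_tchart z.
have wE : w = ttrans c i (tphi c z) by rewrite ttrans_tphi// tpsiK.
have uB : tcoord c (W `&` Tdom i) (tphi c z) by apply: tcoord_tphi.
have uo := tcoord_tover uB.
have CX X' : field_coord i X' w = der (ttrans c i) (tphi c z) (field_coord c X' (tphi c z)).
  by rewrite {1}wE field_coord_change.
have K X' Y' : smooth_field W X' ->
    der (field_coord i X') w (field_coord i Y' w) =
    der (fun v => der (ttrans c i) v (field_coord c X' (tphi c z))) (tphi c z)
      (field_coord c Y' (tphi c z)) +
    der (ttrans c i) (tphi c z)
      (der (field_coord c X') (tphi c z) (field_coord c Y' (tphi c z))).
  move=> sX'; rewrite CX.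
  have E := der_field_coord_change (field_coord c Y' (tphi c z)) oW sX' uB.
  rewrite -wE in E; exact: E.
rewrite (K _ _ sX) (K _ _ sY) CX field_coord_self bracketE -/c derB.
have cancel (p q r s : V) : p = q -> r - s = (p + r) - (q + s).
  by move=> ->; rewrite opprD addrACA subrr add0r.
apply: cancel.
exact: (der_derC _ _ framed_vec (@open_tover _ _ _ c i) uo (smooth_ttrans c i 2)).
Qed.

Lemma smooth_bracket W X Y : openTM W -> smooth_field W X -> smooth_field W Y ->
  smooth_field W (bracket X Y).
Proof.
move=> oW sX sY i k.
have D X' Y' : smooth_field W X' -> smooth_field W Y' ->
    Ck k (tcoord i W) (fun w => der (field_coord i X') w (field_coord i Y' w)).
  by move=> sX' sY'; apply: (Ck_der_apply framed_vec (oW i) (sX' i k.+1) (sY' i k)).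
apply: Ck_ext (Ck_minus (oW i) (D _ _ sY sX) (D _ _ sX sY)); first exact: oW.
by move=> w Ww; rewrite (bracket_coord oW sX sY Ww).
Qed.

Lemma dfunE f z a : dfun f z a = der (f \o tpsi (tchart z)) (tphi (tchart z) z) a.
Proof. by []. Qed.

Lemma fun_has_der W f i w : smooth_fun W f -> tcoord i W w -> has_der (f \o tpsi i) w.
Proof. by move=> sf; apply: Ck_has_der (sf i 1). Qed.

Lemma dfun_coord W f i z a : openTM W -> smooth_fun W f -> W z -> Tdom i z ->
  dfun f z a = der (f \o tpsi i) (tphi i z) (tchange (tchart z) i z a).
Proof.
move=> oW sf Wz zi; rewrite dfunE.
have zc := Tdom_tchart z; set c := tchart z in zc *.
have uB : tcoord c (W `&` Tdom i) (tphi c z) by apply: tcoord_tphi.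
have oB : open (tcoord c (W `&` Tdom i)) by exact: open_tcoord_I.
have E1 := tchangeE a zc zi.
have dT := Ck_has_der (smooth_ttrans c i 1) (tphi_tover zc zi).
have df : has_der (f \o tpsi i) (ttrans c i (tphi c z)).
  rewrite (ttrans_tphi zc zi); exact: (fun_has_der sf (tcoord_tphi zi Wz)).
have [d1 E2] := der_comp dT df.
have E3 v : tcoord c (W `&` Tdom i) v -> (f \o tpsi i) (ttrans c i v) = (f \o tpsi c) v.
  by move=> /tcoord_tover vci /=; rewrite (tpsi_ttrans vci).
have [_ E4] := der_eq_on oB uB E3 d1.
apply: etrans (congr1 (@^~ a) (etrans E4 E2)) _.
by rewrite E1 (ttrans_tphi zc zi).
Qed.

Lemma smooth_dfun W f X : openTM W -> smooth_fun W f -> smooth_field W X ->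
  smooth_fun W (fun z => dfun f z (X z)).
Proof.
move=> oW sf sX i k.
have H := Ck_der_apply framed_vec (oW i) (sf i k.+1) (sX i k).
apply: Ck_ext H; first exact: oW.
move=> w [wi Ww] /=.
by rewrite (dfun_coord _ oW sf Ww (tpsi_Tdom wi)) (tpsiK wi).
Qed.

Lemma bracketC X Y z : bracket X Y z = - bracket Y X z.
Proof. by rewrite !bracketE /= opprB. Qed.

Lemma bracket_eq W X X' Y z : openTM W -> W z -> smooth_field W X ->
  (forall t, W t -> X t = X' t) -> bracket X Y z = bracket X' Y z.
Proof.
move=> oW Wz sX XX; rewrite !bracketE.
have wW : tcoord (tchart z) W (tphi (tchart z) z).
  by apply: tcoord_tphi => //; exact: Tdom_tchart.
have E v : tcoord (tchart z) W v ->
    field_coord (tchart z) X v = field_coord (tchart z) X' v.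
  by move=> [_ Wv]; rewrite /field_coord XX.
have [_ ->] := der_eq_on (oW (tchart z)) wW E (field_has_der sX wW).
by rewrite E.
Qed.

Lemma bracket_add W X X' Y z : openTM W -> W z -> smooth_field W X ->
  smooth_field W X' ->
  bracket (fun t => X t + X' t) Y z = bracket X Y z + bracket X' Y z.
Proof.
move=> oW Wz sX sX'; rewrite !bracketE !field_coord_self derD.
have wW : tcoord (tchart z) W (tphi (tchart z) z).
  by apply: tcoord_tphi => //; exact: Tdom_tchart.
have -> : field_coord (tchart z) (fun t => X t + X' t) =
    fun w => field_coord (tchart z) X w + field_coord (tchart z) X' w.
  by apply/funext => w; rewrite /field_coord tchangeD.
rewrite (der_add (field_has_der sX wW) (field_has_der sX' wW)).2.
by rewrite opprD addrACA.
Qed.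

Lemma bracket_scale W f X Y z : openTM W -> W z -> smooth_fun W f ->
  smooth_field W X ->
  bracket (fun t => f t *: X t) Y z = f z *: bracket X Y z - dfun f z (Y z) *: X z.
Proof.
move=> oW Wz sf sX; rewrite !bracketE !field_coord_self derZ dfunE.
have zc := Tdom_tchart z.
have wW : tcoord (tchart z) W (tphi (tchart z) z) by apply: tcoord_tphi.
have -> : field_coord (tchart z) (fun t => f t *: X t) =
    fun w => (f \o tpsi (tchart z)) w *: field_coord (tchart z) X w.
  by apply/funext => w; rewrite /field_coord tchangeZ.
rewrite (der_scale (fun_has_der sf wW) (field_has_der sX wW)).2.
by rewrite field_coord_self /= tphiK// scalerBr opprD addrA.
Qed.

(** By symmetry of the second derivative of [f]. *)
Lemma dfun_bracket W f X Y z : openTM W -> W z -> smooth_fun W f ->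
  smooth_field W X -> smooth_field W Y ->
  dfun f z (bracket X Y z) =
  dfun (fun t => dfun f t (Y t)) z (X z) - dfun (fun t => dfun f t (X t)) z (Y z).
Proof.
move=> oW Wz sf sX sY; have zc := Tdom_tchart z.
set c := tchart z in zc *; set w := tphi c z.
have wW : tcoord c W w by apply: tcoord_tphi.
have D X' b : smooth_field W X' ->
    dfun (fun t => dfun f t (X' t)) z b =
    der (fun u => der (f \o tpsi c) u (X' z)) w b +
    der (f \o tpsi c) w (der (field_coord c X') w b).
  move=> sX'.
  have [d1 E1] := der_der_apply framed_vec (oW c) wW (sf c 2) (field_has_der sX' wW).
  have E u : tcoord c W u -> der (f \o tpsi c) u (field_coord c X' u) =
      ((fun t => dfun f t (X' t)) \o tpsi c) u.
    move=> [ui Wu] /=.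
    by rewrite (dfun_coord _ oW sf Wu (tpsi_Tdom ui)) (tpsiK ui).
  have [_ E2] := der_eq_on (oW c) wW E d1.
  apply: etrans (dfunE _ _ _) _; rewrite -/c -/w E2 E1.
  by rewrite /w field_coord_self.
rewrite (D _ _ sX) (D _ _ sY) bracketE -/c -/w dfunE -/c -/w derB.
rewrite /w !field_coord_self -/w.
have cancel (p q r s : R) : p = q -> r - s = (p + r) - (q + s).
  by move=> ->; rewrite opprD addrACA subrr add0r.
apply: cancel.
exact: (der_derC _ _ (@framed_real R) (oW c) wW (sf c 2)).
Qed.

(** In a chart the second derivatives of the components cancel in pairs by
    symmetry, and the composites of first derivatives cancel cyclically. *)
Lemma Jacobi W X Y Z z : openTM W -> W z ->
  smooth_field W X -> smooth_field W Y -> smooth_field W Z ->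
  bracket X (bracket Y Z) z + bracket Y (bracket Z X) z + bracket Z (bracket X Y) z = 0.
Proof.
move=> oW Wz sX sY sZ; have zc := Tdom_tchart z.
set c := tchart z in zc *; set w := tphi c z.
have wW : tcoord c W w by apply: tcoord_tphi.
pose D X' a := der (field_coord c X') w a.
pose D2 X' a b := der (fun u => der (field_coord c X') u a) w b.
have D2C X' a b : smooth_field W X' -> D2 X' a b = D2 X' b a.
  by move=> sX'; exact: (der_derC _ _ framed_vec (oW c) wW (sX' c 2)).
have B X' Y' : smooth_field W X' -> smooth_field W Y' -> forall b,
   der (field_coord c (bracket X' Y')) w b =
   (D2 Y' (X' z) b + D Y' (D X' b)) - (D2 X' (Y' z) b + D X' (D Y' b)).
  move=> sX' sY' b.
  have [d1 E1] := der_der_apply framed_vec (oW c) wW (sY' c 2) (field_has_der sX' wW).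
  have [d2 E2] := der_der_apply framed_vec (oW c) wW (sX' c 2) (field_has_der sY' wW).
  have [d2' E2'] := der_scale (der_cst (-1 : R) w).1 d2.
  have [d3 E3] := der_add d1 d2'.
  have E u : tcoord c W u ->
     der (field_coord c Y') u (field_coord c X' u) +
     -1 *: der (field_coord c X') u (field_coord c Y' u) =
     field_coord c (bracket X' Y') u.
    by move=> Wu; rewrite (bracket_coord oW sX' sY' Wu) scaleN1r.
  have [_ ->] := der_eq_on (oW c) wW E d3.
  rewrite E3 E2' (der_cst _ _).2 scale0r addr0 scaleN1r E1 E2.
  by rewrite /w !field_coord_self.
have A X' Y' Z' : smooth_field W X' -> smooth_field W Y' -> smooth_field W Z' ->
  bracket X' (bracket Y' Z') z =
   (D2 Z' (Y' z) (X' z) + D Z' (D Y' (X' z))) - (D2 Y' (Z' z) (X' z) + D Y' (D Z' (X' z)))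
   - (D X' (D Z' (Y' z)) - D X' (D Y' (Z' z))).
  move=> sX' sY' sZ'; rewrite bracketE -/c -/w /w !field_coord_self -/w (B _ _ sY' sZ').
  by rewrite bracketE -/c -/w /w !field_coord_self -/w -/(D X' _) /D derB.
rewrite (A _ _ _ sX sY sZ) (A _ _ _ sY sZ sX) (A _ _ _ sZ sX sY).
rewrite (D2C Z (Y z) (X z) sZ) (D2C Y (Z z) (X z) sY) (D2C X (Z z) (Y z) sX).
move: (D2 Z _ _) (D2 Y _ _) (D2 X _ _) (D X (D Y _)) (D X (D Z _)) (D Y (D X _))
  (D Y (D Z _)) (D Z (D X _)) (D Z (D Y _)) => a b c' d1 d2 d3 d4 d5 d6.
apply/pair_equal_spec; split; apply/rowP => k; rewrite !mxE; ring.
Qed.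

Lemma der_coord_Jf W X i w b : openTM W -> smooth_field W X -> tcoord i W w ->
  der (field_coord i (Jf X)) w b = Jmap (der (field_coord i X) w b).
Proof.
move=> oW sX wW; have [d1 E1] := der_Jmap (field_has_der sX wW).
have E u : tcoord i W u -> Jmap (field_coord i X u) = field_coord i (Jf X) u.
  by move=> [ui _]; rewrite (field_coord_Jf X ui).
have [_ E2] := der_eq_on (oW i) wW E d1.
by rewrite E2 E1.
Qed.

(** [J] has constant coefficients in every induced chart. *)
Lemma nijenhuis_Jf W X Y z : openTM W -> W z -> smooth_field W X -> smooth_field W Y ->
  bracket (Jf X) (Jf Y) z = Jmap (bracket (Jf X) Y z) + Jmap (bracket X (Jf Y) z).
Proof.
move=> oW Wz sX sY; have zc := Tdom_tchart z.
have wW : tcoord (tchart z) W (tphi (tchart z) z) by apply: tcoord_tphi.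
rewrite !bracketE !field_coord_self !(der_coord_Jf _ oW sX wW) !(der_coord_Jf _ oW sY wW).
by rewrite !JmapB !JmapJ subr0 sub0r.
Qed.

Lemma liouville_coord i w : cran i w.1 -> field_coord i liouville w = (0, w.2).
Proof.
move=> wi; rewrite /field_coord /liouville.
have zi := tpsi_Tdom wi; set z := tpsi i w in zi *; have zc := Tdom_tchart z.
rewrite (tchangeE _ zc zi) (der_ttrans _ (tphi_tover zc zi)) /= !der0 add0r.
by rewrite tphi_fst -(tphi_snd zi) /z (tpsiK wi).
Qed.

(** The Liouville field is linear in the fibre coordinates. *)
Lemma bracket_liouville W X z : openTM W -> W z -> smooth_field W X ->
  bracket (Jf X) liouville z - Jmap (bracket X liouville z) = Jmap (X z).
Proof.
move=> oW Wz sX; have zc := Tdom_tchart z.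
set c := tchart z in zc *; set w := tphi c z.
have wW : tcoord c W w by apply: tcoord_tphi.
have D b : der (field_coord c liouville) w b = (0, b.2).
  have [d1 E1] := der_pair (der_cst (0 : 'rV[R]_n) w).1 (der_snd w).1.
  have E u : tcoord c W u -> (0, u.2) = field_coord c liouville u.
    by move=> [ui _]; rewrite (liouville_coord ui).
  have [_ E2] := der_eq_on (oW c) wW E d1.
  by rewrite E2 E1 (der_cst _ w).2 (der_snd w).2.
rewrite !bracketE -/c -/w !D (der_coord_Jf _ oW sX wW) JmapB.
by rewrite opprB addrA subrK /w !field_coord_self subr0.
Qed.

Lemma openTM_slit : openTM (slitTM : set (TM M)).
Proof.
move=> i.
have -> : tcoord i (slitTM : set (TM M)) =
    [set w : V | cran i w.1] `&` [set w : V | w.2 != 0].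
  apply/seteqP; split=> w [wi ws]; split=> //.
    by rewrite /= -(tvec_tpsi_eq0 wi).
  by rewrite /slitTM /= (tvec_tpsi_eq0 wi).
apply: openI; first exact: (open_fst (@open_cran _ _ M i)).
have -> : [set w : V | w.2 != 0] = snd @^-1` (~` [set 0]).
  by apply/seteqP; split=> w /=; [move/eqP | move=> H; apply/eqP].
apply: open_comp => [x _|]; first exact: continuous_snd.
rewrite openC; apply: accessible_closed_set1; apply: hausdorff_accessible.
exact: norm_hausdorff.
Qed.

End Fields.

#[local] Opaque bracket.

(** * Linear systems with smooth coefficients *)

Section LinearSystems.
Context {R : realType}.

Lemma Ck_det (V : normedModType R) k (A : set V) m (B : V -> 'M[R]_m) :
  open A -> (forall i j, Ck k A (fun x => B x i j)) ->
  Ck k A (fun x => \det (B x)).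
Proof.
move=> oA Bk.
have H (s : {perm 'I_m}) : Ck k A (fun x => (-1) ^+ s * \prod_i B x i (s i)).
  apply: (@Ck_mul R V k A (fun=> (-1) ^+ s)) => //; first exact: Ck_cst.
  exact: (@Ck_prod R V k A _ _ (fun i x => B x i (s i))).
exact: (Ck_sum _ _ oA H).
Qed.

Lemma Ck_invmx (V : normedModType R) k (A : set V) m (B : V -> 'M[R]_m) :
  open A -> (forall i j, Ck k A (fun x => B x i j)) ->
  (forall x, A x -> B x \in unitmx) ->
  forall i j, Ck k A (fun x => invmx (B x) i j).
Proof.
move=> oA Bk uB i j.
have dB x : A x -> \det (B x) != 0.
  by move=> Ax; have := uB x Ax; rewrite unitmxE unitfE.
have cB : Ck k A (fun x => cofactor (B x) j i).
  apply: (@Ck_mul R V k A (fun=> (-1) ^+ (j + i))) => //; first exact: Ck_cst.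
  apply: (Ck_det oA) => p q.
  have E x : B x (lift j p) (lift i q) = (row' j (col' i (B x))) p q by rewrite !mxE.
  by apply: (Ck_ext oA (fun x _ => E x)); apply: Bk.
have H := Ck_mul oA (Ck_inv oA dB (Ck_det oA Bk)) cB.
apply: (Ck_ext oA _ H) => x Ax.
by rewrite /invmx uB// !mxE.
Qed.

Context {n : nat}.
Notation V := (vec R n).

Lemma row_mx_vec (a : V) : (lsubmx (row_mx a.1 a.2), rsubmx (row_mx a.1 a.2)) = a.
Proof. by rewrite row_mxKl row_mxKr; case: a. Qed.

(** By Cramer's rule the inverse of the matrix of the system has smooth entries.
    This is what makes the spray, defined pointwise by a linear system, smooth. *)
Lemma smooth_solution (A : set V) (om : V -> V -> V -> R) (al : V -> V -> R) :
  open A ->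
  (forall w b, A w -> linear ((om w)^~ b : V -> R)) ->
  (forall w a, A w -> linear (om w a : V -> R)) ->
  (forall w, A w -> linear (al w : V -> R)) ->
  (forall a b k, Ck k A (fun w => om w a b)) ->
  (forall b k, Ck k A (fun w => al w b)) ->
  (forall w a, A w -> (forall b, om w a b = 0) -> a = 0) ->
  exists s : V -> V, (forall k, Ck k A s) /\
    forall w, A w -> forall b, om w (s w) b = al w b.
Proof.
move=> oA oml omr all omk alk nd.
pose e (k : 'I_(n + n)) : V := (lsubmx (delta_mx 0 k), rsubmx (delta_mx 0 k)).
pose v (r : 'rV[R]_(n + n)) : V := (lsubmx r, rsubmx r).
have vE r : v r = \sum_k r 0 k *: e k.
  have vlin : linear v by move=> a x y; rewrite /v !linearP.
  rewrite {1}[r]row_sum_delta.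
  pose L : {linear 'rV[R]_(n + n) -> V} :=
    HB.pack_for {linear 'rV[R]_(n + n) -> V} v (GRing.isLinear.Build _ _ _ _ _ vlin).
  rewrite -[v]/(L : _ -> _) linear_sum; apply: eq_bigr => k _.
  exact: linearZ.
have vK (a : V) : a = v (row_mx a.1 a.2) by rewrite /v row_mx_vec.
have lsum (f : V -> R) r : linear f -> f (v r) = \sum_k r 0 k * f (e k).
  move=> lf.
  pose L : {linear V -> R} :=
    HB.pack_for {linear V -> R} f (GRing.isLinear.Build _ _ _ _ _ lf).
  rewrite vE -[f]/(L : _ -> _) linear_sum; apply: eq_bigr => k _.
  exact: linearZ.
pose B w : 'M[R]_(n + n) := \matrix_(k, l) om w (e k) (e l).
have uB w : A w -> B w \in unitmx.
  move=> Aw; rewrite -row_free_unit; apply: inj_row_free => r rB.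
  have r0 : v r = 0.
    apply: (nd w) => // b; rewrite (vK b) (lsum (om w (v r))); last exact: omr.
    apply: big1 => l _.
    rewrite (lsum ((om w)^~ (e l))); last exact: oml.
    have /rowP/(_ l) := rB; rewrite !mxE => rl.
    rewrite (_ : \sum_k _ = 0) ?mulr0// -[RHS]rl; apply: eq_bigr => k _.
    by rewrite mxE.
  have := congr1 (fun a : V => row_mx a.1 a.2) r0; rewrite /v /= hsubmxK => ->.
  by rewrite row_mx0.
pose d w : 'rV[R]_(n + n) := \row_l al w (e l).
pose r w := d w *m invmx (B w).
exists (fun w => \sum_k r w 0 k *: e k); split.
  move=> k; apply: Ck_sum => // j; apply: Ck_scale => //; last exact: Ck_cst.
  have H : Ck k A (fun w => \sum_l al w (e l) * invmx (B w) l j).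
    apply: (@Ck_sum R V R k A _ _ _ (fun l w => al w (e l) * invmx (B w) l j)) => // l.
    apply: (Ck_mul oA (alk (e l) k)); apply: Ck_invmx => // p q.
    by apply: (Ck_ext oA _ (omk (e p) (e q) k)) => w _; rewrite mxE.
  by apply: (Ck_ext oA _ H) => w _; rewrite /r mxE; apply: eq_bigr => l _; rewrite mxE.
move=> w Aw b; rewrite -vE (vK b) (lsum (om w _)); last exact: omr.
rewrite (lsum (al w)); last exact: all.
apply: eq_bigr => l _; congr (_ * _).
rewrite (lsum ((om w)^~ (e l))); last exact: oml.
have : (r w *m B w) 0 l = d w 0 l by rewrite /r mulmxKV// uB.
rewrite mxE [RHS]mxE => <-; apply: eq_bigr => k _.
by rewrite [X in _ = _ * X]mxE.
Qed.

Lemma der2_comp (U V' W : normedModType R) (A : set U) (B : set V') (T : U -> V')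
    (g : V' -> W) (x a b : U) :
  framed V' -> open A -> A x -> (forall y, A y -> B (T y)) -> Ck 2 A T -> Ck 2 B g ->
  der (fun y => der (fun z => g (T z)) y b) x a =
  der (fun v => der g v (der T x b)) (T x) (der T x a) +
  der g (T x) (der (fun y => der T y b) x a).
Proof.
move=> [I [e [l [lc lE]]]] oA Ax AB Tk gk.
have dT y : A y -> has_der T y by apply: Ck_has_der Tk.
have dg y : A y -> has_der g (T y) by move=> /AB; apply: Ck_has_der gk.
have dTb : has_der (fun y => der T y b) x by apply: Ck_has_der (Ck_der b Tk) Ax.
have dge j : has_der (fun v => der g v (e j)) (T x).
  by apply: Ck_has_der (Ck_der (e j) gk) _; apply: AB.
have dc j := der_comp (dT x Ax) (dge j).
have dl j := der_lin_comp (lc j) dTb.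
have ds j := der_scale (dl j).1 (dc j).1.
have [d1 E1] := der_sum (fun j => (ds j).1).
have E y : A y -> \sum_j l j (der T y b) *: der g (T y) (e j) =
    der (fun z => g (T z)) y b.
  move=> Ay; rewrite -(der_framed g (T y) (der T y b) lE).
  by rewrite (der_comp (dT y Ay) (dg y Ay)).2.
have [_ E2] := der_eq_on oA Ax E d1.
rewrite E2 E1 [X in _ = _ + X](der_framed _ _ _ lE).
have Q : der (fun v => der g v (der T x b)) (T x) (der T x a) =
    \sum_j l j (der T x b) *: der (fun v => der g v (e j)) (T x) (der T x a).
  have -> : (fun v => der g v (der T x b)) =
      fun v => \sum_j l j (der T x b) *: der g v (e j).
    by apply/funext => v; apply: der_framed.
  have dz j := der_scale (der_cst (l j (der T x b)) (T x)).1 (dge j).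
  rewrite (der_sum (fun j => (dz j).1)).2; apply: eq_bigr => j _.
  by rewrite (dz j).2 (der_cst _ _).2 scale0r addr0.
rewrite Q -big_split /=; apply: eq_bigr => j _.
by rewrite (ds j).2 (dl j).2 (dc j).2.
Qed.

End LinearSystems.

#[local] Opaque field_coord.

(** * The fundamental form and the canonical spray *)

Section FinslerCoordinates.
Context {R : realType} {n : nat} {M : smooth_manifold R n}.
Variables (E : TM M -> R) (hE : finsler E).
Notation V := (vec R n).
Notation field := (TM M -> V).
Notation slit := (slitTM : set (TM M)).
Implicit Types (i j : chart M) (w a b : V) (z : TM M).

Let sE : smooth_fun slit E := finsler_smooth hE.
Let oS : openTM slit := @openTM_slit R n M.
Arguments oS : clear implicits.

Definition hess i w a b : R := der (fun u => der (E \o tpsi i) u b) w a.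

(** [dd_J E] on fields with constant components in the chart [i]. *)
Definition Omega_chart i w a b : R := hess i w a (Jmap b) - hess i w b (Jmap a).

Lemma hessC i w a b : tcoord i slit w -> hess i w a b = hess i w b a.
Proof.
move=> ws; rewrite /hess.
exact: (der_derC b a (@framed_real R) (oS i) ws (sE i 2)).
Qed.

Lemma hess_linearl i w b : linear (fun a => hess i w a b : R).
Proof. exact: der_linear. Qed.

Lemma hess_linearr i w a : tcoord i slit w -> linear (fun b => hess i w a b : R).
Proof.
move=> ws k b b'; rewrite (hessC a (k *: b + b') ws) (hessC a b ws) (hessC a b' ws).
exact: hess_linearl.
Qed.

Lemma hess0 i w a : hess i w a 0 = 0.
Proof.
rewrite /hess (_ : (fun u => _) = fun=> 0); first by rewrite (der_cst _ w).2.
by apply/funext => u; rewrite der0.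
Qed.

(** The defect of [hess] from being a tensor is a second derivative of the chart
    change. *)
Lemma hess_change i j w a b : tcoord i (slit `&` Tdom j) w ->
  hess i w a b =
  hess j (ttrans i j w) (der (ttrans i j) w a) (der (ttrans i j) w b) +
  der (E \o tpsi j) (ttrans i j w) (der (fun u => der (ttrans i j) u b) w a).
Proof.
move=> wB; have oB : open (tcoord i (slit `&` Tdom j)) by exact: open_tcoord_I.
have TB u : tcoord i (slit `&` Tdom j) u -> tcoord j slit (ttrans i j u).
  by move=> /tcoord_ttrans; apply: tcoord_sub => t [].
have Tk k : Ck k (tcoord i (slit `&` Tdom j)) (ttrans i j).
  by apply: Ck_sub (smooth_ttrans i j k) => v; apply: tcoord_tover.
have E0 u : tcoord i (slit `&` Tdom j) u -> (E \o tpsi j) (ttrans i j u) = (E \o tpsi i) u.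
  by move=> /tcoord_tover uij /=; rewrite (tpsi_ttrans uij).
have dET u : tcoord i (slit `&` Tdom j) u ->
    has_der (fun y => (E \o tpsi j) (ttrans i j y)) u.
  move=> uB; exact: (der_comp (Ck_has_der (Tk 1%N) uB) (fun_has_der sE (TB u uB))).1.
have E1 u : tcoord i (slit `&` Tdom j) u ->
    der (fun y => (E \o tpsi j) (ttrans i j y)) u b = der (E \o tpsi i) u b.
  move=> uB; have [_ E2] := der_eq_on oB uB E0 (dET u uB).
  exact: (congr1 (@^~ b) (esym E2)).
have CET : Ck 2 (tcoord i (slit `&` Tdom j)) (fun y => (E \o tpsi j) (ttrans i j y)).
  exact: (Ck_comp framed_vec oB TB (Tk 2) (sE j 2)).
have d1 := Ck_has_der (Ck_der b CET) wB.
have [_ E3] := der_eq_on oB wB E1 d1.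
apply: etrans (congr1 (@^~ a) E3) _.
exact: (der2_comp _ _ framed_vec oB wB TB (Tk 2) (sE j 2)).
Qed.

Lemma der_ttrans_Jmap i j u b : tover i j u ->
  der (ttrans i j) u (Jmap b) = Jmap (der (ttrans i j) u b).
Proof. by move=> uij; rewrite !(der_ttrans _ uij) /Jmap /= !der0 add0r. Qed.

Lemma Omega_chart_change i j w a b : tcoord i (slit `&` Tdom j) w ->
  Omega_chart i w a b =
  Omega_chart j (ttrans i j w) (der (ttrans i j) w a) (der (ttrans i j) w b).
Proof.
move=> wB; have wij := tcoord_tover wB.
rewrite /Omega_chart !(hess_change _ _ wB) !(der_ttrans_Jmap _ wij).
(* With one vertical direction, the second derivative of the chart change is
   that of the change of base coordinates, which is symmetric. *)
have D c d : der (fun u => der (ttrans i j) u (Jmap d)) w c =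
    (0, der (fun x => der (transition i j) x d.1) w.1 c.1).
  have [d0 E0] := der_fst_comp (V' := 'rV[R]_n)
    (Ck_has_der (Ck_der d.1 (smooth_overlap i j 2)) wij).
  have [d1 E1] := der_pair (der_cst (0 : 'rV[R]_n) w).1 d0.
  have E2 u : tover i j u -> (0, der (transition i j) u.1 d.1) =
      der (ttrans i j) u (Jmap d).
    by move=> uij; rewrite (der_ttrans _ uij) /Jmap /= !der0 add0r.
  have [_ E3] := der_eq_on (@open_tover _ _ _ i j) wij E2 d1.
  apply: etrans (congr1 (@^~ c) (etrans E3 E1)) _.
  by rewrite E0 (der_cst _ w).2.
rewrite !D.
rewrite (der_derC b.1 a.1 framed_rVn (@open_overlap _ _ _ i j) wij (smooth_overlap i j 2)).
by rewrite opprD addrACA subrr addr0.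
Qed.

Lemma Omega_self z a b : slit z ->
  Omega E z a b = Omega_chart (tchart z) (tphi (tchart z) z) a b.
Proof.
move=> zs; have zc := Tdom_tchart z; set c := tchart z in zc *.
have wB : tcoord c slit (tphi c z) by apply: tcoord_tphi.
have D d e : dfun (fun t => dJ_form E t (extend z d t)) z e =
    hess c (tphi c z) e (Jmap d).
  have d1 := Ck_has_der (Ck_der (Jmap d) (sE c 2)) wB.
  have E1 u : tcoord c slit u -> der (E \o tpsi c) u (Jmap d) =
      ((fun t => dJ_form E t (extend z d t)) \o tpsi c) u.
    move=> [ui us]; rewrite /= /dJ_form (dfun_coord _ oS sE us (tpsi_Tdom ui)).
    rewrite (tpsiK ui) (tchange_Jmap _ (Tdom_tchart _) (tpsi_Tdom ui)).
    have zu := tpsi_Tdom ui; have Eu := field_coord_tphi (extend z d) zu.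
    by rewrite (tpsiK ui) (extend_coord d ui) in Eu; rewrite -Eu.
  have [_ E2] := der_eq_on (oS c) wB E1 d1.
  exact: (congr1 (@^~ e) E2).
by rewrite /Omega /d1form !D.
Qed.

Lemma Omega_coord i z a b : slit z -> Tdom i z ->
  Omega E z a b = Omega_chart i (tphi i z) (tchange (tchart z) i z a) (tchange (tchart z) i z b).
Proof.
move=> zs zi; have zc := Tdom_tchart z.
rewrite (Omega_self _ _ zs) (@Omega_chart_change (tchart z) i); last first.
  by apply: tcoord_tphi.
by rewrite !(tchangeE _ zc zi) (ttrans_tphi zc zi).
Qed.

Lemma Omega_chart_linearl i w b : tcoord i slit w ->
  linear (fun a => Omega_chart i w a b : R).
Proof.
move=> ws k a a'; rewrite /Omega_chart hess_linearl JmapD JmapZ.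
by rewrite (hess_linearr _ ws) scalerBr opprD addrACA.
Qed.

Lemma Omega_chart_linearr i w a : tcoord i slit w ->
  linear (fun b => Omega_chart i w a b : R).
Proof.
move=> ws k b b'; rewrite /Omega_chart hess_linearl JmapD JmapZ.
by rewrite (hess_linearr _ ws) scalerBr opprD addrACA.
Qed.

Lemma Omega_subl z a a' b : slit z -> Omega E z (a - a') b = Omega E z a b - Omega E z a' b.
Proof.
move=> zs; rewrite !(Omega_self _ _ zs).
have ws : tcoord (tchart z) slit (tphi (tchart z) z).
  by apply: tcoord_tphi => //; exact: Tdom_tchart.
have := Omega_chart_linearl b ws (-1) a' a; rewrite !scaleN1r => H.
by rewrite (addrC a) H addrC.
Qed.

Lemma Omega_inj z a a' : slit z -> (forall b, Omega E z a b = Omega E z a' b) -> a = a'.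
Proof.
move=> zs H; apply/eqP; rewrite -subr_eq0; apply/eqP.
by apply: (finsler_nondeg hE zs) => b; rewrite (Omega_subl _ _ _ zs) H subrr.
Qed.

Lemma Omega_vert z a b : slit z ->
  Omega E z (Jmap a) b = hess (tchart z) (tphi (tchart z) z) (Jmap a) (Jmap b).
Proof. by move=> zs; rewrite (Omega_self _ _ zs) /Omega_chart JmapJ hess0 subr0. Qed.

Lemma Omega_vertr z a b : slit z ->
  Omega E z a (Jmap b) = - hess (tchart z) (tphi (tchart z) z) (Jmap b) (Jmap a).
Proof. by move=> zs; rewrite (Omega_self _ _ zs) /Omega_chart JmapJ hess0 sub0r. Qed.

(** By symmetry of the Hessian [Omega (J a) b = - Omega a (J b)], and [Omega] is
    nondegenerate. *)
Lemma vertical_Omega z a : slit z -> (forall b, Omega E z a (Jmap b) = 0) -> Jmap a = 0.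
Proof.
move=> zs H; apply: (finsler_nondeg hE zs) => b; rewrite (Omega_vert _ _ zs).
rewrite hessC; last by apply: tcoord_tphi => //; exact: Tdom_tchart.
by apply/eqP; rewrite -oppr_eq0 -(Omega_vertr _ _ zs) H.
Qed.

(** In a chart the spray solves a nondegenerate linear system with smooth
    coefficients. *)
Lemma spray_solution i : exists s : V -> V, (forall k, Ck k (tcoord i slit) s) /\
  forall w, tcoord i slit w -> field_coord i (spray E) w = s w /\
    forall b, Omega_chart i w (s w) b = - der (E \o tpsi i) w b.
Proof.
have [||||||s [sk sP]] := @smooth_solution R n (tcoord i slit) (Omega_chart i)
  (fun w b => - der (E \o tpsi i) w b) (oS i).
- by move=> w b; apply: Omega_chart_linearl.
- by move=> w a; apply: Omega_chart_linearr.
- move=> w _ k b b'; rewrite (der_linear (E \o tpsi i)) opprD.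
  by rewrite scalerN.
- move=> a b k; apply: (Ck_minus (oS i)).
    exact: (Ck_der a (Ck_der (Jmap b) (sE i k.+2))).
  exact: (Ck_der b (Ck_der (Jmap a) (sE i k.+2))).
- move=> b k; have ck := @Ck_cst R V R k (tcoord i slit) 0.
  apply: (Ck_ext (oS i) _ (Ck_minus (oS i) ck (Ck_der b (sE i k.+1)))) => w _.
  by rewrite sub0r.
- move=> w a [wi ws] H; have zi := tpsi_Tdom wi; have zc := Tdom_tchart (tpsi i w).
  have a0 : tchange i (tchart (tpsi i w)) (tpsi i w) a = 0.
    apply: (finsler_nondeg hE ws) => b; rewrite (Omega_coord _ _ ws zi).
    by rewrite (tchangeK _ zi zc) (tpsiK wi).
  by rewrite -(tchangeK a zi zc) a0 tchange0.
exists s; split=> // w wS; split; last exact: sP.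
have [wi ws] := wS; have zi := tpsi_Tdom wi; have zc := Tdom_tchart (tpsi i w).
have -> : field_coord i (spray E) w =
    tchange (tchart (tpsi i w)) i (tpsi i w) (spray E (tpsi i w)).
  by rewrite -(field_coord_tphi _ zi) (tpsiK wi).
rewrite (_ : spray E (tpsi i w) = tchange i (tchart (tpsi i w)) (tpsi i w) (s w)).
  by rewrite (tchangeK _ zi zc).
have P b : Omega E (tpsi i w) (tchange i (tchart (tpsi i w)) (tpsi i w) (s w)) b =
    - dfun E (tpsi i w) b.
  rewrite (Omega_coord _ _ ws zi) (tchangeK _ zi zc) (tpsiK wi) (sP w wS).
  by rewrite (dfun_coord b oS sE ws zi) (tpsiK wi).
apply: xget_unique => //= y yP; apply: (Omega_inj ws) => b.
by rewrite yP P.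
Qed.

Lemma smooth_spray : smooth_field slit (spray E).
Proof.
move=> i k; have [s [sk sP]] := spray_solution i.
by apply: (Ck_ext (oS i) _ (sk k)) => w /sP[].
Qed.

Lemma sprayP z b : slit z -> Omega E z (spray E z) b = - dfun E z b.
Proof.
move=> zs; have zc := Tdom_tchart z; have [s [_ sP]] := spray_solution (tchart z).
have [E1 E2] := sP _ (tcoord_tphi zc zs).
by rewrite (Omega_self _ _ zs) -(field_coord_self (spray E)) E1 E2.
Qed.

(** Euler's identity for the 2-homogeneous [E] makes its spray a semispray. *)
Lemma Jmap_spray z : slit z -> Jmap (spray E z) = liouville z.
Proof.
move=> zs; have zc := Tdom_tchart z; set c := tchart z in zc *.
have wB : tcoord c slit (tphi c z) by apply: tcoord_tphi.
have CJ : liouville z = Jmap (tvec z, 0) :> V by [].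
rewrite CJ; apply: (Omega_inj zs) => b.
rewrite !(Omega_vert _ _ zs) -/c.
transitivity (der (E \o tpsi c) (tphi c z) (Jmap b)).
  rewrite (hessC _ _ wB); apply: oppr_inj.
  by rewrite -(Omega_vertr _ _ zs) (sprayP _ zs) dfunE.
have E1 u : tcoord c slit u -> der (E \o tpsi c) u (0, u.2) = 2 *: (E \o tpsi c) u.
  move=> [ui us]; have := finsler_homog hE (tpsi c u).
  rewrite (dfun_coord _ oS sE us (tpsi_Tdom ui)) -(field_coord_tphi _ (tpsi_Tdom ui)).
  by rewrite (tpsiK ui) (liouville_coord ui).
have [dX EX] := der_pair (der_cst (0 : 'rV[R]_n) (tphi c z)).1 (der_snd (tphi c z)).1.
have [d1 E2] := der_der_apply framed_vec (oS c) wB (sE c 2) dX.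
have [_ E3] := der_eq_on (oS c) wB E1 d1.
have [_ E4] := der_scale (der_cst (2 : R) (tphi c z)).1 (fun_has_der sE wB).
have := congr1 (@^~ (Jmap b)) (etrans (esym E4) (etrans E3 E2)).
rewrite EX (der_cst _ _).2 (der_cst _ _).2 scale0r addr0 (der_snd _).2.
rewrite /c tphi_self -/c -[(0, tvec z)]/(Jmap (tvec z, 0 : 'rV[R]_n)).
rewrite (hessC _ _ wB) => H.
have {}H : der (E \o tpsi c) (tphi c z) (Jmap b) + der (E \o tpsi c) (tphi c z) (Jmap b) =
    hess c (tphi c z) (Jmap b) (Jmap (tvec z, 0)) + der (E \o tpsi c) (tphi c z) (Jmap b).
  by rewrite -[RHS]H scaler_nat mulr2n.
exact: addIr H.
Qed.

End FinslerCoordinates.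

#[local] Opaque dfun extend Jmap.

(** * The Barthel connection and the almost complex structure *)

Section Barthel.
Context {R : realType} {n : nat} {M : smooth_manifold R n}.
Variables (E : TM M -> R) (hE : finsler E).
Notation V := (vec R n).
Notation field := (TM M -> V).
Notation slit := (slitTM : set (TM M)).
Implicit Types (i j : chart M) (w a b : V) (z : TM M) (X Y : field)
  (W : set (TM M)).

Let oS : openTM slit := @openTM_slit R n M.
Arguments oS : clear implicits.
Let sS : smooth_field slit (spray E) := smooth_spray hE.

Lemma openTM_slitI i : openTM (slit `&` Tdom i).
Proof. by apply: openTM_I => //; exact: openTM_Tdom. Qed.

Lemma barthel_der z a : slit z ->
  barthel E z a =
  der (field_coord (tchart z) (spray E)) (tphi (tchart z) z) (Jmap a) -
  Jmap (der (field_coord (tchart z) (spray E)) (tphi (tchart z) z) a).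
Proof.
move=> zs; have zc := Tdom_tchart z; set c := tchart z in zc *.
have oW := @openTM_slitI c.
have sX : smooth_field (slit `&` Tdom c) (extend z a).
  by apply: smooth_extend => // t [].
have wW : tcoord c (slit `&` Tdom c) (tphi c z) by apply: tcoord_tphi.
rewrite /barthel !bracketE !field_coord_self -/c.
rewrite (der_coord_Jf _ oW sX wW) JmapB /Jf extend_at.
by rewrite opprB addrA subrK.
Qed.

Lemma barthel_bracket W X z : openTM W -> W `<=` slit -> W z -> smooth_field W X ->
  barthel E z (X z) = bracket (Jf X) (spray E) z - Jmap (bracket X (spray E) z).
Proof.
move=> oW Ws Wz sX; rewrite (barthel_der _ (Ws z Wz)).
have wW : tcoord (tchart z) W (tphi (tchart z) z).
  by apply: tcoord_tphi => //; exact: Tdom_tchart.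
rewrite !bracketE !field_coord_self (der_coord_Jf _ oW sX wW) JmapB.
by rewrite opprB addrA subrK.
Qed.

Lemma barthelD z a b : slit z -> barthel E z (a + b) = barthel E z a + barthel E z b.
Proof.
by move=> zs; rewrite !(barthel_der _ zs) JmapD !derD JmapD opprD addrACA.
Qed.

Lemma barthelZ z (k : R) a : slit z -> barthel E z (k *: a) = k *: barthel E z a.
Proof.
by move=> zs; rewrite !(barthel_der _ zs) JmapZ !derZ JmapZ scalerBr.
Qed.

(** [J [J X, S] = [J X, C] - J [X, C] = J X], by [[J, J] = 0], [J S = C] and
    [[J, C] = J]. *)
Lemma Jmap_barthel z a : slit z -> Jmap (barthel E z a) = Jmap a.
Proof.
move=> zs; have zc := Tdom_tchart z; set c := tchart z in zc *.
have oW := @openTM_slitI c; have Wz : (slit `&` Tdom c) z by [].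
have sX : smooth_field (slit `&` Tdom c) (extend z a).
  by apply: smooth_extend => // t [].
have Ws : slit `&` Tdom c `<=` slit by move=> t [].
have sS' := smooth_field_sub Ws sS.
rewrite -{1}[a](extend_at z) (barthel_bracket oW Ws Wz sX) JmapB JmapJ subr0.
have /eqP := bracket_liouville oW Wz sX; rewrite extend_at => /eqP <-.
have sJS := smooth_Jf oW sS'.
have JS t : (slit `&` Tdom c) t -> Jf (spray E) t = liouville t.
  by move=> [ts _]; exact: Jmap_spray.
have E1 Y : bracket Y liouville z = bracket Y (Jf (spray E)) z.
  rewrite (bracketC Y liouville) (bracketC Y (Jf (spray E))).
  by rewrite (bracket_eq Y oW Wz sJS JS).
rewrite !E1 (nijenhuis_Jf oW Wz sX sS').
by rewrite addrK.
Qed.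

(** Both sides are [- J [J X, S]]. *)
Lemma barthel_Jmap z a : slit z -> barthel E z (Jmap a) = - Jmap a.
Proof.
move=> zs; rewrite (barthel_der _ zs) JmapJ der0 sub0r.
by rewrite -{2}(Jmap_barthel a zs) (barthel_der _ zs) JmapB JmapJ subr0.
Qed.

Lemma smooth_barthel W X : openTM W -> W `<=` slit -> smooth_field W X ->
  smooth_field W (fun z => barthel E z (X z)).
Proof.
move=> oW Ws sX; have sS' := smooth_field_sub Ws sS.
have H := smooth_fieldB oW (smooth_bracket oW (smooth_Jf oW sX) sS')
  (smooth_Jf oW (smooth_bracket oW sX sS')).
by apply: (smooth_field_eq oW _ H) => z Wz; rewrite (barthel_bracket oW Ws Wz sX).
Qed.

Lemma smooth_hproj W X : openTM W -> W `<=` slit -> smooth_field W X ->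
  smooth_field W (app1 (hproj E) X).
Proof.
move=> oW Ws sX.
exact: (smooth_fieldZ 2^-1 oW (smooth_field_add oW sX (smooth_barthel oW Ws sX))).
Qed.

Lemma half_double (a : V) : 2^-1 *: (a + a) = a.
Proof.
rewrite scalerDr -scalerDl (_ : 2^-1 + 2^-1 = 1 :> R) ?scale1r//.
by field.
Qed.

Lemma hproj_double z a : hproj E z a + hproj E z a = a + barthel E z a.
Proof. by rewrite /hproj -scalerDr half_double. Qed.

Lemma vprojE z a : vproj E z a = a - hproj E z a.
Proof.
rewrite /vproj /hproj -[X in _ = X - _]half_double -scalerBr; congr (_ *: _).
have aux (U : zmodType) (p q : U) : p - q = p + p - (p + q).
  by rewrite opprD addrACA subrr add0r.
exact: aux.
Qed.

Lemma hprojD z a b : slit z -> hproj E z (a + b) = hproj E z a + hproj E z b.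
Proof. by move=> zs; rewrite /hproj (barthelD _ _ zs) -scalerDr addrACA. Qed.

Lemma hprojZ z (k : R) a : slit z -> hproj E z (k *: a) = k *: hproj E z a.
Proof.
move=> zs; rewrite /hproj (barthelZ _ _ zs) -scalerDr !scalerA; congr (_ *: _).
exact: mulrC.
Qed.

Lemma hprojB z a b : slit z -> hproj E z (a - b) = hproj E z a - hproj E z b.
Proof. by move=> zs; rewrite -scaleN1r (hprojD _ _ zs) (hprojZ _ _ zs) scaleN1r. Qed.

Lemma Jmap_hproj z a : slit z -> Jmap (hproj E z a) = Jmap a.
Proof.
by move=> zs; rewrite /hproj JmapZ JmapD (Jmap_barthel _ zs) half_double.
Qed.

Lemma hproj_Jmap z a : slit z -> hproj E z (Jmap a) = 0.
Proof. by move=> zs; rewrite /hproj (barthel_Jmap _ zs) subrr scaler0. Qed.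

Lemma hproj_vert z a : slit z -> Jmap a = 0 -> hproj E z a = 0.
Proof. by move=> zs /Jmap_image ->; exact: hproj_Jmap. Qed.

Lemma hprojK z a : slit z -> hproj E z (hproj E z a) = hproj E z a.
Proof.
move=> zs; apply/eqP; rewrite eq_sym -subr_eq0 -(hprojB _ _ zs); apply/eqP.
by apply: (hproj_vert zs); rewrite JmapB (Jmap_hproj _ zs) subrr.
Qed.

#[local] Opaque hproj vproj barthel.

(** [J b] and [h c] are determined by their sum, hence so are [h b] and [J c]. *)
Lemma Fmap_eq z a b c : slit z -> a = Jmap b + hproj E z c ->
  Fmap E z a = hproj E z b - Jmap c.
Proof.
move=> zs aE; apply: xget_unique; first by exists b, c.
move=> _ [b' [c' [aE' ->]]].
have hc : hproj E z c = hproj E z c'.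
  have H d e : hproj E z (Jmap d + hproj E z e) = hproj E z e.
    by rewrite (hprojD _ _ zs) (hproj_Jmap _ zs) add0r (hprojK _ zs).
  by rewrite -(H b) -aE aE' H.
have Jc : Jmap c = Jmap c' by rewrite -(Jmap_hproj c zs) hc (Jmap_hproj _ zs).
have Jb : Jmap b = Jmap b'.
  apply: (addIr (hproj E z c)); apply: etrans (esym aE) (etrans aE' _).
  exact: (congr1 (fun t => Jmap b' + t) (esym hc)).
have H0 : hproj E z (b' - b) = 0.
  by apply: (hproj_vert zs); rewrite JmapB Jb subrr.
rewrite (hprojB b' b zs) in H0.
by rewrite (subr0_eq H0); exact: (congr1 (fun t => hproj E z b - t) (esym Jc)).
Qed.

Lemma Fmap_Jmap z a : slit z -> Fmap E z (Jmap a) = hproj E z a.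
Proof.
move=> zs; rewrite (@Fmap_eq z (Jmap a) a 0 zs); first by rewrite Jmap0 subr0.
have -> : hproj E z 0 = 0 by rewrite -[X in hproj E z X]Jmap0; exact: hproj_Jmap.
by rewrite addr0.
Qed.

Lemma vert_decomp z a : slit z -> exists b, a = Jmap b + hproj E z a.
Proof.
move=> zs; exists ((a - hproj E z a).2, 0).
rewrite -(@Jmap_image _ _ (a - hproj E z a)) ?subrK//.
by rewrite JmapB (Jmap_hproj _ zs) subrr.
Qed.

Lemma FmapD z a b : slit z -> Fmap E z (a + b) = Fmap E z a + Fmap E z b.
Proof.
move=> zs; have [a' aE] := vert_decomp a zs; have [b' bE] := vert_decomp b zs.
rewrite (Fmap_eq zs aE) (Fmap_eq zs bE) (@Fmap_eq z (a + b) (a' + b') (a + b) zs).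
  by rewrite (hprojD _ _ zs) JmapD opprD addrACA.
by rewrite {1}aE {1}bE (hprojD _ _ zs) JmapD addrACA.
Qed.

Lemma Jmap_Fmap z a : slit z -> Jmap (Fmap E z a) = a - hproj E z a.
Proof.
move=> zs; have [a' aE] := vert_decomp a zs; rewrite (Fmap_eq zs aE).
rewrite JmapB JmapJ subr0 (Jmap_hproj _ zs); apply/eqP.
by rewrite eq_sym subr_eq; apply/eqP.
Qed.

Lemma hproj_Fmap z a : slit z -> hproj E z (Fmap E z a) = Fmap E z a + Jmap a.
Proof.
move=> zs; have [a' aE] := vert_decomp a zs; rewrite (Fmap_eq zs aE).
rewrite (hprojB (hproj E z a') (Jmap a) zs) (hproj_Jmap a zs) (hprojK a' zs).
by rewrite subr0 subrK.
Qed.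

(** Near each point the vertical part of [X] is [J Y] with [Y] smooth, and then
    [F X = h Y - J X]. In a chart, [Y] has as base components the fibre
    components of the vertical part of [X]. *)
Lemma smooth_Fmap W X : openTM W -> W `<=` slit -> smooth_field W X ->
  smooth_field W (app1 (Fmap E) X).
Proof.
move=> oW Ws sX; apply: smooth_field_local => // z Wz.
set c := tchart z; have zc : Tdom c z := Tdom_tchart z.
have oW' : openTM (W `&` Tdom c) by apply: openTM_I => //; exact: openTM_Tdom.
have WW : W `&` Tdom c `<=` W by move=> t [].
have Ws' : W `&` Tdom c `<=` slit by move=> t /WW /Ws.
exists c, (W `&` Tdom c); split=> //.
have sX' := smooth_field_sub WW sX.
have sh := smooth_hproj oW' Ws' sX'.
have sv := smooth_fieldB oW' sX' sh.
pose Y := chart_field c (fun w => ((field_coord c (fun t => X t - app1 (hproj E) X t) w).2, 0)).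
have sY : smooth_field (W `&` Tdom c) Y.
  apply: smooth_chart_field => [|t []//|k]; first exact: oW'.
  apply: (Ck_pair (oW' c)); last exact: Ck_cst.
  by apply: (@Ck_comp _ _ _ _ k _ setT _ snd framed_vec (oW' c) _ (sv c k)) => //;
    apply: Ck_snd; apply: openT.
have JY t : (W `&` Tdom c) t -> Jmap (Y t) = X t - hproj E t (X t).
  move=> [Wt tc]; apply: (@field_eq_coord _ _ _ c (Jf Y) (fun t => X t - app1 (hproj E) X t)) => //.
  have tr := tphi_cran tc.
  rewrite (field_coord_Jf _ tr) chart_fieldE; last exact: tr.
  rewrite -Jmap_image// -(field_coord_Jf _ tr) (field_coord_tphi _ tc) /Jf.
  by rewrite JmapB (Jmap_hproj _ (Ws t Wt)) subrr tchange0.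
have H := smooth_fieldB oW' (smooth_hproj oW' Ws' sY) (smooth_Jf oW' sX').
have Q : smooth_field (W `&` Tdom c) (app1 (Fmap E) X).
  apply: (smooth_field_eq oW' _ H) => t tW; rewrite /app1 /Jf.
  by rewrite (Fmap_eq (Ws' t tW) (b := Y t) (c := X t))// JY// subrK.
exact: Q.
Qed.

End Barthel.

(** * The Bianchi identity on the nullity distribution *)

(** The operators [br], [D], [J], [h], [G], [Fm] and the element [S] stand for the
    bracket, the Cartan connection, the almost tangent structure, the horizontal
    projector, the Barthel connection, the almost complex structure and the
    spray. By [sep] an equation between sums reduces to a linear equation between
    real numbers. *)
Section AbstractBianchi.
Context {R : realType} {F : zmodType}.
Hypothesis sep : forall x : F, (forall l : {additive F -> R}, l x = 0) -> x = 0.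
Variables (br D : F -> F -> F) (J h G Fm : F -> F) (S : F).
Implicit Types A B C X Y Z T : F.

Hypothesis brDl : forall X Y Z, br (X + Y) Z = br X Z + br Y Z.
Hypothesis brC : forall X Y, br X Y = - br Y X.
Hypothesis jacobi : forall X Y Z,
  br X (br Y Z) + br Y (br Z X) + br Z (br X Y) = 0.
Hypothesis JD : forall X Y, J (X + Y) = J X + J Y.
Hypothesis JJ : forall X, J (J X) = 0.
Hypothesis nij : forall X Y, br (J X) (J Y) = J (br (J X) Y) + J (br X (J Y)).
Hypothesis GE : forall X, G X = br (J X) S - J (br X S).
Hypothesis hE : forall X, h X + h X = X + G X.
Hypothesis hD : forall X Y, h (X + Y) = h X + h Y.
Hypothesis Jh : forall X, J (h X) = J X.
Hypothesis hJ : forall X, h (J X) = 0.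
Hypothesis FD : forall X Y, Fm (X + Y) = Fm X + Fm Y.
Hypothesis FJ : forall X, Fm (J X) = h X.
Hypothesis JF : forall X, J (Fm X) = X - h X.
Hypothesis hF : forall X, h (Fm X) = Fm X + J X.
Hypothesis DDl : forall X Y Z, D (X + Y) Z = D X Z + D Y Z.
Hypothesis DDr : forall X Y Z, D X (Y + Z) = D X Y + D X Z.
Hypothesis DF : forall X Y, D X (Fm Y) = Fm (D X Y).

(** On vector fields this is the first Cartan tensor. *)
Definition torsion_part X Y : F := D (J X) (J Y) - J (br (J X) Y).

Hypothesis torsion_partC : forall X Y, torsion_part X Y = torsion_part Y X.
Hypothesis J_torsion_part : forall X Y, J (torsion_part X Y) = 0.
Hypothesis J_Dh : forall X Y, J (D (h X) (J Y)) = 0.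

Lemma additive_opp (f : F -> F) : (forall X Y, f (X + Y) = f X + f Y) ->
  (f 0 = 0) * (forall X, f (- X) = - f X) * (forall X Y, f (X - Y) = f X - f Y).
Proof.
move=> fD; have f0 : f 0 = 0 by apply: (addrI (f 0)); rewrite -fD !addr0.
have fN X : f (- X) = - f X by apply: (addrI (f X)); rewrite -fD !subrr.
by split=> // X Y; rewrite fD fN.
Qed.

Let JE := additive_opp JD.
Let hE' := additive_opp hD.
Let FE := additive_opp FD.
Let DEr X := additive_opp (DDr X).
Let DEl Y := additive_opp (fun X X' => DDl X X' Y).
Let brEl Y := additive_opp (fun X X' => brDl X X' Y).

Let brDr X Y Z : br X (Y + Z) = br X Y + br X Z.
Proof. by rewrite brC brDl opprD -!(brC X). Qed.

Let brEr X := additive_opp (brDr X).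

Let addE := (JE, hE', FE, JD, hD, FD, DDl, DDr, brDl, brDr,
  fun X => (DEr X, DEl X, brEl X, brEr X)).

Let jacobi' X Y Z : br (br X Y) Z = br X (br Y Z) - br Y (br X Z).
Proof.
have := jacobi X Y Z; rewrite (brC Z (br X Y)) (brC Z X) (brEr Y).1.2 => /subr0_eq.
by move=> ->.
Qed.

Let hh X : h (h X) = h X.
Proof.
by have := congr1 h (JF X); rewrite hJ hE'.2 => /esym/subr0_eq.
Qed.

Let GhE X : G X = h X + h X - X.
Proof. by rewrite hE addrC addKr. Qed.

Let nij_barthel X Y : br (J X) (G Y) + br (G X) (J Y) - J (br (G X) Y) - J (br X (G Y))
   - G (br (J X) Y) - G (br X (J Y)) = 0.
Proof.
apply: sep => l; rewrite !GE.
have j1 := congr1 l (jacobi' (J X) (J Y) S).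
have j2 := congr1 (fun t => l (J t)) (jacobi' (J X) Y S).
have j3 := congr1 (fun t => l (J t)) (jacobi' X (J Y) S).
have n1 := congr1 l (nij X (br Y S)).
have n2 := congr1 l (nij (br X S) Y).
have n3 := congr1 (fun t => l (br t S)) (nij X Y).
have c1 := congr1 l (brC (br (J X) S) (J Y)).
have c2 := congr1 (fun t => l (J t)) (brC (br (J X) S) Y).
have c3 := congr1 (fun t => l (J t)) (brC (br X S) (J Y)).
move: j1 j2 j3 n1 n2 n3 c1 c2 c3.
rewrite !addE !(raddfD l, raddfN l, raddfB l, raddf0 l).
lra.
Qed.

(** The Barthel connection has no weak torsion: this is [[J, [J, S]] = 0], a
    consequence of [[J, J] = 0] and of the Jacobi identity. *)
Lemma weak_torsion X Y :
  J (br (h X) (h Y)) =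
  (br (h X) (J Y) - h (br (h X) (J Y))) + (br (J X) (h Y) - h (br (J X) (h Y))).
Proof.
apply/eqP; rewrite -subr_eq0; apply/eqP; apply: sep => l.
have := congr1 l (nij_barthel (h X) (h Y)).
rewrite (GhE (br _ _)) (GhE (br (h X) _)) (GhE (h X)) (GhE (h Y)) !hh !Jh.
rewrite !addE !(raddfD l, raddfN l, raddfB l, raddf0 l).
lra.
Qed.

Let vert_h X : J X = 0 -> h X = 0.
Proof. by move=> JX; rewrite -FJ JX FE. Qed.

Lemma J_DJ X Y : J (D (J X) (J Y)) = 0.
Proof.
have := J_torsion_part X Y; rewrite /torsion_part JE.2 JJ subr0; exact.
Qed.

(** [Fm] exchanges vertical and horizontal fields, so an operator that commutes
    with [Fm] and preserves the vertical fields also preserves the horizontal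
    ones; it then commutes with [J], and with [h] since [h = Fm J]. *)
Lemma D_J A : (forall Y, J (D A (J Y)) = 0) -> forall X, D A (J X) = J (D A X).
Proof.
move=> vA X.
have hX : J (D A X) = J (D A (h X)).
  by apply/eqP; rewrite -subr_eq0 -JE.2 -(DEr A).2 -JF vA.
rewrite hX -FJ DF JF (vert_h (vA X)) subr0 //.
Qed.

Lemma D_h A : (forall Y, J (D A (J Y)) = 0) -> forall X, D A (h X) = h (D A X).
Proof. by move=> vA X; rewrite -FJ DF (D_J vA) FJ. Qed.

Definition curv A B T := D A (D B T) - D B (D A T) - D (br A B) T.

Lemma curvC A B T : curv A B T = - curv B A T.
Proof.
by rewrite /curv (brC A B) (DEl T).1.2 opprK [RHS]opprB opprB addrC.
Qed.

Lemma curvDl A A' B T : curv (A + A') B T = curv A B T + curv A' B T.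
Proof.
apply/eqP; rewrite -subr_eq0; apply/eqP; apply: sep => l.
by rewrite /curv !addE !(raddfD l, raddfN l, raddfB l, raddf0 l); lra.
Qed.

Lemma curvDr A B B' T : curv A (B + B') T = curv A B T + curv A B' T.
Proof. by rewrite curvC curvDl opprD -!curvC. Qed.

(** The second Bianchi identity: the terms in three derivatives cancel in pairs,
    the others by the Jacobi identity. *)
Lemma bianchi A B C T :
  (D A (curv B C T) - curv B C (D A T) - curv (br A B) C T) +
  (D B (curv C A T) - curv C A (D B T) - curv (br B C) A T) +
  (D C (curv A B T) - curv A B (D C T) - curv (br C A) B T) = 0.
Proof.
apply: sep => l; rewrite /curv !addE.
have j := congr1 (fun t => l (D t T)) (jacobi A B C).
have c1 := congr1 (fun t => l (D t T)) (brC (br A B) C).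
have c2 := congr1 (fun t => l (D t T)) (brC (br B C) A).
have c3 := congr1 (fun t => l (D t T)) (brC (br C A) B).
move: j c1 c2 c3; rewrite !addE !(raddfD l, raddfN l, raddfB l, raddf0 l); lra.
Qed.

Definition hv_part X Y T : F := curv (h X) (J Y) (J T).

Definition D_hv_part A X Y T : F :=
  D A (hv_part X Y T) - hv_part (D A X) Y T - hv_part X (D A Y) T
  - hv_part X Y (D A T).

Definition A_part X Y Z T : F :=
  - hv_part (Fm (torsion_part Z X)) Y T - D_hv_part (J X) Y Z T
  - D_hv_part (J Z) X Y T.

Let curvNr A B U : curv A (- B) U = - curv A B U.
Proof. exact: (additive_opp (fun B B' => curvDr A B B' U)).1.2. Qed.

Let curvNl A B U : curv (- A) B U = - curv A B U.
Proof. exact: (additive_opp (fun A A' => curvDl A A' B U)).1.2. Qed.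

(** The Bianchi identity on [X], [J Y], [J Z]. The curvature of two vertical
    fields, one of which is [J Y], vanishes; and [D (J Y) X] differs from
    [h [J Y, X]] by the torsion term. *)
Lemma bianchi_nullity X Y Z T : h X = X ->
  (forall B U, curv (J Y) (J B) (J U) = 0) ->
  curv (br X (J Y) - h (br X (J Y))) (J Z) (J T) =
  - D_hv_part (J Y) X Z T - hv_part (Fm (torsion_part Y X)) Z T
  + D_hv_part (J Z) X Y T + hv_part (Fm (torsion_part Z X)) Y T.
Proof.
move=> hX nY.
have vJ A B : J (D (J A) (J B)) = 0 := J_DJ A B.
have vX B : J (D X (J B)) = 0 by rewrite -hX; exact: J_Dh.
have DJX A : D (J A) X = h (br (J A) X) + Fm (torsion_part A X).
  by rewrite -{1}hX -FJ DF -{1}(subrK (J (br (J A) X)) (D (J A) (J X))) addrC FD FJ.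
have hFC A B : h (Fm (torsion_part A B)) = Fm (torsion_part A B).
  by rewrite hF J_torsion_part addr0.
have hDX A : h (D (J A) X) = D (J A) X by rewrite -(D_h (vJ A)) hX.
have tor : J (D (J Y) Z) - J (D (J Z) Y) - br (J Y) (J Z) = 0.
  rewrite -(D_J (vJ Y)) -(D_J (vJ Z)); apply: sep => l.
  have := congr1 l (torsion_partC Y Z); have := congr1 l (nij Y Z).
  have := congr1 (fun t => l (J t)) (brC Y (J Z)).
  rewrite /torsion_part !addE !(raddfD l, raddfN l, raddfB l, raddf0 l); lra.
have torK := congr1 (fun t => curv X t (J T)) tor.
have vK A : curv (A - h A) (J Y) (J T) = 0.
  by rewrite -JF curvC nY oppr0.
have spl A B : curv A (J B) (J T) = curv (A - h A) (J B) (J T) + curv (h A) (J B) (J T).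
  by rewrite -curvDl subrK.
have B0 := bianchi X (J Y) (J Z) (J T).
have c1 := curvC (J Z) X (J T); have c2 := curvC (J Z) X (D (J Y) (J T)).
have c3 := curvC (br (J Y) (J Z)) X (J T).
rewrite /D_hv_part /hv_part !hX !hDX !hFC.
apply/eqP; rewrite -subr_eq0; apply/eqP; apply: sep => l.
move: (congr1 l B0) (congr1 l torK).
rewrite c1 c2 c3 (D_J vX) !nY (spl (br (J Z) X)) vK (spl (br X (J Y))).
rewrite (brC X (J Y)) !(D_J (vJ Y)) !(D_J (vJ Z)) (DJX Y) (DJX Z) !curvDl.
rewrite !curvDr !curvNr (additive_opp (fun B B' => curvDr X B B' (J T))).1.1.
move: (curv (Fm (torsion_part Y X)) (J Z) (J T))
  (curv (Fm (torsion_part Z X)) (J Y) (J T)) => a1 a2.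
rewrite !addE !curvNl.
move: (curv (br (J Y) X) (J Z) (J T)) (curv (h (br (J Y) X)) (J Z) (J T))
  (D (J Y) (curv X (J Z) (J T))) (curv X (J Z) (J (D (J Y) T)))
  (curv X (br (J Y) (J Z)) (J T)) (D (J Z) (curv X (J Y) (J T)))
  (curv X (J Y) (J (D (J Z) T))) (curv (h (br (J Z) X)) (J Y) (J T))
  (curv X (J (D (J Y) Z)) (J T)) (curv X (J (D (J Z) Y)) (J T)).
move=> a3 a4 a5 a6 a7 a8 a9 a10 a11 a12.
rewrite !(raddfD l, raddfN l, raddfB l, raddf0 l); lra.
Qed.

(** The vertical part [J [X, Y]] is the skew part of the vertical component of
    [[X, J Y]], whose curvature the Bianchi identity expresses through the
    hv-curvature. *)
Lemma nullity_bracket X Y Z T : h X = X -> h Y = Y ->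
  (forall B U, curv (J X) (J B) (J U) = 0) ->
  (forall B U, curv (J Y) (J B) (J U) = 0) ->
  curv (J (br X Y)) (J Z) (J T) = A_part Y X Z T - A_part X Y Z T.
Proof.
move=> hX hY nX nY.
have E : J (br X Y) = (br X (J Y) - h (br X (J Y))) - (br Y (J X) - h (br Y (J X))).
  by rewrite -{1}hX -{1}hY weak_torsion hX hY (brC (J X) Y) hE'.1.2 -opprD.
rewrite E curvDl curvNl (bianchi_nullity Z T hX nY) (bianchi_nullity Z T hY nX).
rewrite (torsion_partC X Y) /A_part.
move: (D_hv_part (J Y) X Z T) (D_hv_part (J X) Y Z T) (D_hv_part (J Z) X Y T)
  (D_hv_part (J Z) Y X T) (hv_part (Fm (torsion_part Y X)) Z T)
  (hv_part (Fm (torsion_part Z X)) Y T) (hv_part (Fm (torsion_part Z Y)) X T).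
move=> a b c d e f g; apply/eqP; rewrite -subr_eq0; apply/eqP; apply: sep => l.
rewrite !(raddfD l, raddfN l, raddfB l, raddf0 l); lra.
Qed.

End AbstractBianchi.

#[local] Opaque der has_der Ck tpsi tphi ttrans tchange transition field_coord
  bracket dfun extend Jmap.

#[local] Opaque hproj vproj barthel Fmap.

(** * The Cartan tensors *)

Section CartanTensors.
Context {R : realType} {n : nat} {M : smooth_manifold R n}.
Variables (E : TM M -> R) (hE : finsler E).
Notation V := (vec R n).
Notation field := (TM M -> V).
Notation slit := (slitTM : set (TM M)).
Implicit Types (i j : chart M) (w a b e : V) (z : TM M) (X Y : field)
  (W : set (TM M)).

Let sE : smooth_fun slit E := finsler_smooth hE.
Let oS : openTM slit := @openTM_slit R n M.
Arguments oS : clear implicits.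

Lemma dfun_eq W f g z a : openTM W -> W z -> smooth_fun W f ->
  (forall t, W t -> f t = g t) -> dfun f z a = dfun g z a.
Proof.
move=> oW Wz sf fg; have zc := Tdom_tchart z.
have wW : tcoord (tchart z) W (tphi (tchart z) z) by exact: tcoord_tphi.
have Eu u : tcoord (tchart z) W u -> (f \o tpsi (tchart z)) u = (g \o tpsi (tchart z)) u.
  by move=> [_ Wu]; apply: fg.
have [_ E1] := der_eq_on (oW (tchart z)) wW Eu (fun_has_der sf wW).
rewrite !dfunE; exact: (congr1 (@^~ a) (esym E1)).
Qed.

Lemma dfun_cst (c : R) z a : dfun (fun=> c) z a = 0.
Proof.
rewrite dfunE; exact: (congr1 (@^~ a) (der_cst c (tphi (tchart z) z)).2).
Qed.

Lemma bracket_vanish W X Y z : openTM W -> W z -> (forall t, W t -> X t = 0) ->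
  bracket X Y z = 0.
Proof.
move=> oW Wz X0; have s0 := @smooth_field0 R n M W.
rewrite -(bracket_eq Y oW Wz s0 (fun t Wt => esym (X0 t Wt))).
have := bracket_add Y oW Wz s0 s0; rewrite (_ : (fun t => 0 + 0) = fun=> 0).
  by move/eqP; rewrite -subr_eq0 opprD addrA subrr sub0r oppr_eq0 => /eqP.
by apply/funext => t; rewrite addr0.
Qed.

Lemma der_coord_extend z a v :
  der (field_coord (tchart z) (extend z a)) (tphi (tchart z) z) v = 0.
Proof.
have zc := Tdom_tchart z; have cz := tphi_cran zc.
have oi : open [set w : V | cran (tchart z) w.1] by apply: open_fst; apply: open_cran.
have [d1 E1] := der_cst a (tphi (tchart z) z).
have Eu u : cran (tchart z) u.1 -> a = field_coord (tchart z) (extend z a) u.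
  by move=> ui; rewrite (extend_coord a ui).
have [_ E2] := der_eq_on oi cz Eu d1.
exact: (congr1 (@^~ v) (etrans E2 E1)).
Qed.

Lemma bracket_J_extend z a b : slit z -> bracket (Jf (extend z a)) (extend z b) z = 0.
Proof.
move=> zs; have zc := Tdom_tchart z.
have oW := @openTM_slitI R n M (tchart z).
have sX : smooth_field (slit `&` Tdom (tchart z)) (extend z a).
  by apply: smooth_extend => // t [].
have wW : tcoord (tchart z) (slit `&` Tdom (tchart z)) (tphi (tchart z) z).
  by apply: tcoord_tphi.
by rewrite bracketE der_coord_extend (der_coord_Jf _ oW sX wW) der_coord_extend Jmap0 subr0.
Qed.

Lemma Omega0l z b : slit z -> Omega E z 0 b = 0.
Proof. by move=> zs; rewrite -(subrr (0 : V)) (Omega_subl hE _ _ _ zs) subrr. Qed.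

Lemma Omega_vert_vert z a b : slit z -> Jmap b = 0 -> Omega E z (Jmap a) b = 0.
Proof. by move=> zs b0; rewrite (Omega_vert hE _ _ zs) b0 hess0. Qed.

Lemma Fmap0 z : slit z -> Fmap E z 0 = 0.
Proof.
move=> zs; have := FmapD hE 0 0 zs; rewrite addr0 => /eqP.
by rewrite -subr_eq0 opprD addrA subrr sub0r oppr_eq0 => /eqP.
Qed.

Lemma metric0r z a : slit z -> metric E z a 0 = 0.
Proof.
move=> zs; rewrite /metric (Fmap0 zs).
have := Omega_chart_linearr hE a (tcoord_tphi (Tdom_tchart z) zs) (-1) 0 0.
rewrite -!(Omega_self hE _ _ zs) scaler0 addr0 scaleN1r => /eqP.
by rewrite addNr => /eqP.
Qed.

Lemma JmetricE z a b : slit z -> Jmetric E z a b = Omega E z (Jmap a) b.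
Proof.
move=> zs; rewrite /Jmetric /metric (Fmap_Jmap hE _ zs).
by rewrite !(Omega_vert hE _ _ zs) (Jmap_hproj hE _ zs).
Qed.

Lemma Jmetric_extend z t b e : slit t -> Tdom (tchart z) t ->
  Jmetric E t (extend z b t) (extend z e t) =
  hess E (tchart z) (tphi (tchart z) t) (Jmap b) (Jmap e).
Proof.
move=> ts tc; have tt := Tdom_tchart t.
have X d : tchange (tchart t) (tchart z) t (extend z d t) = d.
  by rewrite -(field_coord_tphi _ tc) (extend_coord d (tphi_cran tc)).
rewrite (JmetricE _ _ ts) (Omega_coord hE _ _ ts tc) (tchange_Jmap _ tt tc) !X.
by rewrite /Omega_chart JmapJ hess0 subr0.
Qed.

(** The brackets of the constant extensions vanish, and in the chart the metric
    of their vertical lifts is the vertical Hessian of [E]. *)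
Lemma lie2_Jmetric z a b e : slit z ->
  lie2 (Jf (extend z a)) (Jmetric E) (extend z b) (extend z e) z =
  der (fun u => hess E (tchart z) u (Jmap b) (Jmap e)) (tphi (tchart z) z) (Jmap a).
Proof.
move=> zs; have zc := Tdom_tchart z.
rewrite /lie2 !(bracket_J_extend _ _ zs) !(JmetricE _ _ zs).
rewrite Jmap0 (Omega0l _ zs) subr0.
rewrite (Omega_vert_vert _ zs Jmap0) subr0 dfunE /Jf extend_at.
have oW := @openTM_slitI R n M (tchart z) (tchart z).
have wW : tcoord (tchart z) (slit `&` Tdom (tchart z)) (tphi (tchart z) z).
  by apply: tcoord_tphi.
have d1 := Ck_has_der (Ck_der (Jmap b) (Ck_der (Jmap e) (sE (tchart z) 3)))
  (tcoord_tphi zc zs).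
have Eu u : tcoord (tchart z) (slit `&` Tdom (tchart z)) u ->
   hess E (tchart z) u (Jmap b) (Jmap e) =
   ((fun t => Jmetric E t (extend z b t) (extend z e t)) \o tpsi (tchart z)) u.
  move=> [ui [us uc]] /=; apply: esym; apply: etrans (Jmetric_extend b e us uc) _.
  by rewrite (tpsiK ui).
have [_ E1] := der_eq_on oW wW Eu d1.
exact: (congr1 (@^~ (Jmap a)) E1).
Qed.

(** The defining form is a third vertical derivative of [E]. *)
Lemma cartan1C z a b : slit z -> cartan1 E z a b = cartan1 E z b a.
Proof.
move=> zs.
pose P a b : set V := fun c => forall e, Omega E z c e =
  2^-1 * lie2 (Jf (extend z a)) (Jmetric E) (extend z b) (extend z e) z.
have L e : lie2 (Jf (extend z a)) (Jmetric E) (extend z b) (extend z e) z =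
           lie2 (Jf (extend z b)) (Jmetric E) (extend z a) (extend z e) z.
  rewrite !(lie2_Jmetric _ _ _ zs).
  have C2 := Ck_der (Jmap e) (sE (tchart z) 3).
  exact: (der_derC _ _ (@framed_real R) (oS (tchart z)) (tcoord_tphi (Tdom_tchart z) zs) C2).
have S : P a b = P b a.
  by apply/funext => c; apply/propext; split=> H e; rewrite H L.
exact: (congr1 the_vec S).
Qed.

(** The defining form vanishes on vertical [e]. *)
Lemma cartan1_vert z a b : slit z -> Jmap (cartan1 E z a b) = 0.
Proof.
move=> zs; rewrite /cartan1 /the_vec.
case: xgetP => [c _ /= H|_]; last exact: Jmap0.
apply: (vertical_Omega hE zs) => e; rewrite H (lie2_Jmetric _ _ _ zs).
rewrite JmapJ (_ : (fun u => _) = fun=> 0).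
  by rewrite (der_cst _ _).2 mulr0.
by apply/funext => u; rewrite hess0.
Qed.

Lemma cartan2_vert z a b : slit z -> Jmap (cartan2 E z a b) = 0.
Proof.
move=> zs; rewrite /cartan2 /the_vec.
case: xgetP => [c _ /= H|_]; last exact: Jmap0.
apply: (vertical_Omega hE zs) => e; rewrite H.
have zc := Tdom_tchart z; have oW := @openTM_slitI R n M (tchart z).
have Wz : (slit `&` Tdom (tchart z)) z by [].
have J0 t : (slit `&` Tdom (tchart z)) t -> Jf (extend z (Jmap e)) t = 0.
  move=> [ts tc]; apply: (@field_eq_coord _ _ _ (tchart z) _ (fun=> 0)) => //.
  have tr := tphi_cran tc.
  by rewrite (field_coord_Jf _ tr) (extend_coord _ tr) JmapJ (field_coord_tphi _ tc) tchange0.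
rewrite /lie2 (bracketC _ (Jf (extend z (Jmap e)))) (bracket_vanish _ oW Wz J0) oppr0.
rewrite (J0 z Wz) !(metric0r _ zs) !subr0.
rewrite -(@dfun_eq (slit `&` Tdom (tchart z)) (fun=> 0) _ z _ oW Wz).
- by rewrite dfun_cst mulr0.
- exact: smooth_fun_cst.
- by move=> t tW; rewrite (J0 t tW) (metric0r _ tW.1).
Qed.

End CartanTensors.

(** * Linear connections and the tensor character of the curvature *)

Section Connections.
Context {R : realType} {n : nat} {M : smooth_manifold R n}.
Notation V := (vec R n).
Notation field := (TM M -> V).
Notation slit := (slitTM : set (TM M)).
Implicit Types (a b : V) (z : TM M) (X Y Z T A B : field) (W : set (TM M)).

(** Near [z] a field is a combination of the coordinate frame, with functions as
    coefficients; and a field vanishing near [z] is its own multiple by a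
    function vanishing near [z]. *)
Lemma tensorial (W : set (TM M)) (z : TM M) (Phi : field -> V) :
  openTM W -> W z ->
  (forall U X X', openTM U -> U `<=` W -> U z -> smooth_field U X ->
    smooth_field U X' -> Phi (fun t => X t + X' t) = Phi X + Phi X') ->
  (forall U f X, openTM U -> U `<=` W -> U z -> smooth_fun U f ->
    smooth_field U X -> Phi (fun t => f t *: X t) = f z *: Phi X) ->
  forall X X', smooth_field W X -> smooth_field W X' -> X z = X' z -> Phi X = Phi X'.
Proof.
move=> oW Wz PD PZ X X' sX sX' XX.
suff P0 Y : smooth_field W Y -> Y z = 0 -> Phi Y = 0.
  have sN := smooth_fieldZ (-1) oW sX'.
  have E0 := P0 _ (smooth_field_add oW sX sN).
  rewrite (PD W) ?(PZ W (fun=> -1)) // in E0; last exact: smooth_fun_cst.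
  by apply/eqP; rewrite -subr_eq0 -scaleN1r E0// XX scaleN1r subrr.
move=> sY Y0; set c := tchart z; have zc : Tdom c z := Tdom_tchart z.
pose U := W `&` Tdom c.
have oU : openTM U by apply: openTM_I => //; exact: openTM_Tdom.
have UW : U `<=` W by move=> t [].
have Uc : U `<=` Tdom c by move=> t [].
have Uz : U z by [].
have sYU := smooth_field_sub UW sY.
have [I [e [l [lc lE]]]] := @framed_vec R n.
pose f j (t : TM M) : R := l j (field_coord c Y (tphi c t)).
have sf j : smooth_fun U (f j).
  apply: smooth_fun_local => // t Ut; exists c, U; split=> // [|k]; first exact: Uc.
  apply: (Ck_ext (oU c) _ (Ck_lin (lc j) (oU c) (sYU c k))) => u [ui Uu].
  by rewrite /f /= (tpsiK ui).
have se j : smooth_field U (extend z (e j)) by apply: smooth_extend.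
pose S (r : seq I) (t : TM M) : V := \sum_(j <- r) f j t *: extend z (e j) t.
have PS r : smooth_field U (S r) /\ Phi (S r) = \sum_(j <- r) f j z *: Phi (extend z (e j)).
  elim: r => [|j r [sS IH]].
    rewrite (_ : S [::] = fun=> 0); last by apply/funext => t; rewrite /S big_nil.
    have s0 := @smooth_field0 R n M U; split=> //; rewrite big_nil.
    rewrite -[LHS](_ : Phi (fun t => 0 *: 0) = _).
      by rewrite (PZ U (fun=> 0)) // ?scale0r//; exact: smooth_fun_cst.
    by congr Phi; apply/funext => t; rewrite scaler0.
  have -> : S (j :: r) = fun t => f j t *: extend z (e j) t + S r t.
    by apply/funext => t; rewrite /S big_cons.
  have sj := smooth_field_scale oU (sf j) (se j).
  split; first exact: smooth_field_add.
  by rewrite (PD U) // (PZ U) // IH big_cons.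
have [sS PSE] := PS (index_enum I).
have SE t : U t -> S (index_enum I) t = Y t.
  move=> [Wt tc]; rewrite -[RHS](tchangeK _ (Tdom_tchart t) tc) -(field_coord_tphi _ tc).
  rewrite [in RHS](lE (field_coord c Y (tphi c t))).
  rewrite (big_morph (tchange c (tchart t) t) (tchangeD c (tchart t) t) (tchange0 c (tchart t) t)).
  by apply: eq_bigr => j _; rewrite tchangeZ extendE.
pose g (t : TM M) : R := if `[< U t >] then 0 else 1.
pose N t := Y t - S (index_enum I) t.
have sN : smooth_field U N by apply: smooth_fieldB.
have sg : smooth_fun U g.
  move=> i k; apply: (Ck_ext (oU i) _ (Ck_cst k (tcoord i U) (0 : R))) => u [ui Uu].
  by rewrite /g /= asboolT.
have PN : Phi N = 0.
  rewrite (_ : N = fun t => g t *: N t).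
    by rewrite (PZ U) // /g asboolT // scale0r.
  apply/funext => t; rewrite /g; case: asboolP => Ut; last by rewrite scale1r.
  by rewrite /N SE // subrr scale0r.
rewrite (_ : Y = fun t => S (index_enum I) t + N t).
  rewrite (PD U) // PN addr0 PSE; apply: big1 => j _.
  by rewrite /f field_coord_self Y0 raddf0 scale0r.
by apply/funext => t; rewrite /N addrC subrK.
Qed.

Lemma bracket_local W X X' Y Y' z : openTM W -> W z -> smooth_field W X ->
  smooth_field W Y -> (forall t, W t -> X t = X' t) -> (forall t, W t -> Y t = Y' t) ->
  bracket X Y z = bracket X' Y' z.
Proof.
move=> oW Wz sX sY XX YY; rewrite (bracket_eq Y oW Wz sX XX) bracketC.
by rewrite (bracket_eq X' oW Wz sY YY) -bracketC.
Qed.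

Variable D : field -> field -> field.
Hypothesis hD : linear_connection D.

Lemma conn_smooth W X Y : openTM W -> W `<=` slit -> smooth_field W X ->
  smooth_field W Y -> smooth_field W (D X Y).
Proof.
move=> oW Ws sX sY.
by have [] := hD oW Ws sX sX sY sY (@smooth_fun_cst R n M W 0).
Qed.

Lemma connDl W X X' Y z : openTM W -> W `<=` slit -> W z -> smooth_field W X ->
  smooth_field W X' -> smooth_field W Y ->
  D (fun t => X t + X' t) Y z = D X Y z + D X' Y z.
Proof.
move=> oW Ws Wz sX sX' sY.
by have [_ /(_ z Wz)[]] := hD oW Ws sX sX' sY sY (@smooth_fun_cst R n M W 0).
Qed.

Lemma connZl W f X Y z : openTM W -> W `<=` slit -> W z -> smooth_fun W f ->
  smooth_field W X -> smooth_field W Y ->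
  D (fun t => f t *: X t) Y z = f z *: D X Y z.
Proof.
move=> oW Ws Wz sf sX sY.
by have [_ /(_ z Wz)[]] := hD oW Ws sX sX sY sY sf.
Qed.

Lemma connDr W X Y Y' z : openTM W -> W `<=` slit -> W z -> smooth_field W X ->
  smooth_field W Y -> smooth_field W Y' ->
  D X (fun t => Y t + Y' t) z = D X Y z + D X Y' z.
Proof.
move=> oW Ws Wz sX sY sY'.
by have [_ /(_ z Wz)[]] := hD oW Ws sX sX sY sY' (@smooth_fun_cst R n M W 0).
Qed.

Lemma connZr W f X Y z : openTM W -> W `<=` slit -> W z -> smooth_fun W f ->
  smooth_field W X -> smooth_field W Y ->
  D X (fun t => f t *: Y t) z = dfun f z (X z) *: Y z + f z *: D X Y z.
Proof.
move=> oW Ws Wz sf sX sY.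
by have [_ /(_ z Wz)[]] := hD oW Ws sX sX sY sY sf.
Qed.

(** The difference of two fields that agree on [W] is its own multiple by the
    function equal to 0 on [W] and to 1 elsewhere, which is smooth on [W]. *)
Lemma conn_local W X X' Y Y' z : openTM W -> W `<=` slit -> W z ->
  smooth_field W X -> smooth_field W Y ->
  (forall t, W t -> X t = X' t) -> (forall t, W t -> Y t = Y' t) ->
  D X Y z = D X' Y' z.
Proof.
move=> oW Ws Wz sX sY XX YY.
have sX' := smooth_field_eq oW XX sX; have sY' := smooth_field_eq oW YY sY.
pose g (t : TM M) : R := if `[< W t >] then 0 else 1.
have gz : g z = 0 by rewrite /g asboolT.
have sg : smooth_fun W g.
  move=> i k; apply: (Ck_ext (oW i) _ (Ck_cst k (tcoord i W) (0 : R))) => u [ui Uu].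
  by rewrite /g /= asboolT.
have gN Z Z' : (forall t, W t -> Z t = Z' t) ->
    (fun t => g t *: (Z' t - Z t)) = fun t => Z' t - Z t.
  move=> ZZ; apply/funext => t; rewrite /g; case: asboolP => Wt.
    by rewrite ZZ // subrr scale0r.
  by rewrite scale1r.
have add Z Z' : (fun t => Z t + (Z' t - Z t)) = Z' :> field.
  by apply/funext => t; rewrite addrC subrK.
have sNX := smooth_fieldB oW sX' sX; have sNY := smooth_fieldB oW sY' sY.
transitivity (D X' Y z).
  rewrite -{1}(add X X') (connDl oW Ws Wz sX sNX sY) -(gN _ _ XX).
  by rewrite (connZl oW Ws Wz sg sNX sY) gz scale0r addr0.
rewrite -{1}(add Y Y') (connDr oW Ws Wz sX' sY sNY) -(gN _ _ YY).
by rewrite (connZr oW Ws Wz sg sX' sNY) gz scale0r addr0 YY // subrr scaler0 addr0.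
Qed.

Lemma curvature_skew W A B Z z : openTM W -> W `<=` slit -> W z ->
  smooth_field W A -> smooth_field W B -> smooth_field W Z ->
  curvature D A B Z z = - curvature D B A Z z.
Proof.
move=> oW Ws Wz sA sB sZ; rewrite /curvature.
have E : bracket A B = fun t => -1 *: bracket B A t.
  by apply/funext => t; rewrite bracketC scaleN1r.
rewrite E (connZl oW Ws Wz (@smooth_fun_cst R n M W (-1)) (smooth_bracket oW sB sA) sZ).
by rewrite scaleN1r opprK [RHS]opprB opprB addrC.
Qed.

Let sub_sub_addACA (p1 p2 p3 p4 p5 p6 : V) :
  p1 + p2 - (p3 + p4) - (p5 + p6) = p1 - p3 - p5 + (p2 - p4 - p6).
Proof. by apply/pair_equal_spec; split; apply/rowP => k; rewrite !mxE; ring. Qed.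

Lemma curvatureD1 W A A' B Z z : openTM W -> W `<=` slit -> W z ->
  smooth_field W A -> smooth_field W A' -> smooth_field W B -> smooth_field W Z ->
  curvature D (fun t => A t + A' t) B Z z =
  curvature D A B Z z + curvature D A' B Z z.
Proof.
move=> oW Ws Wz sA sA' sB sZ; rewrite /curvature.
have sDB := conn_smooth oW Ws sB sZ.
have sDA := conn_smooth oW Ws sA sZ; have sDA' := conn_smooth oW Ws sA' sZ.
rewrite (connDl oW Ws Wz sA sA' sDB).
rewrite -(conn_local (Y := fun t => D A Z t + D A' Z t)
  (Y' := D (fun t => A t + A' t) Z) oW Ws Wz sB _ (fun t _ => erefl)); last 2 first.
- exact: smooth_field_add.
- by move=> t Wt; rewrite (connDl oW Ws Wt sA sA' sZ).
rewrite (connDr oW Ws Wz sB sDA sDA').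
have sb := smooth_bracket oW sA sB; have sb' := smooth_bracket oW sA' sB.
have bE t : W t -> bracket A B t + bracket A' B t = bracket (fun t => A t + A' t) B t.
  by move=> Wt; rewrite (bracket_add _ oW Wt sA sA').
have bD := conn_local oW Ws Wz (smooth_field_add oW sb sb') sZ bE (fun t (_ : W t) => erefl (Z t)).
apply: etrans (congr1 (fun t => _ - t) (esym bD)) _.
rewrite (connDl oW Ws Wz sb sb' sZ).
exact: sub_sub_addACA.
Qed.

Lemma curvatureD3 W A B Z Z' z : openTM W -> W `<=` slit -> W z ->
  smooth_field W A -> smooth_field W B -> smooth_field W Z -> smooth_field W Z' ->
  curvature D A B (fun t => Z t + Z' t) z =
  curvature D A B Z z + curvature D A B Z' z.
Proof.
move=> oW Ws Wz sA sB sZ sZ'; rewrite /curvature.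
have DD A1 B1 : smooth_field W A1 -> smooth_field W B1 ->
    D A1 (D B1 (fun t => Z t + Z' t)) z = D A1 (D B1 Z) z + D A1 (D B1 Z') z.
  move=> s1 s2; have sZ1 := conn_smooth oW Ws s2 sZ; have sZ2 := conn_smooth oW Ws s2 sZ'.
  rewrite -(connDr oW Ws Wz s1 sZ1 sZ2); apply: esym.
  apply: (conn_local oW Ws Wz s1 _ (fun t _ => erefl)).
    exact: smooth_field_add.
  by move=> t Wt; rewrite (connDr oW Ws Wt s2 sZ sZ').
rewrite (DD _ _ sA sB) (DD _ _ sB sA) (connDr oW Ws Wz (smooth_bracket oW sA sB) sZ sZ').
move: (D _ _ z) (D _ _ z) (D _ _ z) (D _ _ z) (D _ _ z) (D _ _ z) => p1 p2 p3 p4 p5 p6.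
by apply/pair_equal_spec; split; apply/rowP => k; rewrite !mxE; ring.
Qed.

Lemma curvatureZ1 W f A B Z z : openTM W -> W `<=` slit -> W z -> smooth_fun W f ->
  smooth_field W A -> smooth_field W B -> smooth_field W Z ->
  curvature D (fun t => f t *: A t) B Z z = f z *: curvature D A B Z z.
Proof.
move=> oW Ws Wz sf sA sB sZ; rewrite /curvature.
have sDB := conn_smooth oW Ws sB sZ; have sDA := conn_smooth oW Ws sA sZ.
have sb := smooth_bracket oW sA sB.
rewrite (connZl oW Ws Wz sf sA sDB).
rewrite -(conn_local (Y := fun t => f t *: D A Z t)
  (Y' := D (fun t => f t *: A t) Z) oW Ws Wz sB _ (fun t _ => erefl)); last 2 first.
- exact: smooth_field_scale.
- by move=> t Wt; rewrite (connZl oW Ws Wt sf sA sZ).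
rewrite (connZr oW Ws Wz sf sB sDA).
have sBf := smooth_dfun oW sf sB.
have s1 := smooth_field_scale oW sf sb.
have s2 := smooth_fieldZ (-1) oW (smooth_field_scale oW sBf sA).
have bE t : W t -> f t *: bracket A B t + -1 *: (dfun f t (B t) *: A t) =
    bracket (fun t => f t *: A t) B t.
  by move=> Wt; rewrite (bracket_scale _ oW Wt sf sA) scaleN1r.
have bD := conn_local oW Ws Wz (smooth_field_add oW s1 s2) sZ bE (fun t (_ : W t) => erefl (Z t)).
apply: etrans (congr1 (fun t => _ - t) (esym bD)) _.
rewrite (connDl oW Ws Wz s1 s2 sZ) (connZl oW Ws Wz sf sb sZ).
rewrite (connZl oW Ws Wz (@smooth_fun_cst R n M W (-1)) (smooth_field_scale oW sBf sA) sZ).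
rewrite (connZl oW Ws Wz sBf sA sZ).
move: (D _ _ z) (D _ _ z) (D _ _ z) (D _ _ z) (f z) (dfun _ _ _) => p1 p2 p3 p4 p5 p6.
by apply/pair_equal_spec; split; apply/rowP => k; rewrite !mxE; ring.
Qed.

Lemma curvatureZ3 W f A B Z z : openTM W -> W `<=` slit -> W z -> smooth_fun W f ->
  smooth_field W A -> smooth_field W B -> smooth_field W Z ->
  curvature D A B (fun t => f t *: Z t) z = f z *: curvature D A B Z z.
Proof.
move=> oW Ws Wz sf sA sB sZ; rewrite /curvature.
have DD A1 B1 : smooth_field W A1 -> smooth_field W B1 ->
    D A1 (D B1 (fun t => f t *: Z t)) z =
    (dfun (fun t => dfun f t (B1 t)) z (A1 z) *: Z z + dfun f z (B1 z) *: D A1 Z z) +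
    (dfun f z (A1 z) *: D B1 Z z + f z *: D A1 (D B1 Z) z).
  move=> s1 s2; have sZ1 := conn_smooth oW Ws s2 sZ.
  have sBf := smooth_dfun oW sf s2.
  have s3 := smooth_field_scale oW sBf sZ; have s4 := smooth_field_scale oW sf sZ1.
  rewrite -(connZr oW Ws Wz sBf s1 sZ) -(connZr oW Ws Wz sf s1 sZ1).
  rewrite -(connDr oW Ws Wz s1 s3 s4); apply: esym.
  apply: (conn_local oW Ws Wz s1 _ (fun t _ => erefl)).
    exact: smooth_field_add.
  by move=> t Wt; rewrite (connZr oW Ws Wt sf s2 sZ).
rewrite (DD _ _ sA sB) (DD _ _ sB sA) (connZr oW Ws Wz sf (smooth_bracket oW sA sB) sZ).
rewrite (dfun_bracket oW Wz sf sA sB).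
move: (D A (D B Z) z) (D B (D A Z) z) (D (bracket A B) Z z) (D A Z z) (D B Z z) => p1 p2 p3 p4 p5.
move: (dfun (fun t => dfun f t (B t)) z (A z)) (dfun (fun t => dfun f t (A t)) z (B z)) => p6 p7.
move: (dfun _ _ _) (dfun _ _ _) (f z) (Z z) => p8 p9 p10 p11.
by apply/pair_equal_spec; split; apply/rowP => k; rewrite !mxE; ring.
Qed.

Lemma Jf_add X Y : Jf (fun t => X t + Y t) = fun t => Jf X t + Jf Y t.
Proof. by apply/funext => t; exact: JmapD. Qed.

Lemma Jf_scale (f : TM M -> R) X : Jf (fun t => f t *: X t) = fun t => f t *: Jf X t.
Proof. by apply/funext => t; exact: JmapZ. Qed.

(** The first and third arguments are covered by [tensorial], and the second one
    by skew symmetry. *)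
Lemma v_curv_tensorial W X X' Y Y' Z Z' z : openTM W -> W `<=` slit -> W z ->
  smooth_field W X -> smooth_field W Y -> smooth_field W Z ->
  smooth_field W X' -> smooth_field W Y' -> smooth_field W Z' ->
  X z = X' z -> Y z = Y' z -> Z z = Z' z ->
  v_curv D X Y Z z = v_curv D X' Y' Z' z.
Proof.
move=> oW Ws Wz sX sY sZ sX' sY' sZ' XX YY ZZ; rewrite /v_curv.
have sJ U := @smooth_Jf R n M U.
have skew X1 Y1 Z1 : smooth_field W X1 -> smooth_field W Y1 -> smooth_field W Z1 ->
    curvature D (Jf X1) (Jf Y1) (Jf Z1) z = - curvature D (Jf Y1) (Jf X1) (Jf Z1) z.
  by move=> s1 s2 s3; apply: (curvature_skew oW Ws Wz); apply: sJ.
have t1 X1 X2 Y1 Z1 : smooth_field W X1 -> smooth_field W X2 -> smooth_field W Y1 ->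
    smooth_field W Z1 -> X1 z = X2 z ->
    curvature D (Jf X1) (Jf Y1) (Jf Z1) z = curvature D (Jf X2) (Jf Y1) (Jf Z1) z.
  move=> s1 s2 s3 s4.
  apply: (tensorial (Phi := fun A => curvature D (Jf A) (Jf Y1) (Jf Z1) z)
    oW Wz _ _ s1 s2).
    move=> U A A' oU UW Uz sA sA'; rewrite Jf_add.
    apply: (curvatureD1 oU (subset_trans UW Ws) Uz); apply: sJ => //.
      exact: smooth_field_sub UW s3.
    exact: smooth_field_sub UW s4.
  move=> U f A oU UW Uz sf sA; rewrite Jf_scale.
  apply: (curvatureZ1 oU (subset_trans UW Ws) Uz sf); apply: sJ => //.
    exact: smooth_field_sub UW s3.
  exact: smooth_field_sub UW s4.
have t3 X1 Y1 Z1 Z2 : smooth_field W X1 -> smooth_field W Y1 -> smooth_field W Z1 ->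
    smooth_field W Z2 -> Z1 z = Z2 z ->
    curvature D (Jf X1) (Jf Y1) (Jf Z1) z = curvature D (Jf X1) (Jf Y1) (Jf Z2) z.
  move=> s1 s2 s3 s4.
  apply: (tensorial (Phi := fun A => curvature D (Jf X1) (Jf Y1) (Jf A) z)
    oW Wz _ _ s3 s4).
    move=> U A A' oU UW Uz sA sA'; rewrite Jf_add.
    apply: (curvatureD3 oU (subset_trans UW Ws) Uz); apply: sJ => //.
      exact: smooth_field_sub UW s1.
    exact: smooth_field_sub UW s2.
  move=> U f A oU UW Uz sf sA; rewrite Jf_scale.
  apply: (curvatureZ3 oU (subset_trans UW Ws) Uz sf); apply: sJ => //.
    exact: smooth_field_sub UW s1.
  exact: smooth_field_sub UW s2.
rewrite (t1 _ _ _ _ sX sX' sY sZ XX) (skew _ _ _ sX' sY sZ) (t1 _ _ _ _ sY sY' sX' sZ YY).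
by rewrite -(skew _ _ _ sX' sY' sZ); apply: t3.
Qed.

End Connections.

(** * The group of vector fields on an open set *)

Section SmoothFields.
Context {R : realType} {n : nat} {M : smooth_manifold R n}.
Notation V := (vec R n).
Notation field := (TM M -> V).

Record slit_open : Type := SlitOpen {
  slit_set :> set (TM M);
  slit_set_open : openTM slit_set;
  slit_set_sub : slit_set `<=` slitTM
}.

Variable W : slit_open.

(** The fields are made 0 outside [W], so that two of them are equal as soon as
    they agree on [W]. *)
Definition field_on : {pred field} :=
  fun X => `[< smooth_field W X /\ forall z, ~ slit_set W z -> X z = 0 >].

Lemma field_onP X : reflect (smooth_field W X /\ forall z, ~ slit_set W z -> X z = 0)
  (X \in field_on).
Proof. exact: asboolP. Qed.

Lemma field_on_zmod_closed : zmod_closed field_on.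
Proof.
split=> [|X Y /field_onP[sX X0] /field_onP[sY Y0]]; apply/field_onP.
  by split=> //; exact: smooth_field0.
split; last by move=> z Wz; rewrite !fctE X0 // Y0 // subr0.
have oW := @slit_set_open W.
exact: (smooth_fieldB oW sX sY).
Qed.

HB.instance Definition _ := GRing.isZmodClosed.Build field field_on
  field_on_zmod_closed.

Record smooth_on : Type := SmoothOn {
  field_of :> field;
  field_of_on : field_of \in field_on
}.

HB.instance Definition _ := [isSub for field_of].
HB.instance Definition _ := [Choice of smooth_on by <:].
HB.instance Definition _ := [SubChoice_isSubZmodule of smooth_on by <:].

Definition restrict (X : field) : smooth_on :=
  insubd 0 (fun z => if `[< slit_set W z >] then X z else 0).

Lemma restrictE X z : smooth_field W X -> slit_set W z -> restrict X z = X z.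
Proof.
move=> sX Wz; rewrite /restrict /insubd insubT /= ?asboolT //.
apply/field_onP; split=> [|t Wt]; last by rewrite asboolF.
have oW := @slit_set_open W.
have XX t : slit_set W t -> X t = if `[< slit_set W t >] then X t else 0.
  by move=> Wt; rewrite asboolT.
exact: (smooth_field_eq oW XX sX).
Qed.

Lemma smooth_on_smooth (X : smooth_on) : smooth_field W X.
Proof. by have /field_onP[] := field_of_on X. Qed.

Lemma smooth_on_eq (X Y : smooth_on) : (forall z, slit_set W z -> X z = Y z) -> X = Y.
Proof.
move=> XY; apply: val_inj; apply/funext => z.
have [Wz|Wz] := pselect (slit_set W z); first exact: XY.
have /field_onP[_ X0] := field_of_on X; have /field_onP[_ Y0] := field_of_on Y.
exact: etrans (X0 z Wz) (esym (Y0 z Wz)).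
Qed.

Lemma smooth_onD (X Y : smooth_on) z : (X + Y) z = X z + Y z.
Proof. by []. Qed.

Lemma smooth_onB (X Y : smooth_on) z : (X - Y) z = X z - Y z.
Proof. by []. Qed.

Lemma smooth_on0 z : (0 : smooth_on) z = 0.
Proof. by []. Qed.

Let comp1 z k (X : smooth_on) : R := (X z).1 0 k.
Let comp2 z k (X : smooth_on) : R := (X z).2 0 k.

Let comp1_zmod z k : zmod_morphism (comp1 z k).
Proof. by move=> X Y; rewrite /comp1 smooth_onB !mxE. Qed.

Let comp2_zmod z k : zmod_morphism (comp2 z k).
Proof. by move=> X Y; rewrite /comp2 smooth_onB !mxE. Qed.

(** The components at the points of [W] are additive functionals. *)
Lemma smooth_on_sep (X : smooth_on) :
  (forall l : {additive smooth_on -> R}, l X = 0) -> X = 0.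
Proof.
move=> X0; apply: smooth_on_eq => z _; rewrite smooth_on0 [LHS]surjective_pairing.
apply/pair_equal_spec; split; apply/rowP => k; rewrite mxE.
  pose l : {additive smooth_on -> R} := HB.pack (comp1 z k)
    (GRing.isZmodMorphism.Build _ _ (comp1 z k) (comp1_zmod z k)).
  exact: X0 l.
pose l : {additive smooth_on -> R} := HB.pack (comp2 z k)
  (GRing.isZmodMorphism.Build _ _ (comp2 z k) (comp2_zmod z k)).
exact: X0 l.
Qed.

End SmoothFields.

(** * The vertical curvature of the bracket of two nullity fields *)

Section Identity.
Context {R : realType} {n : nat} {M : smooth_manifold R n}.
Variables (E : TM M -> R) (hE : finsler E).
Notation V := (vec R n).
Notation field := (TM M -> V).
Variables (D0 D : field -> field -> field).
Hypotheses (hD0 : berwald_connection E D0) (hD : cartan_connection E D0 D).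
Variable W : @slit_open R n M.

Let oW : openTM (slit_set W) := @slit_set_open _ _ _ W.
Let Ws : slit_set W `<=` slitTM := @slit_set_sub _ _ _ W.
Let lD : linear_connection D := hD.1.
Notation sec := (smooth_on W).
Arguments oW : clear implicits.

(** Relates an expression in fields that are only relevant on [W], such as the
    defining expressions of the tensors, to the same expression in the group of
    fields on [W]. *)
Definition represents (X : field) (x : sec) : Prop :=
  smooth_field W X /\ forall z, slit_set W z -> x z = X z.

Lemma repr_restrict X : smooth_field W X -> represents X (restrict W X).
Proof. by move=> sX; split=> // z Wz; apply: restrictE. Qed.

Lemma repr_self (x : sec) : represents x x.
Proof. by split=> //; apply: smooth_on_smooth. Qed.

Lemma repr_inj X x Y y : represents X x -> represents Y y ->
  (forall z, slit_set W z -> X z = Y z) -> x = y.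
Proof.
move=> [_ xX] [_ yY] XY; apply: smooth_on_eq => z Wz.
exact: etrans (xX z Wz) (etrans (XY z Wz) (esym (yY z Wz))).
Qed.

Lemma repr_fun X x Y y z : represents X x -> represents Y y -> x = y -> slit_set W z -> X z = Y z.
Proof.
move=> [_ xX] [_ yY] xy Wz.
exact: etrans (esym (xX z Wz)) (etrans (congr1 (fun s : sec => s z) xy) (yY z Wz)).
Qed.

Lemma repr_eq X Y x : represents X x -> (forall z, slit_set W z -> X z = Y z) -> represents Y x.
Proof.
move=> [sX xX] XY; split; first exact: (smooth_field_eq oW XY sX).
by move=> z Wz; apply: etrans (xX z Wz) (XY z Wz).
Qed.

Lemma repr_add X x Y y : represents X x -> represents Y y ->
  represents (fun z => X z + Y z) (x + y).
Proof.
move=> [sX xX] [sY yY]; split; first exact: (smooth_field_add oW sX sY).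
by move=> z Wz; rewrite smooth_onD (xX z Wz) (yY z Wz).
Qed.

Lemma repr_sub X x Y y : represents X x -> represents Y y ->
  represents (fun z => X z - Y z) (x - y).
Proof.
move=> [sX xX] [sY yY]; split; first exact: (smooth_fieldB oW sX sY).
by move=> z Wz; rewrite smooth_onB (xX z Wz) (yY z Wz).
Qed.

Lemma repr0 : represents (fun=> 0) 0.
Proof. by split=> //; apply: smooth_field0. Qed.

Lemma repr_opp X x : represents X x -> represents (fun z => - X z) (- x).
Proof.
move=> rX; have := repr_sub repr0 rX; rewrite sub0r => r0.
by apply: (repr_eq r0) => z _; rewrite sub0r.
Qed.

Definition br_on (x y : sec) : sec := restrict W (bracket x y).
Definition D_on (x y : sec) : sec := restrict W (D x y).
Definition J_on (x : sec) : sec := restrict W (Jf x).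
Definition h_on (x : sec) : sec := restrict W (app1 (hproj E) x).
Definition G_on (x : sec) : sec := restrict W (fun z => barthel E z (x z)).
Definition F_on (x : sec) : sec := restrict W (app1 (Fmap E) x).
Definition S_on : sec := restrict W (spray E).

Lemma repr_br X x Y y : represents X x -> represents Y y -> represents (bracket X Y) (br_on x y).
Proof.
move=> [sX xX] [sY yY]; have sx := smooth_on_smooth x; have sy := smooth_on_smooth y.
apply: (repr_eq (repr_restrict (smooth_bracket oW sx sy))) => z Wz.
exact: (bracket_local oW Wz sx sy xX yY).
Qed.

Lemma repr_D X x Y y : represents X x -> represents Y y -> represents (D X Y) (D_on x y).
Proof.
move=> [sX xX] [sY yY]; have sx := smooth_on_smooth x; have sy := smooth_on_smooth y.
apply: (repr_eq (repr_restrict (conn_smooth lD oW Ws sx sy))) => z Wz.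
exact: (conn_local lD oW Ws Wz sx sy xX yY).
Qed.

Lemma repr_J X x : represents X x -> represents (Jf X) (J_on x).
Proof.
move=> [sX xX]; have sx := smooth_on_smooth x.
apply: (repr_eq (repr_restrict (smooth_Jf oW sx))) => z Wz.
by rewrite /Jf (xX z Wz).
Qed.

Lemma repr_h X x : represents X x -> represents (app1 (hproj E) X) (h_on x).
Proof.
move=> [sX xX]; have sx := smooth_on_smooth x.
apply: (repr_eq (repr_restrict (smooth_hproj hE oW Ws sx))) => z Wz.
by rewrite /app1 (xX z Wz).
Qed.

Lemma repr_G X x : represents X x -> represents (fun z => barthel E z (X z)) (G_on x).
Proof.
move=> [sX xX]; have sx := smooth_on_smooth x.
apply: (repr_eq (repr_restrict (smooth_barthel hE oW Ws sx))) => z Wz.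
by rewrite (xX z Wz).
Qed.

Lemma repr_F X x : represents X x -> represents (app1 (Fmap E) X) (F_on x).
Proof.
move=> [sX xX]; have sx := smooth_on_smooth x.
apply: (repr_eq (repr_restrict (smooth_Fmap hE oW Ws sx))) => z Wz.
by rewrite /app1 (xX z Wz).
Qed.

Lemma repr_S : represents (spray E) S_on.
Proof. exact: (repr_restrict (smooth_field_sub Ws (smooth_spray hE))). Qed.

(** By the definitions of the Berwald and Cartan connections, [D (J X) (J Y)] and
    [J [J X, Y]] differ by the first Cartan tensor. *)
Lemma repr_cartan1 X x Y y : represents X x -> represents Y y ->
  represents (app2 (cartan1 E) X Y) (torsion_part br_on D_on J_on x y).
Proof.
move=> rX rY; have rJX := repr_J rX.
apply: (repr_eq (repr_sub (repr_D rJX (repr_J rY)) (repr_J (repr_br rJX rY)))) => z Wz.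
have [-> _ _] := hD.2 _ oW Ws _ _ rX.1 rY.1 _ Wz.
have [-> _ _] := hD0.2 _ oW Ws _ _ rX.1 rY.1 _ Wz.
by rewrite addrAC subrr add0r.
Qed.

Lemma repr_curvature A a B b T t : represents A a -> represents B b -> represents T t ->
  represents (curvature D A B T) (curv br_on D_on a b t).
Proof.
move=> rA rB rT.
exact: (repr_sub (repr_sub (repr_D rA (repr_D rB rT)) (repr_D rB (repr_D rA rT)))
  (repr_D (repr_br rA rB) rT)).
Qed.

Lemma repr_hv_curv X x Y y T t : represents X x -> represents Y y -> represents T t ->
  represents (hv_curv E D X Y T) (hv_part br_on D_on J_on h_on x y t).
Proof. by move=> rX rY rT; apply: (repr_curvature (repr_h rX) (repr_J rY) (repr_J rT)). Qed.

Lemma repr_D_hv_curv A a X x Y y T t : represents A a ->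
  represents X x -> represents Y y -> represents T t ->
  represents (D_hv_curv E D A X Y T) (D_hv_part br_on D_on J_on h_on a x y t).
Proof.
move=> rA rX rY rT.
exact: (repr_sub (repr_sub (repr_sub (repr_D rA (repr_hv_curv rX rY rT))
  (repr_hv_curv (repr_D rA rX) rY rT)) (repr_hv_curv rX (repr_D rA rY) rT))
  (repr_hv_curv rX rY (repr_D rA rT))).
Qed.

Lemma repr_Atensor X x Y y Z z T t : represents X x ->
  represents Y y -> represents Z z -> represents T t ->
  represents (Atensor E D X Y Z T) (A_part br_on D_on J_on h_on F_on x y z t).
Proof.
move=> rX rY rZ rT.
exact: (repr_sub (repr_sub (repr_opp (repr_hv_curv (repr_F (repr_cartan1 rZ rX)) rY rT))
  (repr_D_hv_curv (repr_J rX) rY rZ rT)) (repr_D_hv_curv (repr_J rZ) rX rY rT)).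
Qed.

Lemma v_curv_extend X B T z : smooth_field W X -> smooth_field W B ->
  smooth_field W T -> slit_set W z ->
  v_curv D X B T z = v_curv D (extend z (X z)) (extend z (B z)) (extend z (T z)) z.
Proof.
move=> sX sB sT Wz; pose U := slit_set W `&` Tdom (tchart z).
have oU : openTM U by apply: openTM_I; [exact: oW|exact: openTM_Tdom].
have UW : U `<=` slit_set W by move=> t [].
have Uc : U `<=` Tdom (tchart z) by move=> t [].
have Uz : U z by split=> //; apply: Tdom_tchart.
have se a : smooth_field U (extend z a) by apply: smooth_extend.
apply: (v_curv_tensorial lD oU (subset_trans UW Ws) Uz); try exact: se;
  try exact: (smooth_field_sub UW); by rewrite extend_at.
Qed.

Lemma nullity_v_curv X B T z : in_nullityQ E D W X -> smooth_field W B ->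
  smooth_field W T -> slit_set W z -> v_curv D X B T z = 0.
Proof.
move=> [sX nX] sB sT Wz; have [_ null] := nX z Wz.
by rewrite (v_curv_extend sX sB sT Wz) null.
Qed.

Lemma nullity_hproj X z : in_nullityQ E D W X -> slit_set W z -> hproj E z (X z) = X z.
Proof.
move=> [_ nX] Wz; have [[a _ <-] _] := nX z Wz; exact: (hprojK hE _ (Ws Wz)).
Qed.

(** The fields on [W] satisfy the hypotheses of [nullity_bracket]. *)
Lemma v_curv_bracket X Y Z T z : in_nullityQ E D W X -> in_nullityQ E D W Y ->
  smooth_field W Z -> smooth_field W T -> slit_set W z ->
  v_curv D (bracket X Y) Z T z = Atensor E D Y X Z T z - Atensor E D X Y Z T z.
Proof.
move=> nX nY sZ sT.
have rX := repr_restrict nX.1; have rY := repr_restrict nY.1.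
have rZ := repr_restrict sZ; have rT := repr_restrict sT.
have rs := repr_self; have sl : forall t, slit_set W t -> slitTM t := Ws.
move: (restrict W X) (restrict W Y) (restrict W Z) (restrict W T) rX rY rZ rT.
move=> x y u t rX rY rZ rT Wz.
have hX : h_on x = x.
  by apply: (repr_inj (repr_h rX) rX) => s Ws'; apply: nullity_hproj.
have hY : h_on y = y.
  by apply: (repr_inj (repr_h rY) rY) => s Ws'; apply: nullity_hproj.
have null X' x' : represents X' x' -> in_nullityQ E D W X' ->
    forall b v, curv br_on D_on (J_on x') (J_on b) (J_on v) = 0.
  move=> rX' nX' b v.
  apply: (repr_inj (repr_curvature (repr_J rX') (repr_J (rs b)) (repr_J (rs v))) repr0).
  by move=> s Ws'; apply: (nullity_v_curv nX' (smooth_on_smooth b) (smooth_on_smooth v) Ws').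
have rL := repr_curvature (repr_J (repr_br rX rY)) (repr_J rZ) (repr_J rT).
have rR := repr_sub (repr_Atensor rY rX rZ rT) (repr_Atensor rX rY rZ rT).
apply: (repr_fun rL rR _ Wz).
apply: (@nullity_bracket R sec (@smooth_on_sep _ _ _ W) br_on D_on J_on h_on G_on F_on S_on).
- move=> a b c.
  apply: (repr_inj (repr_br (repr_add (rs a) (rs b)) (rs c))
    (repr_add (repr_br (rs a) (rs c)) (repr_br (rs b) (rs c)))) => s Ws'.
  exact: (bracket_add c oW Ws' (smooth_on_smooth a) (smooth_on_smooth b)).
- move=> a b; apply: (repr_inj (repr_br (rs a) (rs b)) (repr_opp (repr_br (rs b) (rs a)))).
  by move=> s _; apply: bracketC.
- move=> a b c.
  apply: (repr_inj (repr_add (repr_add (repr_br (rs a) (repr_br (rs b) (rs c)))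
    (repr_br (rs b) (repr_br (rs c) (rs a))))
    (repr_br (rs c) (repr_br (rs a) (rs b)))) repr0) => s Ws'.
  exact: (Jacobi oW Ws' (smooth_on_smooth a) (smooth_on_smooth b) (smooth_on_smooth c)).
- move=> a b.
  apply: (repr_inj (repr_J (repr_add (rs a) (rs b))) (repr_add (repr_J (rs a)) (repr_J (rs b)))).
  by move=> s Ws'; apply: JmapD.
- move=> a; apply: (repr_inj (repr_J (repr_J (rs a))) repr0) => s _; exact: JmapJ.
- move=> a b.
  apply: (repr_inj (repr_br (repr_J (rs a)) (repr_J (rs b)))
    (repr_add (repr_J (repr_br (repr_J (rs a)) (rs b)))
              (repr_J (repr_br (rs a) (repr_J (rs b)))))) => s Ws'.
  exact: (nijenhuis_Jf oW Ws' (smooth_on_smooth a) (smooth_on_smooth b)).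
- move=> a.
  apply: (repr_inj (repr_G (rs a)) (repr_sub (repr_br (repr_J (rs a)) repr_S)
     (repr_J (repr_br (rs a) repr_S)))) => s Ws'.
  exact: (barthel_bracket E oW Ws Ws' (smooth_on_smooth a)).
- move=> a.
  apply: (repr_inj (repr_add (repr_h (rs a)) (repr_h (rs a))) (repr_add (rs a) (repr_G (rs a)))) => s Ws'.
  by rewrite /app1 hproj_double.
- move=> a b.
  apply: (repr_inj (repr_h (repr_add (rs a) (rs b))) (repr_add (repr_h (rs a)) (repr_h (rs b)))).
  by move=> s Ws'; apply: (hprojD E _ _ (sl s Ws')).
- move=> a; apply: (repr_inj (repr_J (repr_h (rs a))) (repr_J (rs a))) => s Ws'.
  exact: (Jmap_hproj hE _ (sl s Ws')).
- move=> a; apply: (repr_inj (repr_h (repr_J (rs a))) repr0) => s Ws'.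
  exact: (hproj_Jmap hE _ (sl s Ws')).
- move=> a b.
  apply: (repr_inj (repr_F (repr_add (rs a) (rs b))) (repr_add (repr_F (rs a)) (repr_F (rs b)))).
  by move=> s Ws'; apply: (FmapD hE _ _ (sl s Ws')).
- move=> a; apply: (repr_inj (repr_F (repr_J (rs a))) (repr_h (rs a))) => s Ws'.
  exact: (Fmap_Jmap hE _ (sl s Ws')).
- move=> a; apply: (repr_inj (repr_J (repr_F (rs a))) (repr_sub (rs a) (repr_h (rs a)))) => s Ws'.
  exact: (Jmap_Fmap hE _ (sl s Ws')).
- move=> a; apply: (repr_inj (repr_h (repr_F (rs a))) (repr_add (repr_F (rs a)) (repr_J (rs a)))) => s Ws'.
  exact: (hproj_Fmap hE _ (sl s Ws')).
- move=> a b c.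
  apply: (repr_inj (repr_D (repr_add (rs a) (rs b)) (rs c))
    (repr_add (repr_D (rs a) (rs c)) (repr_D (rs b) (rs c)))) => s Ws'.
  exact: (connDl lD oW Ws Ws' (smooth_on_smooth a) (smooth_on_smooth b) (smooth_on_smooth c)).
- move=> a b c.
  apply: (repr_inj (repr_D (rs a) (repr_add (rs b) (rs c)))
    (repr_add (repr_D (rs a) (rs b)) (repr_D (rs a) (rs c)))) => s Ws'.
  exact: (connDr lD oW Ws Ws' (smooth_on_smooth a) (smooth_on_smooth b) (smooth_on_smooth c)).
- move=> a b.
  apply: (repr_inj (repr_D (rs a) (repr_F (rs b))) (repr_F (repr_D (rs a) (rs b)))) => s Ws'.
  by have [_ _] := hD.2 _ oW Ws _ _ (smooth_on_smooth a) (smooth_on_smooth b) _ Ws'.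
- move=> a b; apply: (repr_inj (repr_cartan1 (rs a) (rs b)) (repr_cartan1 (rs b) (rs a))) => s Ws'.
  exact: (cartan1C hE _ _ (sl s Ws')).
- move=> a b; apply: (repr_inj (repr_J (repr_cartan1 (rs a) (rs b))) repr0) => s Ws'.
  exact: (cartan1_vert hE _ _ (sl s Ws')).
- move=> a b; apply: (repr_inj (repr_J (repr_D (repr_h (rs a)) (repr_J (rs b)))) repr0) => s Ws'.
  have sa := smooth_on_smooth a; have sb := smooth_on_smooth b.
  rewrite /Jf; have [_ -> _] := hD.2 _ oW Ws _ _ sa sb _ Ws'.
  have [_ -> _] := hD0.2 _ oW Ws _ _ sa sb _ Ws'.
  rewrite /app1 /app2 vprojE JmapD JmapB (Jmap_hproj hE _ (sl s Ws')) subrr add0r.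
  exact: (cartan2_vert hE _ _ (sl s Ws')).
- exact: hX.
- exact: hY.
- exact: (null _ _ rX nX).
- exact: (null _ _ rY nY).
Qed.

End Identity.

(** * Global fields with a prescribed value *)

Section BumpFunction.
Context {R : realType}.
Implicit Types t x y : R.

(** With the powers of [t^-1] as factors, the family is stable under derivation
    up to linear combinations; a single induction then proves smoothness. *)
Definition flat (m : nat) (t : R) : R :=
  if 0 < t then t^-1 ^+ m * expR (- t^-1) else 0.

Lemma flat_gt0 m t : 0 < t -> 0 < flat m t.
Proof. by move=> t0; rewrite /flat t0 mulr_gt0 ?expR_gt0// exprn_gt0// invr_gt0. Qed.

Lemma flat_le0 m t : t <= 0 -> flat m t = 0.
Proof. by move=> t0; rewrite /flat ltNge t0. Qed.

(** [exp u >= (u / N) ^ N] for [u >= 0], so that the flat functions are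
    quadratically small at [0]. *)
Lemma flat_small m : exists2 C : R, 0 < C & forall t, `|flat m t| <= C * t ^+ 2.
Proof.
pose N : R := m.+2%:R; have N0 : 0 < N by rewrite ltr0n.
exists (N ^+ m.+2) => [|t]; first by rewrite exprn_gt0.
have [t0|t0] := leP t 0.
  by rewrite flat_le0// normr0 mulr_ge0 ?sqr_ge0// exprn_ge0 ?ltW.
rewrite gtr0_norm ?flat_gt0// /flat t0.
have u0 : 0 < t^-1 by rewrite invr_gt0.
have E : (t^-1 / N) ^+ m.+2 <= expR t^-1.
  have -> : expR t^-1 = expR (t^-1 / N) ^+ m.+2.
    by rewrite -expRM_natl /N mulrC divfK// lt0r_neq0.
  rewrite lerXn2r ?nnegrE ?expR_ge0 ?divr_ge0 ?ltW//.
  by apply: lt_le_trans (expR_ge1Dx _); rewrite ltrDr.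
rewrite expRN -ler_pdivlMr ?invr_gt0 ?expR_gt0// invrK.
apply: le_trans (ler_wpM2l _ E); last by rewrite mulr_ge0 ?exprn_ge0 ?ltW.
have : N ^+ m.+2 != 0 by rewrite expf_neq0// lt0r_neq0.
rewrite expr_div_n; move: (N ^+ m.+2) => q q0; rewrite -(addn2 m) exprD.
move: (t^-1 ^+ m) => p; rewrite le_eqVlt; apply/orP; left; apply/eqP.
by field; rewrite q0 lt0r_neq0.
Qed.

Lemma flat_der m x : has_der (flat m) x /\
  der (flat m) x = fun v => v * (flat m.+2 x - m%:R * flat m.+1 x).
Proof.
have [x0|x0|->] := ltgtP x 0.
- have oA : open [set t : R | t < 0] by exact: open_lt.
  have [d1 E1] := der_cst (0 : R) x.
  have [d2 E2] := der_eq_on (g := flat m) oA x0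
    (fun y (y0 : y < 0) => esym (flat_le0 m (ltW y0))) d1.
  split=> //; rewrite E2 E1; apply/funext => v.
  by rewrite !flat_le0 ?ltW// mulr0 subr0 mulr0.
- have oA : open [set t : R | 0 < t] by exact: open_gt.
  have xn : x != 0 by rewrite lt0r_neq0.
  pose p (u : R) : R := u ^+ m * expR (- u).
  have dp u : has_der p u /\ der p u = fun v => v * ((m%:R * u ^+ m.-1 - u ^+ m) * expR (- u)).
    have dN : is_derive u 1 (fun u : R => expR (- u)) (- expR (- u)).
      have := is_derive1_comp (is_derive_expR (- u)) (is_deriveN (is_derive_id u (1 : R))).
      by rewrite mulrN1; exact.
    have := is_deriveM (is_deriveX m (is_derive_id u (1 : R))) dN.
    have <- : p = id ^+ m * (fun u : R => expR (- u)).
      by apply/funext => y; rewrite /p /GRing.mul/= exprfctE.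
    move=> /der_derive1[d E]; split; first exact: d.
    by rewrite E; apply/funext => v; rewrite exprfctE /GRing.scale/= mulr1; ring.
  have [d1 E1] := der_id x; have [d2 E2] := der_inv d1 xn.
  have [d3 E3] := dp x^-1; have [d4 E4] := der_comp d2 d3.
  have Eg y : 0 < y -> p y^-1 = flat m y by move=> y0; rewrite /p /flat y0.
  have [d5 E5] := der_eq_on oA x0 Eg d4.
  split; first exact: d5.
  rewrite E5 E4 E3 E2 E1; apply/funext => v; rewrite /flat x0 -exprVn.
  by case: m {p dp d3 E3 d4 E4 Eg d5 E5} => [|m]; rewrite /= ?exprS; ring.
- apply: der_derive1; rewrite !flat_le0// mulr0 subr0.
  have [C C0 small] := flat_small m.
  suff L : (fun h : R => h^-1 *: ((flat m \o shift 0) (h *: 1) - flat m 0)) @ 0^' --> 0.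
    by split; [apply/cvg_ex; exists 0|exact: (cvg_lim (@Rhausdorff R) L)].
  apply/cvgr0Pnorm_lt => e e0; near=> h.
  have h0 : h != 0 by near: h; exact: nbhs_dnbhs_neq.
  have hC : `|h| < e / C by near: h; apply: dnbhs0_lt; rewrite divr_gt0.
  rewrite (flat_le0 m (lexx 0)) subr0 /= addr0 /GRing.scale/= mulr1 normrM normfV.
  apply: (@le_lt_trans _ _ (`|h|^-1 * (C * h ^+ 2))).
    by rewrite ler_wpM2l ?invr_ge0.
  rewrite -(real_normK (num_real h)) expr2 mulrCA mulKf ?normr_eq0// mulrC.
  by rewrite -ltr_pdivlMr.
Unshelve. all: end_near.
Qed.

Lemma flat_smooth m k : Ck k setT (flat m).
Proof.
elim: k m => [|k IH] m.
  by move=> x _; apply: differentiable_continuous; exact: (flat_der m x).1.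
apply/CkS; split=> [x _|v]; first exact: (flat_der m x).1.
have oT : open [set: R] := openT.
have sZ (c : R) (f : R -> R) : Ck k setT f -> Ck k setT (fun x : R => c * f x).
  by move=> sf; apply: (Ck_mul oT (Ck_cst k setT c) sf).
apply: (Ck_ext oT _ (sZ v _ (Ck_minus oT (IH m.+2) (sZ m%:R _ (IH m.+1))))).
by move=> x _; rewrite (flat_der m x).2.
Qed.

End BumpFunction.

Section BumpField.
Context {R : realType} {n : nat} {M : smooth_manifold R n}.
Notation V := (vec R n).

Definition box (x0 : 'rV[R]_n) (r : R) : set 'rV[R]_n :=
  [set x | forall k, `|x 0 k - x0 0 k| <= r].

Definition box_bump (x0 : 'rV[R]_n) (r : R) (x : 'rV[R]_n) : R :=
  \prod_(k < n) flat 0 (r ^+ 2 - (x 0 k - x0 0 k) ^+ 2).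

Lemma box_bump_center x0 r : 0 < r -> 0 < box_bump x0 r x0.
Proof.
move=> r0; apply: prodr_gt0 => k _; apply: flat_gt0.
by rewrite subrr expr0n subr0 exprn_gt0.
Qed.

Lemma box_bump_out x0 r x : 0 < r -> ~ box x0 r x -> box_bump x0 r x = 0.
Proof.
move=> r0 /existsNP[k /negP]; rewrite -ltNge => rk.
rewrite /box_bump (bigD1 k)//= flat_le0 ?mul0r// subr_le0.
by rewrite -[leRHS](real_normK (num_real _)) lerXn2r ?nnegrE ?normr_ge0// ?ltW.
Qed.

Lemma box_bump_smooth x0 r k : Ck k setT (box_bump x0 r).
Proof.
have oT : open [set: 'rV[R]_n] := openT.
apply: (Ck_prod _ oT) => i.
have s1 : Ck k setT (fun x : 'rV[R]_n => x 0 i).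
  exact: (@Ck_linear _ _ _ k setT (rV_coord i) oT (@coord_continuous R 1 n 0 i)).
have s2 := Ck_minus oT s1 (Ck_cst k setT (x0 0 i)).
have s3 := Ck_minus oT (Ck_cst k setT (r ^+ 2)) (Ck_mul oT s2 s2).
exact: (Ck_comp (@framed_real R) oT _ s3 (flat_smooth 0 k)).
Qed.

Lemma box_sub (A : set 'rV[R]_n) x0 : open A -> A x0 -> exists2 r, 0 < r & box x0 r `<=` A.
Proof.
move=> oA Ax; have /nbhs_ballP[e e0 eA] : nbhs x0 A by apply: open_nbhs_nbhs.
exists (e / 2); first by rewrite divr_gt0.
move=> x xb; apply: eA; split=> // i k; rewrite ord1 /ball/= distrC.
by apply: le_lt_trans (xb k) _; rewrite ltr_pdivrMr// ltr_pMr// ltr1n.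
Qed.

Lemma box_compact x0 r : compact (box x0 r).
Proof.
have -> : box x0 r =
    [set x : 'rV[R]_n | forall k, `[x0 0 k - r, x0 0 k + r]%classic (x ord0 k)].
  by apply/seteqP; split=> x xb k; have := xb k; rewrite /= in_itv/= ler_distl.
apply: (@rV_compact R n (fun k => `[x0 0 k - r, x0 0 k + r]%classic)) => k.
exact: segment_compact.
Qed.

Lemma openTM_foot (F : set M) : closed F -> openTM [set z : TM M | ~ F (foot z)].
Proof.
move=> cF i.
have -> : tcoord i [set z : TM M | ~ F (foot z)] =
    [set w | [set x | cran i x /\ (~` F) (cpsi i x)] w.1] by apply/seteqP; split=> w [].
apply: open_fst.
exact: open_cpsi_preimage (closed_openC cF).
Qed.

(** The extension from a chart is cut off by a bump function on the base. The
    support of the latter is compact in the chart, hence closed in the Hausdorff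
    manifold, so that the product extended by 0 is smooth. *)
Lemma global_extension (z0 : TM M) (b : V) :
  exists2 Z : TM M -> V, smooth_field slitTM Z & Z z0 = b.
Proof.
set c := tchart z0; have z0c : Tdom c z0 := Tdom_tchart z0.
pose x0 := cphi c (foot z0).
have [r r0 rc] := box_sub (@open_cran _ _ M c) (cran_cphi z0c).
pose f (z : TM M) : R :=
  (box_bump x0 r x0)^-1 * if `[< Tdom c z >] then box_bump x0 r (cphi c (foot z)) else 0.
exists (fun z => f z *: extend z0 b z); last first.
  by rewrite /f asboolT// mulVf ?scale1r ?extend_at// gt_eqF// box_bump_center.
have cK : closed (cpsi c @` box x0 r).
  apply: compact_closed; first exact: hausdorff_mpoint.
  apply: continuous_compact; last exact: box_compact.
  exact: continuous_subspaceW rc (@continuous_cpsi _ _ M c).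
have oS := @openTM_slit R n M.
apply: (smooth_field_local oS) => z zs; exists (tchart z).
have [zc|zc] := pselect (Tdom c z).
  pose U := slitTM `&` Tdom c : set (TM M).
  have oU : openTM U by apply: openTM_I => //; apply: openTM_Tdom.
  exists U; split=> // [|k]; first exact: Tdom_tchart.
  have se : smooth_field U (extend z0 b) by apply: smooth_extend => // t [].
  have sf : smooth_fun U f.
    apply: (smooth_fun_local oU) => t Ut; exists c, U; split=> // [|k']; first exact: Ut.2.
    have s1 := Ck_comp framed_rVn (oU c) (fun _ _ => I) (Ck_fst k' (oU c))
      (box_bump_smooth x0 r k').
    apply: (Ck_ext (oU c) _ (Ck_mul (oU c) (Ck_cst k' _ (box_bump x0 r x0)^-1) s1)) => w [wc Uw].
    rewrite /f /= asboolT; last exact: Uw.2.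
    by rewrite (cranP wc).2.
  exact: (smooth_field_scale oU sf se (tchart z) k).
pose N := slitTM `&` [set t : TM M | ~ (cpsi c @` box x0 r) (foot t)] : set (TM M).
have oN : openTM N by apply: openTM_I => //; apply: openTM_foot.
have Nz : N z.
  by split=> // -[x /rc/cranP[xc _] xz]; apply: zc; rewrite /Tdom /= -xz.
exists N; split=> // [|k]; first exact: Tdom_tchart.
have f0 t : N t -> 0 = f t *: extend z0 b t.
  move=> [_ Nt]; rewrite /f; case: asboolP => [tc|_]; last by rewrite mulr0 scale0r.
  have [tb|tb] := pselect (box x0 r (cphi c (foot t))); last first.
    by rewrite (box_bump_out r0 tb) mulr0 scale0r.
  case: Nt.
  by exists (cphi c (foot t)) => //; apply: cphiK.
exact: (smooth_field_eq oN f0 (@smooth_field0 R n M N) (tchart z) k).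
Qed.

End BumpField.

(** * Integrability of the nullity distribution *)

Section Integrability.
Context {R : realType} {n : nat} {M : smooth_manifold R n}.
Variables (E : TM M -> R) (hE : finsler E).
Notation V := (vec R n).
Notation field := (TM M -> V).

Lemma horizontalP z a : slitTM z -> horizontal E z a <-> hproj E z a = a.
Proof.
by move=> zs; split=> [[b _ <-]|ha]; [apply: (hprojK hE _ zs)|exists a].
Qed.

(** In [[h, h] / 2] all brackets are [[X, Y]] when [h X = X] and [h Y = Y], and
    [h h = h]. *)
Lemma barthel_curvature_horizontal (W : set (TM M)) (X Y : field) z :
  openTM W -> W `<=` slitTM -> smooth_field W X -> smooth_field W Y ->
  (forall t, W t -> hproj E t (X t) = X t) ->
  (forall t, W t -> hproj E t (Y t) = Y t) -> W z ->
  barthel_curvature E X Y z = hproj E z (bracket X Y z) - bracket X Y z.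
Proof.
move=> oW Ws sX sY hX hY Wz; have zs := Ws z Wz.
have sHX := smooth_hproj hE oW Ws sX; have sHY := smooth_hproj hE oW Ws sY.
have eX t : W t -> app1 (hproj E) X t = X t by exact: hX.
have eY t : W t -> app1 (hproj E) Y t = Y t by exact: hY.
rewrite /barthel_curvature /fn_square.
rewrite (bracket_local oW Wz sHX sHY eX eY).
rewrite (bracket_local oW Wz sHX sY eX (fun t _ => erefl (Y t))).
rewrite (bracket_local oW Wz sX sHY (fun t _ => erefl (X t)) eY).
rewrite (hprojK hE _ zs).
move: (bracket X Y z) (hproj E z _) => p q.
rewrite scalerA mulNr mulVf ?pnatr_eq0// scaleN1r.
by rewrite addrK opprB.
Qed.

End Integrability.

Theorem theorem6p3 (R : realType) (n : nat) (M : smooth_manifold R n)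
  (E : TM M -> R) (hE : finsler E)
  (D0 D : (TM M -> vec R n) -> (TM M -> vec R n) -> (TM M -> vec R n))
  (hD0 : berwald_connection E D0) (hD : cartan_connection E D0 D)
  (U : set (TM M)) (hU : openTM U) (k : nat)
  (hmu : forall z, (U `&` slitTM) z -> has_dim (nullityQ E D z) k) :
  nullityQ_integrable E D (U `&` slitTM) <->
  (forall X Y : TM M -> vec R n,
     in_nullityQ E D (U `&` slitTM) X -> in_nullityQ E D (U `&` slitTM) Y ->
     (forall z, (U `&` slitTM) z -> barthel_curvature E X Y z = 0) /\
     (forall Z T : TM M -> vec R n,
        smooth_field slitTM Z -> smooth_field slitTM T ->
        forall z, (U `&` slitTM) z ->
          Atensor E D X Y Z T z = Atensor E D Y X Z T z)).
Proof.
pose W := @SlitOpen R n M (U `&` slitTM) (openTM_I hU (@openTM_slit R n M))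
  (@subIsetr _ U slitTM).
have oW : openTM (slit_set W) := @slit_set_open _ _ _ W.
have Ws : slit_set W `<=` slitTM := @slit_set_sub _ _ _ W.
change (U `&` slitTM) with (slit_set W).
have curvE X Y : in_nullityQ E D W X -> in_nullityQ E D W Y -> forall z, slit_set W z ->
    barthel_curvature E X Y z = hproj E z (bracket X Y z) - bracket X Y z.
  move=> nX nY z Wz; apply: (barthel_curvature_horizontal hE oW Ws nX.1 nY.1 _ _ Wz).
    by move=> t Wt; apply: (nullity_hproj hE nX Wt).
  by move=> t Wt; apply: (nullity_hproj hE nY Wt).
split=> [int X Y nX nY|H X Y nX nY].
  have nB := int X Y nX nY; split=> [z Wz|Z T sZ sT z Wz].
    by rewrite (curvE X Y nX nY z Wz) (nullity_hproj hE nB Wz) subrr.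
  have sZW := smooth_field_sub Ws sZ; have sTW := smooth_field_sub Ws sT.
  have B0 := nullity_v_curv hD nB sZW sTW Wz.
  have BA := v_curv_bracket hE hD0 hD nX nY sZW sTW Wz.
  by apply/esym/eqP; rewrite -subr_eq0 -BA B0.
have [R0 Asym] := H X Y nX nY; have sB := smooth_bracket oW nX.1 nY.1.
split=> // z Wz; split.
  apply/(horizontalP hE _ (Ws z Wz))/eqP; rewrite -subr_eq0.
  by rewrite -(curvE X Y nX nY z Wz) (R0 z Wz).
(* [b] and [c] are values of global fields, on which the symmetry of [A] is
   assumed. *)
move=> b c; have [Z sZ Zb] := global_extension z b.
have [T sT Tc] := global_extension z c.
have sZW := smooth_field_sub Ws sZ; have sTW := smooth_field_sub Ws sT.
rewrite -Zb -Tc -(v_curv_extend hD sB sZW sTW Wz).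
rewrite (v_curv_bracket hE hD0 hD nX nY sZW sTW Wz) (Asym Z T sZ sT z Wz).
exact: subrr.
Qed.
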